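(* Let $k$ be a positive integer with $k\equiv0\pmod 4$. Let $\alpha$ and $\beta$ be positive real numbers with $\alpha+\beta=1$. Let $f(z)$ be a holomorphic cusp form of weight $k$ on $\Gamma_0(q)$, and let $f(z)=\sum_{n=1}^\infty a_f(n)e^{2\pi inz}$ be its Fourier expansion at the cusp $i\infty$. Assume that $a_f(1)=1$, $Wf=f$, and $f(iy)>0$ for any $y>0$. Then $$L^\ast(s,f)=2\sum_{m=0}^\infty\sum_{n=0}^\infty c_{f,\alpha}(m)\,c_{f,\beta}(n)\Bigl(\frac{n+\beta}{m+\alpha}\Bigr)^{\frac{s-k\beta}{2}}K_{s-k\beta}\Bigl(\frac{4\pi}{\sqrt q}\sqrt{(m+\alpha)(n+\beta)}\Bigr)$$ for any $s\in\mathbb{C}$. In particular, taking $\alpha=\beta=1/2$, $$L^\ast(s,f)=2\sum_{m=0}^\infty\sum_{n=0}^\infty c_{f,\frac12}(m)\,c_{f,\frac12}(n)\Bigl(\frac{2n+1}{2m+1}\Bigr)^{\frac s2-\frac k4}K_{s-\frac k2}\Bigl(\frac{2\pi}{\sqrt q}\sqrt{(2m+1)(2n+1)}\Bigr).$$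
   Context: $\Gamma_0(q)$ is the group of matrices in $SL_2(\mathbb{Z})$ whose lower-left entry is divisible by $q$. The completed $L$-function is $$L^\ast(s,f)=q^{\frac s2}(2\pi)^{-s}\Gamma(s)\sum_{n=1}^\infty a_f(n)n^{-s},$$ where the series converges absolutely for $\mathrm{Re}(s)>(k+1)/2$; $L^\ast(s,f)$ is continued to an entire function. The Fricke involution is $Wf(z)=q^{-k/2}z^{-k}f\bigl(-\frac{1}{qz}\bigr)$. When $a_f(1)=1$ and $f(iy)>0$ for all $y>0$, for real $\alpha>0$ the numbers $c_{f,\alpha}(m)$ $(m=0,1,2,\dots)$ are defined by the expansion $$f(iy)^\alpha=e^{-2\pi\alpha y}\Bigl(1+\sum_{n=2}^\infty a_f(n)e^{-2\pi(n-1)y}\Bigr)^\alpha=e^{-2\pi\alpha y}\sum_{j=0}^\infty\binom{\alpha}{j}\Bigl(\sum_{n=2}^\infty a_f(n)e^{-2\pi(n-1)y}\Bigr)^j=\sum_{m=0}^\infty c_{f,\alpha}(m)e^{-2\pi(m+\alpha)y},$$ where $f(iy)^\alpha=\exp(\alpha\log f(iy))$. $K_\nu$ is the $K$-Bessel function, $K_\nu(x)=\frac12\int_0^\infty e^{-\frac{x}{2}(t+\frac1t)}t^{-\nu}\frac{dt}{t}$ for $x>0$, $\nu\in\mathbb{C}$.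
   Formalization: Added: the defining expansion of f(iy)^α (and of f(iy)^β) in the numbers c_{f,α}(m) is assumed to hold for every y>0; without it the double series can diverge, e.g. for f=ΔE_4, q=1, k=16, α=β=1/2. *)

(* Defs.v *)
(* Stdlib real numbers with Coquelicot. *)
From Stdlib Require Import Reals ZArith Arith.
From Coquelicot Require Import Coquelicot.
Local Open Scope R_scope.

Definition Cexp (z : C) : C := (exp (Re z) * cos (Im z), exp (Re z) * sin (Im z)).

(* x ^ w for a real base x > 0, through the real logarithm. *)
Definition Rcpow (x : R) (w : C) : C := Cexp (w * RtoC (ln x))%C.

Definition integral_0_infty (h : R -> C) : C :=
  @RInt_gen C_R_CompleteNormedModule h (at_right 0) (Rbar_locally p_infty).

(* Euler's integral: this is the Gamma function for 0 < Re s, and it is only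
   used there. *)
Definition Gamma (s : C) : C :=
  integral_0_infty (fun t => RtoC (exp (- t)) * Rcpow t (s - RtoC 1))%C.

(* For 0 < x. *)
Definition BesselK (nu : C) (x : R) : C :=
  (RtoC (/ 2) *
   integral_0_infty (fun t =>
     RtoC (exp (- (x / 2) * (t + / t))) * Rcpow t (- nu) * RtoC (/ t)))%C.

Definition C_series (u : nat -> C) (l : C) : Prop :=
  @is_series C_AbsRing C_NormedModule u l.

(* sum_{m >= 0} sum_{n >= 0} u m n = l, as an iterated sum. *)
Definition C_double_series (u : nat -> nat -> C) (l : C) : Prop :=
  exists r : nat -> C, (forall m, C_series (u m) (r m)) /\ C_series r l.

Definition C_differentiable (f : C -> C) (z : C) : Prop :=
  @ex_derive C_AbsRing C_NormedModule f z.

Definition entire (f : C -> C) : Prop := forall z : C, C_differentiable f z.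

(* A function on the upper half-plane is a total function C -> C whose values
   outside 0 < Im z are never used. *)
Definition upper (z : C) : Prop := 0 < Im z.

Definition SL2Z (a b c d : Z) : Prop := (a * d - b * c = 1)%Z.

Definition slash (k : nat) (a b c d : Z) (f : C -> C) (z : C) : C :=
  (/ (RtoC (IZR c) * z + RtoC (IZR d)) ^ k
   * f ((RtoC (IZR a) * z + RtoC (IZR b)) / (RtoC (IZR c) * z + RtoC (IZR d))))%C.

(* Holomorphic cusp form of weight k on Gamma_0(q).  Every cusp is the image of
   i oo under some gamma in SL_2(Z), so vanishing at all cusps is: each
   f |_k gamma tends to 0 as Im z -> +oo, uniformly in Re z. *)
Definition cusp_form (k q : nat) (f : C -> C) : Prop :=
  (forall z, upper z -> C_differentiable f z) /\
  (forall a b c d : Z, SL2Z a b c d -> (Z.of_nat q | c)%Z ->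
     forall z, upper z -> slash k a b c d f z = f z) /\
  (forall a b c d : Z, SL2Z a b c d ->
     forall eps : R, 0 < eps ->
     exists Y : R, 0 < Y /\
       forall z, Y <= Im z -> Cmod (slash k a b c d f z) < eps).

(* In all series below the index starts at 1, hence the S n; the value a 0
   plays no role. *)
Definition fourier_expansion (f : C -> C) (a : nat -> C) : Prop :=
  forall z, upper z ->
    C_series (fun n => a (S n) * Cexp (RtoC (2 * PI * INR (S n)) * Ci * z))%C (f z).

Definition fricke (k q : nat) (f : C -> C) (z : C) : C :=
  (RtoC (Rpower (INR q) (- (INR k / 2))) * / z ^ k
   * f (- (RtoC 1 / (RtoC (INR q) * z))))%C.

(* Lambda is the entire continuation of
   q^(s/2) (2 pi)^(-s) Gamma(s) sum_{n >= 1} a n * n^(-s),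
   given by the series for Re s > (k+1)/2. *)
Definition completed_L (k q : nat) (a : nat -> C) (Lambda : C -> C) : Prop :=
  entire Lambda /\
  forall s : C, (INR k + 1) / 2 < Re s ->
    exists D : C,
      C_series (fun n => a (S n) * Rcpow (INR (S n)) (- s))%C D /\
      Lambda s =
        (Rcpow (INR q) (s / RtoC 2) * Rcpow (2 * PI) (- s) * Gamma s * D)%C.

(* The positive values of f on the imaginary axis, as real numbers. *)
Definition on_axis (f : C -> C) (y : R) : R := Re (f (0, y)).

Definition positive_on_axis (f : C -> C) : Prop :=
  forall y : R, 0 < y -> Im (f (0, y)) = 0 /\ 0 < on_axis f y.

Fixpoint binom (alpha : R) (j : nat) : R :=
  match j with
  | O => 1
  | S i => binom alpha i * (alpha - INR i) / INR (S i)
  end.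

(* Formal power series are given by their coefficient sequences. *)
Definition ps_mul (u v : nat -> C) (m : nat) : C :=
  @sum_n C_AbelianMonoid (fun i => u i * v (m - i)%nat)%C m.

Fixpoint ps_pow (u : nat -> C) (j : nat) : nat -> C :=
  match j with
  | O => fun m => match m with O => RtoC 1 | S _ => RtoC 0 end
  | S i => ps_mul u (ps_pow u i)
  end.

(* Coefficients of sum_{n >= 2} a n * X^(n-1), where X = e^(-2 pi y). *)
Definition tail_coeff (a : nat -> C) (n : nat) : C :=
  match n with O => RtoC 0 | S _ => a (S n) end.

(* c_{f,alpha}(m): coefficient of X^m in
   sum_j binom(alpha,j) * (sum_{n >= 2} a n * X^(n-1))^j.
   The j-th power is divisible by X^j, so only j <= m contributes. *)
Definition c_coeff (a : nat -> C) (alpha : R) (m : nat) : C :=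
  @sum_n C_AbelianMonoid
    (fun j => RtoC (binom alpha j) * ps_pow (tail_coeff a) j m)%C m.

(* The expansion f(iy)^alpha = sum_m c_{f,alpha}(m) e^(-2 pi (m + alpha) y)
   holds for every y > 0.  For large y this is automatic; down to y = 0 it is
   not: a zero of f in the upper half-plane may be a branch point of f^alpha,
   and then the c_{f,alpha}(m) grow exponentially and the Bessel double series
   diverges (e.g. f = Delta * E_4, q = 1, k = 16, alpha = 1/2). *)
Definition power_expansion (f : C -> C) (a : nat -> C) (alpha : R) : Prop :=
  forall y : R, 0 < y ->
    C_series
      (fun m => c_coeff a alpha m * RtoC (exp (- (2 * PI * (INR m + alpha) * y))))%C
      (RtoC (Rpower (on_axis f y) alpha)).

(* Main.v *)
Require Import Defs.
From Stdlib Require Import Reals ZArith Arith Lra Lia Psatz ClassicalEpsilon.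
From Coquelicot Require Import Coquelicot.
Local Open Scope R_scope.

(** Put [g(y) = f(iy / sqrt q)].  The Fricke relation reads [g(1/y) = y^k g(y)], so
    [L(s) = int g(y) y^(s-1) dy = int g(y)^alpha g(1/y)^beta y^(s - k beta - 1) dy]; inserting
    the two power expansions and integrating term by term gives the Bessel functions.

    The interchange is absolute because [c_(f,alpha)(m)] grows polynomially: the
    Dirichlet series of [f] converges somewhere, so [a_f(n)] grows polynomially; on each ray of
    the unit disk [|sum_m c_(f,alpha)(m) X^m|] equals [|sum_n a_f(n+1) X^n|^alpha], also across
    zeros of [f], and Cauchy's estimate applies.

    The Mellin integral equals [L(s)] for [Re s] large.  Equality everywhere is unique
    continuation for a function [E] that is only assumed complex differentiable: Goursat's
    theorem for [E(z) exp(N (z - c)^2)] on a rectangle with left side through [c] and right side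
    where [E = 0] makes the Gaussian average of [E] around [c] exponentially small in [N]. *)

(** * Complex differentiability and the exponential *)

(** The obstacle is that [f] may vanish off the imaginary axis: no branch of [f ^ alpha] is
    available on the disk where Cauchy's estimate is wanted, and [power_expansion] speaks only of
    positive [X]. There the power satisfies [A c' = alpha A' c], an identity between coefficients,
    hence valid in every direction. Along a ray the squared moduli of the two series obey the same
    real equation with the same [alpha], and a real non-negative solution can be followed across its
    zeros. As [alpha <= 1], the series of [c] is then bounded by that of [A], which grows
    polynomially towards the unit circle.

    The majorants hold for every [s] at once, because [exp (- a y)] and [exp (- b / y)] absorb any
    power of [y]. So the Mellin integral is known to be entire before it is compared with [L]; the
    comparison for large [Re s] integrates the Fourier series of [f] itself against Gamma integrals.

    Divisibility of [k] by 4 gives [i ^ k = 1], hence the sign in the Fricke relation on the axis.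
    All integrands are measured against [1 / (1 + y ^ 2)]. *)

Notation CV := C_R_CompleteNormedModule.

Lemma norm_CV (z : C) : @norm R_AbsRing C_R_NormedModule z = Cmod z.
Proof. symmetry; apply Cmod_norm. Qed.

Lemma scal_CV (x : R) (z : C) : @scal R_AbsRing C_R_NormedModule x z = (RtoC x * z)%C.
Proof. destruct z; apply injective_projections; cbv; ring. Qed.

Lemma continuous_CV (f : R -> C) (x : R) :
  (forall eps, 0 < eps -> exists d, 0 < d /\
     forall y, Rabs (y - x) < d -> Cmod (f y - f x)%C < eps) ->
  @continuous R_UniformSpace CV f x.
Proof.
  intros H. apply filterlim_locally. intros eps.
  destruct (H eps (cond_pos eps)) as [d [Hd Hy]].
  exists (mkposreal d Hd). intros y By.
  apply C_NormedModule_mixin_compat1. apply Hy, By.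
Qed.

(* The uniform structure of [C] is the sup norm, hence the factor [sqrt 2]. *)
Lemma ball_Cmod (eps : R) : 0 < eps ->
  exists e : posreal, forall x y : C, @ball CV x e y -> Cmod (y - x)%C < eps.
Proof.
  intros Heps. assert (Hs : 0 < sqrt 2) by (apply sqrt_lt_R0; lra).
  assert (He : 0 < eps / sqrt 2) by (apply Rdiv_lt_0_compat; lra).
  exists (mkposreal _ He). intros x y Hy.
  apply (C_NormedModule_mixin_compat2 x y (mkposreal _ He)) in Hy. simpl in Hy.
  replace (sqrt 2 * (eps / sqrt 2)) with eps in Hy by (field; lra). exact Hy.
Qed.

Lemma continuous_CV_inv (f : R -> C) (x : R) :
  @continuous R_UniformSpace CV f x ->
  forall eps, 0 < eps -> exists d, 0 < d /\
     forall y, Rabs (y - x) < d -> Cmod (f y - f x)%C < eps.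
Proof.
  intros H eps Heps. destruct (ball_Cmod eps Heps) as [e He].
  destruct (proj1 (filterlim_locally _ _) H e) as [d Hd].
  exists d. split; [apply cond_pos|]. intros y Hy. apply He, Hd, Hy.
Qed.

Lemma continuous_pair (u v : R -> R) (y : R) : continuous u y -> continuous v y ->
  @continuous R_UniformSpace CV (fun t => (u t, v t) : C) y.
Proof.
  intros Hu Hv. apply filterlim_locally. intros eps.
  destruct (proj1 (filterlim_locally _ _) Hu eps) as [d1 H1].
  destruct (proj1 (filterlim_locally _ _) Hv eps) as [d2 H2].
  assert (Hd : 0 < Rmin d1 d2) by (apply Rmin_glb_lt; apply cond_pos).
  exists (mkposreal _ Hd). intros z Hz. split.
  - apply H1. exact (Rlt_le_trans _ _ _ Hz (Rmin_l _ _)).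
  - apply H2. exact (Rlt_le_trans _ _ _ Hz (Rmin_r _ _)).
Qed.

Lemma is_RInt_pair (f : R -> C) (a b u v : R) :
  is_RInt (fun t => fst (f t)) a b u -> is_RInt (fun t => snd (f t)) a b v ->
  is_RInt f a b (u, v).
Proof. apply (is_RInt_fct_extend_pair). Qed.

Lemma Rabs_cos_le_1 (x : R) : Rabs (cos x) <= 1.
Proof. pose proof (COS_bound x). apply Rabs_le; lra. Qed.

Lemma Rabs_sin_le_1 (x : R) : Rabs (sin x) <= 1.
Proof. pose proof (SIN_bound x). apply Rabs_le; lra. Qed.

(** Differentiability in increment form, with [Cmod] in place of filters. It links the derivative
    used in [entire] with the one for which the product and chain rules are available, and it is the
    form that Goursat's argument consumes. *)
Definition cdiff (G : C -> C) (z : C) : Prop :=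
  exists D : C, forall eps, 0 < eps -> exists d, 0 < d /\
    forall h : C, Cmod h < d -> Cmod (G (z + h) - G z - D * h)%C <= eps * Cmod h.

Lemma cdiff_intro (G : C -> C) (z D : C) :
  (forall eps : posreal, @locally (AbsRing_UniformSpace C_AbsRing) z
     (fun y => Cmod (G y - G z - (y - z) * D)%C <= eps * Cmod (y - z)%C)) -> cdiff G z.
Proof.
  intros HD. exists D. intros eps Heps.
  destruct (HD (mkposreal eps Heps)) as [d Hd]. exists d. split; [apply cond_pos|].
  intros h Hh.
  assert (B : @ball (AbsRing_UniformSpace C_AbsRing) z d (z + h)%C).
  { change (Cmod (z + h - z)%C < d). replace (z + h - z)%C with h by ring. exact Hh. }
  specialize (Hd _ B). simpl in Hd.
  replace (z + h - z)%C with h in Hd by ring.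
  replace (D * h)%C with (h * D)%C by ring. exact Hd.
Qed.

Lemma C_differentiable_cdiff (G : C -> C) (z : C) : C_differentiable G z -> cdiff G z.
Proof.
  intros [D [_ HD]]. exact (cdiff_intro G z D (HD z (fun P H => H))).
Qed.

(* Coquelicot's rules for products and compositions are stated for [C_AbsRing] as a normed module
   over itself, which is not convertible to the [C_NormedModule] of [C_differentiable]. *)
Notation C_ex_derive := (@ex_derive C_AbsRing (AbsRing_NormedModule C_AbsRing)).

Lemma C_ex_derive_cdiff (G : C -> C) (z : C) : C_ex_derive G z -> cdiff G z.
Proof.
  intros [D [_ HD]]. exact (cdiff_intro G z D (HD z (fun P H => H))).
Qed.

Lemma Cmod_sub_triangle (x y : C) : Cmod (x - y) <= Cmod x + Cmod y.
Proof. unfold Cminus. eapply Rle_trans; [apply Cmod_triangle|]. rewrite Cmod_opp; lra. Qed.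

Lemma cdiff_continuous (G : C -> C) (z : C) : cdiff G z ->
  forall eps, 0 < eps -> exists d, 0 < d /\
    forall h : C, Cmod h < d -> Cmod (G (z + h) - G z)%C < eps.
Proof.
  intros [D HD] eps Heps. destruct (HD 1 Rlt_0_1) as [d [Hd H]].
  pose proof (Cmod_ge_0 D) as HD0.
  assert (Hq : 0 < eps / (2 + Cmod D)) by (apply Rdiv_lt_0_compat; lra).
  exists (Rmin d (eps / (2 + Cmod D))). split; [apply Rmin_glb_lt; lra|].
  intros h Hh.
  assert (h1 : Cmod h < d) by (eapply Rlt_le_trans; [apply Hh|apply Rmin_l]).
  assert (h2 : Cmod h < eps / (2 + Cmod D)) by (eapply Rlt_le_trans; [apply Hh|apply Rmin_r]).
  specialize (H h h1).
  replace (G (z + h) - G z)%C with ((G (z + h) - G z - D * h) + D * h)%C by ring.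
  eapply Rle_lt_trans; [apply Cmod_triangle|]. rewrite Cmod_mult.
  pose proof (Cmod_ge_0 h).
  apply Rle_lt_trans with ((2 + Cmod D) * Cmod h); [nra|].
  apply Rmult_lt_reg_r with (/ (2 + Cmod D)); [apply Rinv_0_lt_compat; lra|].
  replace ((2 + Cmod D) * Cmod h * / (2 + Cmod D)) with (Cmod h) by (field; lra).
  exact h2.
Qed.

Lemma cdiff_C_ex_derive (G : C -> C) (z : C) : cdiff G z -> C_ex_derive G z.
Proof.
  intros [D HD]. exists D. split; [apply is_linear_scal_l|].
  intros x Hx eps.
  pose proof (is_filter_lim_locally_unique (V := AbsRing_NormedModule C_AbsRing) z x Hx) as <-.
  destruct (HD eps (cond_pos eps)) as [d [Hd H]].
  exists (mkposreal d Hd). intros y Hy.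
  change (Cmod (y - z)%C < d) in Hy.
  change (Cmod (G y - G z - (y - z) * D)%C <= eps * Cmod (y - z)%C).
  specialize (H (y - z)%C Hy). replace (z + (y - z))%C with (y : C) in H by (apply injective_projections; simpl; ring).
  rewrite (Cmult_comm (y - z)%C D). exact H.
Qed.

Lemma cdiff_mult (F G : C -> C) (z : C) :
  cdiff F z -> cdiff G z -> cdiff (fun w => F w * G w)%C z.
Proof.
  intros HF HG. apply C_ex_derive_cdiff.
  apply cdiff_C_ex_derive in HF as [D HD]. apply cdiff_C_ex_derive in HG as [E HE].
  eexists. exact (is_derive_mult F G z D E HD HE Cmult_comm).
Qed.

Lemma cdiff_sub (F G : C -> C) (z : C) : cdiff F z -> cdiff G z -> cdiff (fun w => F w - G w)%C z.
Proof.
  intros HF HG. apply C_ex_derive_cdiff.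
  apply cdiff_C_ex_derive in HF as [D HD]. apply cdiff_C_ex_derive in HG as [E HE].
  eexists. exact (is_derive_minus (V := AbsRing_NormedModule C_AbsRing) F G z D E HD HE).
Qed.

(** Everything follows from [1 + x <= exp x] at [x] and at [- x], the latter rewritten as
    [exp x * (1 - x) <= 1]. *)
Lemma exp_sub_bound (x : R) : Rabs (exp x - 1 - x) <= x ^ 2 * exp (Rabs x).
Proof.
  assert (H1 := exp_ineq1_le x).
  assert (H2 := exp_ineq1_le (- x)).
  assert (H3 : exp x * exp (- x) = 1) by (rewrite <- exp_plus, Rplus_opp_r, exp_0; ring).
  pose proof (exp_pos x).
  assert (H4 : exp x * (1 - x) <= 1) by (rewrite <- H3; apply Rmult_le_compat_l; lra).
  rewrite Rabs_pos_eq by lra.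
  destruct (Rle_dec 0 x).
  - rewrite Rabs_pos_eq by lra. nra.
  - rewrite Rabs_left by lra.
    nra.
Qed.

Lemma exp_minus_1_bound (x : R) : Rabs (exp x - 1) <= Rabs x * exp (Rabs x).
Proof.
  assert (H1 := exp_ineq1_le x).
  assert (H2 := exp_ineq1_le (- x)).
  assert (H3 : exp x * exp (- x) = 1) by (rewrite <- exp_plus, Rplus_opp_r, exp_0; ring).
  pose proof (exp_pos x).
  destruct (Rle_dec 0 x).
  - rewrite !Rabs_pos_eq by lra. nra.
  - rewrite (Rabs_left x), Rabs_left1; [ |nra|lra].
    nra.
Qed.

Lemma sin_le_abs (x : R) : Rabs (sin x) <= Rabs x.
Proof.
  destruct (MVT_gen sin 0 x cos) as [c [_ Hc]].
  - intros; apply is_derive_Reals, derivable_pt_lim_sin.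
  - intros; apply continuity_sin.
  - rewrite sin_0, !Rminus_0_r in Hc. rewrite Hc, Rabs_mult.
    pose proof (Rabs_cos_le_1 c). pose proof (Rabs_pos x). nra.
Qed.

Lemma one_minus_cos_le (x : R) : Rabs (cos x - 1) <= x ^ 2.
Proof.
  replace x with (2 * (x / 2)) at 1 by field. rewrite cos_2a_sin.
  pose proof (sin_le_abs (x / 2)) as H.
  replace (1 - 2 * sin (x / 2) * sin (x / 2) - 1) with (- (2 * (sin (x / 2) * sin (x / 2)))) by ring.
  rewrite Rabs_Ropp, Rabs_mult, Rabs_mult, (Rabs_pos_eq 2) by lra.
  assert (Hx : x ^ 2 = 4 * (Rabs (x / 2) * Rabs (x / 2))).
  { rewrite <- Rabs_mult, Rabs_pos_eq by nra. field. }
  rewrite Hx. pose proof (Rabs_pos (sin (x / 2))). nra.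
Qed.

Lemma sin_sub_le (x : R) : Rabs (sin x - x) <= x ^ 2.
Proof.
  assert (H : forall x, Rabs (sin x - x) <= Rabs x * Rabs x).
  { clear x. intros x.
    destruct (MVT_gen (fun t => sin t - t) 0 x (fun t => cos t - 1)) as [c [Hc1 Hc]].
    - intros; auto_derive; [easy|ring].
    - intros y _; apply derivable_continuous_pt; reg.
    - rewrite sin_0, !Rminus_0_r in Hc. rewrite Hc, Rabs_mult.
      apply Rmult_le_compat_r; [apply Rabs_pos|].
      assert (Hcx : Rabs c <= Rabs x).
      { unfold Rmin, Rmax in Hc1; destruct (Rle_dec 0 x); split_Rabs; lra. }
      eapply Rle_trans; [|exact Hcx].
      destruct (MVT_gen cos 0 c (fun t => - sin t)) as [d [_ Hd]].
      + intros; auto_derive; [easy|ring].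
      + intros; apply continuity_cos.
      + rewrite cos_0, !Rminus_0_r in Hd. rewrite Hd, Rabs_mult, Rabs_Ropp.
        pose proof (Rabs_sin_le_1 d). pose proof (Rabs_pos c). nra. }
  specialize (H x). rewrite <- Rabs_mult, (Rabs_pos_eq (x * x)) in H by nra. simpl; lra.
Qed.

Lemma Cmod_le_sum (z : C) : Cmod z <= Rabs (Re z) + Rabs (Im z).
Proof.
  unfold Cmod. rewrite <- (sqrt_pow2 (Rabs (Re z) + Rabs (Im z))).
  - apply sqrt_le_1_alt. unfold Re, Im. rewrite <- (pow2_abs (fst z)), <- (pow2_abs (snd z)).
    pose proof (Rabs_pos (fst z)); pose proof (Rabs_pos (snd z)). simpl; nra.
  - pose proof (Rabs_pos (Re z)); pose proof (Rabs_pos (Im z)); lra.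
Qed.

Lemma im_le_Cmod (z : C) : Rabs (Im z) <= Cmod z.
Proof. eapply Rle_trans; [|apply Rmax_Cmod]. apply Rmax_r. Qed.

(** The real part is [(exp x - 1 - x) + exp x * (cos y - 1)], the imaginary part
    [exp x * (sin y - y) + y * (exp x - 1)]. Each of the four terms is at most [m ^ 2 * exp m]; the
    constant 5 leaves slack. *)
Lemma Cexp_sub_bound (z : C) :
  Cmod (Cexp z - 1 - z) <= 5 * Cmod z ^ 2 * exp (Cmod z).
Proof.
  set (m := Cmod z). set (x := Re z). set (y := Im z).
  assert (Hx : Rabs x <= m) by apply re_le_Cmod.
  assert (Hy : Rabs y <= m) by apply im_le_Cmod.
  assert (Hx2 : x ^ 2 <= m ^ 2) by (rewrite <- pow2_abs; apply pow_incr; split; [apply Rabs_pos|lra]).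
  assert (Hy2 : y ^ 2 <= m ^ 2) by (rewrite <- pow2_abs; apply pow_incr; split; [apply Rabs_pos|lra]).
  assert (He : exp (Rabs x) <= exp m) by (destruct Hx as [Hx|Hx]; [left; now apply exp_increasing|rewrite Hx; lra]).
  assert (He' : exp x <= exp m).
  { assert (x <= m) by (pose proof (Rle_abs x); lra).
    destruct H as [H|H]; [left; now apply exp_increasing|rewrite H; lra]. }
  pose proof (exp_pos x). pose proof (exp_pos (Rabs x)). pose proof (exp_pos m).
  pose proof (exp_sub_bound x) as B1. pose proof (exp_minus_1_bound x) as B2.
  pose proof (one_minus_cos_le y) as B3. pose proof (sin_sub_le y) as B4.
  assert (P1 : x ^ 2 * exp (Rabs x) <= m ^ 2 * exp m).
  { apply Rmult_le_compat; try lra; apply pow2_ge_0. }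
  assert (P2 : exp x * y ^ 2 <= m ^ 2 * exp m).
  { rewrite Rmult_comm. apply Rmult_le_compat; try lra; apply pow2_ge_0. }
  assert (P3 : Rabs y * (Rabs x * exp (Rabs x)) <= m ^ 2 * exp m).
  { replace (m ^ 2 * exp m) with (m * (m * exp m)) by ring.
    apply Rmult_le_compat; [apply Rabs_pos| |lra|].
    - apply Rmult_le_pos; [apply Rabs_pos|lra].
    - apply Rmult_le_compat; [apply Rabs_pos|lra|lra|lra]. }
  eapply Rle_trans; [apply Cmod_le_sum|].
  replace (Re (Cexp z - 1 - z)) with ((exp x - 1 - x) + exp x * (cos y - 1))
    by (unfold x, y, Cexp, Cminus, Cplus, Copp, RtoC, Re, Im; simpl; ring).
  replace (Im (Cexp z - 1 - z)) with (exp x * (sin y - y) + y * (exp x - 1))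
    by (unfold x, y, Cexp, Cminus, Cplus, Copp, RtoC, Re, Im; simpl; ring).
  eapply Rle_trans; [apply Rplus_le_compat; apply Rabs_triang|].
  rewrite !Rabs_mult, (Rabs_pos_eq (exp x)) by lra.
  assert (Q1 : exp x * Rabs (cos y - 1) <= exp x * y ^ 2) by (apply Rmult_le_compat_l; lra).
  assert (Q2 : exp x * Rabs (sin y - y) <= exp x * y ^ 2) by (apply Rmult_le_compat_l; lra).
  assert (Q3 : Rabs y * Rabs (exp x - 1) <= Rabs y * (Rabs x * exp (Rabs x)))
    by (apply Rmult_le_compat_l; [apply Rabs_pos|lra]).
  pose proof (Rmult_le_pos _ _ (pow2_ge_0 m) (Rlt_le _ _ H1)).
  lra.
Qed.

Lemma Cexp_plus (z w : C) : Cexp (z + w) = (Cexp z * Cexp w)%C.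
Proof.
  unfold Cexp, Cplus, Cmult, Re, Im. apply injective_projections; simpl.
  - rewrite exp_plus, cos_plus; ring.
  - rewrite exp_plus, sin_plus; ring.
Qed.

Lemma Cexp_RtoC (x : R) : Cexp (RtoC x) = RtoC (exp x).
Proof. unfold Cexp, RtoC, Re, Im; simpl. rewrite cos_0, sin_0. apply injective_projections; simpl; ring. Qed.

Lemma Cmod_Cexp (z : C) : Cmod (Cexp z) = exp (Re z).
Proof.
  unfold Cmod, Cexp; simpl fst; simpl snd.
  replace ((exp (Re z) * cos (Im z)) ^ 2 + (exp (Re z) * sin (Im z)) ^ 2)
    with (exp (Re z) ^ 2 * (Rsqr (sin (Im z)) + Rsqr (cos (Im z)))) by (unfold Rsqr; ring).
  rewrite sin2_cos2, Rmult_1_r. apply sqrt_pow2. left; apply exp_pos.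
Qed.

(** * Goursat's theorem and unique continuation *)

Definition hint (G : C -> C) (y a b : R) : C := @RInt CV (fun x => G (x, y)) a b.
Definition vint (G : C -> C) (x a b : R) : C := @RInt CV (fun y => G (x, y)) a b.

(** The counterclockwise contour integral over the boundary: bottom minus top, plus [Ci] times right
    minus left. *)
Definition rect_int (G : C -> C) (x0 x1 y0 y1 : R) : C :=
  (hint G y0 x0 x1 - hint G y1 x0 x1 + Ci * (vint G x1 y0 y1 - vint G x0 y0 y1))%C.

Definition hol (G : C -> C) : Prop := forall z, cdiff G z.

Lemma hol_continuous_h (G : C -> C) (y x : R) : hol G ->
  @continuous R_UniformSpace CV (fun x => G (x, y)) x.
Proof.
  intros HG. apply continuous_CV. intros eps Heps.
  destruct (cdiff_continuous G (x, y) (HG _) eps Heps) as [d [Hd H]].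
  exists d. split; [exact Hd|]. intros t Ht.
  change (Cmod (G (t, y) - G (x, y))%C < eps).
  replace (t, y) with ((x, y) + RtoC (t - x))%C
    by (apply injective_projections; simpl; ring).
  apply H. rewrite Cmod_R. exact Ht.
Qed.

Lemma hol_continuous_v (G : C -> C) (x y : R) : hol G ->
  @continuous R_UniformSpace CV (fun y => G (x, y)) y.
Proof.
  intros HG. apply continuous_CV. intros eps Heps.
  destruct (cdiff_continuous G (x, y) (HG _) eps Heps) as [d [Hd H]].
  exists d. split; [exact Hd|]. intros t Ht.
  change (Cmod (G (x, t) - G (x, y))%C < eps).
  replace (x, t) with ((x, y) + Ci * RtoC (t - y))%C
    by (apply injective_projections; simpl; ring).
  apply H. rewrite Cmod_mult, Cmod_Ci, Rmult_1_l, Cmod_R. exact Ht.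
Qed.

Lemma hol_ex_RInt_h (G : C -> C) (y a b : R) : hol G -> @ex_RInt CV (fun x => G (x, y)) a b.
Proof. intros HG. apply (@ex_RInt_continuous CV). intros; now apply hol_continuous_h. Qed.

Lemma hol_ex_RInt_v (G : C -> C) (x a b : R) : hol G -> @ex_RInt CV (fun y => G (x, y)) a b.
Proof. intros HG. apply (@ex_RInt_continuous CV). intros; now apply hol_continuous_v. Qed.

Lemma hint_Chasles (G : C -> C) (y a b c : R) : hol G ->
  (hint G y a c = hint G y a b + hint G y b c)%C.
Proof. intros HG. symmetry. apply (@RInt_Chasles CV); now apply hol_ex_RInt_h. Qed.

Lemma vint_Chasles (G : C -> C) (x a b c : R) : hol G ->
  (vint G x a c = vint G x a b + vint G x b c)%C.
Proof. intros HG. symmetry. apply (@RInt_Chasles CV); now apply hol_ex_RInt_v. Qed.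

(** Every inner edge is traversed twice, in opposite directions. *)
Lemma rect_int_quarter (G : C -> C) (x0 xm x1 y0 ym y1 : R) : hol G ->
  rect_int G x0 x1 y0 y1 =
  (rect_int G x0 xm y0 ym + rect_int G xm x1 y0 ym
   + rect_int G x0 xm ym y1 + rect_int G xm x1 ym y1)%C.
Proof.
  intros HG. unfold rect_int.
  rewrite (hint_Chasles G y0 x0 xm x1 HG), (hint_Chasles G y1 x0 xm x1 HG),
    (vint_Chasles G x1 y0 ym y1 HG), (vint_Chasles G x0 y0 ym y1 HG). ring.
Qed.

Lemma cdiff_affine (c D z : C) : cdiff (fun w => c + D * w)%C z.
Proof.
  exists D. intros eps Heps. exists 1. split; [lra|]. intros h _.
  replace (c + D * (z + h) - (c + D * z) - D * h)%C with (RtoC 0) by ring.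
  rewrite Cmod_0. apply Rmult_le_pos; [lra|apply Cmod_ge_0].
Qed.

Lemma is_RInt_lin (p q a b : R) :
  is_RInt (fun x => p + q * x) a b (p * (b - a) + q * ((b ^ 2 - a ^ 2) / 2)).
Proof.
  replace (p * (b - a) + q * ((b ^ 2 - a ^ 2) / 2))
    with (minus (p * b + q * (b ^ 2 / 2)) (p * a + q * (a ^ 2 / 2)))
    by (unfold minus, plus, opp; simpl; field).
  apply (is_RInt_derive (fun x => p * x + q * (x ^ 2 / 2))).
  - intros; auto_derive; [easy|field].
  - intros x _. apply (ex_derive_continuous (fun x => p + q * x)). auto_derive; easy.
Qed.

(** The base case of Cauchy's theorem, by computing the four sides explicitly. *)
Lemma rect_int_affine (c D : C) (x0 x1 y0 y1 : R) :
  rect_int (fun w => c + D * w)%C x0 x1 y0 y1 = RtoC 0.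
Proof.
  destruct c as [c1 c2], D as [d1 d2].
  assert (Hh : forall y, hint (fun w => (c1, c2) + (d1, d2) * w)%C y x0 x1 =
    ((c1 - d2 * y) * (x1 - x0) + d1 * ((x1 ^ 2 - x0 ^ 2) / 2),
     (c2 + d1 * y) * (x1 - x0) + d2 * ((x1 ^ 2 - x0 ^ 2) / 2))).
  { intros y. apply (is_RInt_unique (V := CV)). apply is_RInt_pair.
    - eapply is_RInt_ext; [|apply is_RInt_lin]. intros; simpl; ring.
    - eapply is_RInt_ext; [|apply is_RInt_lin]. intros; simpl; ring. }
  assert (Hv : forall x, vint (fun w => (c1, c2) + (d1, d2) * w)%C x y0 y1 =
    ((c1 + d1 * x) * (y1 - y0) + - d2 * ((y1 ^ 2 - y0 ^ 2) / 2),
     (c2 + d2 * x) * (y1 - y0) + d1 * ((y1 ^ 2 - y0 ^ 2) / 2))).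
  { intros x. apply (is_RInt_unique (V := CV)). apply is_RInt_pair.
    - eapply is_RInt_ext; [|apply is_RInt_lin]. intros; simpl; ring.
    - eapply is_RInt_ext; [|apply is_RInt_lin]. intros; simpl; ring. }
  unfold rect_int. rewrite !Hh, !Hv.
  apply injective_projections; simpl; field.
Qed.

Lemma Cmod_RInt_le (f : R -> C) (a b B : R) : a <= b ->
  @ex_RInt CV f a b ->
  (forall x, a <= x <= b -> Cmod (f x) <= B) ->
  Cmod (@RInt CV f a b) <= (b - a) * B.
Proof.
  intros Hab Hex HB. rewrite <- norm_CV.
  apply (@norm_RInt_le_const C_R_NormedModule f); [exact Hab| |].
  - intros x Hx. rewrite norm_CV. now apply HB.
  - apply (@RInt_correct CV). exact Hex.
Qed.

(** Subtracting an affine function does not change the contour integral, so only the deviation [B]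
    from it is multiplied by the perimeter. *)
Lemma rect_int_bound (G : C -> C) (c D : C) (x0 x1 y0 y1 B : R) : hol G ->
  x0 <= x1 -> y0 <= y1 ->
  (forall x y, x0 <= x <= x1 -> y0 <= y <= y1 -> Cmod (G (x, y) - (c + D * (x, y)))%C <= B) ->
  Cmod (rect_int G x0 x1 y0 y1) <= 2 * ((x1 - x0) + (y1 - y0)) * B.
Proof.
  intros HG Hx Hy HB. set (A := fun w => (c + D * w)%C).
  assert (HA : hol A) by (intros z; apply cdiff_affine).
  pose proof (rect_int_affine c D x0 x1 y0 y1) as H0. fold A in H0.
  assert (Bh : forall y, y0 <= y <= y1 -> Cmod (hint G y x0 x1 - hint A y x0 x1) <= (x1 - x0) * B).
  { intros y Hy'. unfold hint.
    change (Cmod (minus (RInt (V := CV) (fun x => G (x, y)) x0 x1) (RInt (V := CV) (fun x => A (x, y)) x0 x1)) <= (x1 - x0) * B).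
    rewrite <- (RInt_minus); try now apply hol_ex_RInt_h.
    apply Cmod_RInt_le; [exact Hx| |].
    - apply (ex_RInt_minus); now apply hol_ex_RInt_h.
    - intros x Hx'. now apply HB. }
  assert (Bv : forall x, x0 <= x <= x1 -> Cmod (vint G x y0 y1 - vint A x y0 y1) <= (y1 - y0) * B).
  { intros x Hx'. unfold vint.
    change (Cmod (minus (RInt (V := CV) (fun y => G (x, y)) y0 y1) (RInt (V := CV) (fun y => A (x, y)) y0 y1)) <= (y1 - y0) * B).
    rewrite <- (RInt_minus); try now apply hol_ex_RInt_v.
    apply Cmod_RInt_le; [exact Hy| |].
    - apply (ex_RInt_minus); now apply hol_ex_RInt_v.
    - intros y Hy'. now apply HB. }
  replace (rect_int G x0 x1 y0 y1) with (rect_int G x0 x1 y0 y1 - rect_int A x0 x1 y0 y1)%C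
    by (rewrite H0; ring).
  unfold rect_int.
  replace (hint G y0 x0 x1 - hint G y1 x0 x1 + Ci * (vint G x1 y0 y1 - vint G x0 y0 y1) -
    (hint A y0 x0 x1 - hint A y1 x0 x1 + Ci * (vint A x1 y0 y1 - vint A x0 y0 y1)))%C
  with ((hint G y0 x0 x1 - hint A y0 x0 x1) - (hint G y1 x0 x1 - hint A y1 x0 x1)
     + Ci * ((vint G x1 y0 y1 - vint A x1 y0 y1) - (vint G x0 y0 y1 - vint A x0 y0 y1)))%C by ring.
  eapply Rle_trans; [apply Cmod_triangle|]. rewrite Cmod_mult, Cmod_Ci, Rmult_1_l.
  eapply Rle_trans; [apply Rplus_le_compat; apply Cmod_sub_triangle|].
  pose proof (Bh y0 ltac:(lra)). pose proof (Bh y1 ltac:(lra)).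
  pose proof (Bv x0 ltac:(lra)). pose proof (Bv x1 ltac:(lra)). lra.
Qed.

Section Goursat.
Variables (G : C -> C) (HG : hol G) (w h : R) (Hw : 0 <= w) (Hh : 0 <= h).

Let I (n : nat) (p : R * R) : C :=
  rect_int G (fst p) (fst p + w / 2 ^ n) (snd p) (snd p + h / 2 ^ n).

Let corner (n : nat) (p : R * R) (i j : bool) : R * R :=
  (if i then fst p + w / 2 ^ S n else fst p, if j then snd p + h / 2 ^ S n else snd p).

(** Picks the first quarter that carries at least a quarter of the modulus. The last quarter is the
    default: when the other three fail the test, the triangle inequality forces it to pass. *)
Definition goursat_next (n : nat) (p : R * R) : R * R :=
  let t := Cmod (I n p) / 4 in
  if Rle_dec t (Cmod (I (S n) (corner n p false false))) then corner n p false false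
  else if Rle_dec t (Cmod (I (S n) (corner n p true false))) then corner n p true false
  else if Rle_dec t (Cmod (I (S n) (corner n p false true))) then corner n p false true
  else corner n p true true.

Lemma half_pow (x : R) (n : nat) : x / 2 ^ S n + x / 2 ^ S n = x / 2 ^ n.
Proof. simpl. field. apply pow_nonzero; lra. Qed.

Lemma goursat_next_spec (n : nat) (p : R * R) :
  Cmod (I n p) / 4 <= Cmod (I (S n) (goursat_next n p)) /\
  exists i j, goursat_next n p = corner n p i j.
Proof.
  unfold goursat_next.
  repeat match goal with |- context [Rle_dec ?a ?b] => destruct (Rle_dec a b) end;
    split; eauto.
  assert (HI : I n p = (I (S n) (corner n p false false) + I (S n) (corner n p true false)
    + I (S n) (corner n p false true) + I (S n) (corner n p true true))%C).
  { unfold I, corner; cbn [fst snd]. rewrite !Rplus_assoc, !half_pow.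
    apply rect_int_quarter; exact HG. }
  rewrite HI at 1.
  rewrite HI in n0, n1, n2.
  set (A := I (S n) (corner n p false false)) in *. set (B := I (S n) (corner n p true false)) in *.
  set (C' := I (S n) (corner n p false true)) in *. set (D := I (S n) (corner n p true true)) in *.
  pose proof (Cmod_triangle (A + B + C') D). pose proof (Cmod_triangle (A + B) C').
  pose proof (Cmod_triangle A B). lra.
Qed.

Fixpoint goursat_seq (p : R * R) (n : nat) : R * R :=
  match n with O => p | S n => goursat_next n (goursat_seq p n) end.

Lemma goursat_seq_int (p : R * R) (n : nat) :
  Cmod (I 0 p) / 4 ^ n <= Cmod (I n (goursat_seq p n)).
Proof.
  induction n; [simpl; lra|].
  simpl goursat_seq. eapply Rle_trans; [|apply goursat_next_spec].
  replace (Cmod (I 0 p) / 4 ^ S n) with (Cmod (I 0 p) / 4 ^ n / 4).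
  - lra.
  - simpl; field. apply pow_nonzero; lra.
Qed.

Lemma goursat_seq_step (p : R * R) (n : nat) :
  (fst (goursat_seq p n) <= fst (goursat_seq p (S n)) /\
   fst (goursat_seq p (S n)) + w / 2 ^ S n <= fst (goursat_seq p n) + w / 2 ^ n) /\
  (snd (goursat_seq p n) <= snd (goursat_seq p (S n)) /\
   snd (goursat_seq p (S n)) + h / 2 ^ S n <= snd (goursat_seq p n) + h / 2 ^ n).
Proof.
  simpl goursat_seq. set (r := goursat_seq p n).
  destruct (goursat_next_spec n r) as [_ [i [j ->]]].
  assert (0 <= w / 2 ^ S n) by (apply Rdiv_le_0_compat; [lra|apply pow_lt; lra]).
  assert (0 <= h / 2 ^ S n) by (apply Rdiv_le_0_compat; [lra|apply pow_lt; lra]).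
  rewrite <- (half_pow w n), <- (half_pow h n).
  unfold corner; cbn [fst snd].
  destruct i, j; lra.
Qed.

(** The supremum of the left ends lies in every interval, because each left end is below each right
    end. *)
Lemma nested_limit (u e : nat -> R) :
  (forall n, u n <= u (S n) /\ u (S n) + e (S n) <= u n + e n) -> (forall n, 0 <= e n) ->
  exists l, forall n, u n <= l <= u n + e n.
Proof.
  intros H He.
  assert (Hm : forall n k, u n <= u (n + k)%nat /\ u (n + k)%nat + e (n + k)%nat <= u n + e n).
  { intros n k. induction k; [rewrite Nat.add_0_r; lra|].
    rewrite Nat.add_succ_r. pose proof (H (n + k)%nat). lra. }
  assert (Hb : forall m n, u m <= u n + e n).
  { intros m n. pose proof (Hm n m). pose proof (Hm m n). pose proof (He (n + m)%nat).
    rewrite (Nat.add_comm m n) in *. lra. }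
  destruct (completeness (fun x => exists n, x = u n)) as [l [Hl1 Hl2]].
  - exists (u 0%nat + e 0%nat). intros x [n ->]. apply Hb.
  - exists (u 0%nat). now exists 0%nat.
  - exists l. intros n. split.
    + apply Hl1. now exists n.
    + apply Hl2. intros x [m ->]. apply Hb.
Qed.

(** The chosen rectangles shrink to a point. Their integrals decay at most like [4 ^ (- n)], while
    differentiability at the limit point makes them [eps] times diameter times perimeter, again of
    order [4 ^ (- n)] but with an arbitrarily small factor. *)
Lemma goursat_zero (p : R * R) : I 0 p = RtoC 0.
Proof.
  set (u := goursat_seq p).
  assert (Pos : forall x n, 0 <= x -> 0 <= x / 2 ^ n)
    by (intros; apply Rdiv_le_0_compat; [lra|apply pow_lt; lra]).
  destruct (nested_limit (fun n => fst (u n)) (fun n => w / 2 ^ n)) as [X HX].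
  { intros n. apply (goursat_seq_step p n). }
  { intros; now apply Pos. }
  destruct (nested_limit (fun n => snd (u n)) (fun n => h / 2 ^ n)) as [Y HY].
  { intros n. apply (goursat_seq_step p n). }
  { intros; now apply Pos. }
  apply Cmod_eq_0. apply Rle_antisym; [|apply Cmod_ge_0].
  apply Rnot_lt_le. intros HI.
  destruct (HG (X, Y)) as [D HD].
  (* With this value the upper bound is exactly half of the lower bound. The summand 1 keeps the
     denominator positive for a degenerate rectangle. *)
  set (eps := Cmod (I 0 p) / (4 * (w + h + 1) ^ 2)).
  assert (Hden : 0 < 4 * (w + h + 1) ^ 2) by (assert (0 < (w + h + 1) ^ 2) by (apply pow_lt; lra); lra).
  assert (Heps : 0 < eps) by (apply Rdiv_lt_0_compat; lra).
  destruct (HD eps Heps) as [d [Hd Hloc]].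
  assert (Hn : exists n, (w + h + 1) / 2 ^ n < d).
  { destruct (pow_lt_1_zero (/ 2) ltac:(rewrite Rabs_pos_eq; lra) (d / (w + h + 1))) as [n Hn].
    - apply Rdiv_lt_0_compat; lra.
    - exists n. specialize (Hn n (Nat.le_refl n)).
      rewrite pow_inv in Hn. rewrite Rabs_pos_eq in Hn by (left; apply Rinv_0_lt_compat, pow_lt; lra).
      apply Rmult_lt_compat_r with (r := w + h + 1) in Hn; [|lra].
      replace (d / (w + h + 1) * (w + h + 1)) with d in Hn by (field; lra).
      unfold Rdiv; lra. }
  destruct Hn as [n Hn].
  assert (P2n : 0 < 2 ^ n) by (apply pow_lt; lra).
  assert (Hwh : w / 2 ^ n + h / 2 ^ n <= (w + h + 1) / 2 ^ n).
  { apply Rmult_le_reg_r with (2 ^ n); [lra|]. field_simplify; lra. }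
  pose proof (goursat_seq_int p n) as Hint. fold u in Hint.
  assert (Hup : Cmod (I n (u n)) <= 2 * (w / 2 ^ n + h / 2 ^ n) * (eps * ((w + h + 1) / 2 ^ n))).
  { unfold I. eapply Rle_trans.
    - apply (rect_int_bound G (G (X, Y) - D * (X, Y))%C D _ _ _ _ (eps * ((w + h + 1) / 2 ^ n)) HG).
      + pose proof (Pos w n Hw); lra.
      + pose proof (Pos h n Hh); lra.
      + intros x y Hx Hy.
        assert (Hc : Cmod ((x, y) - (X, Y))%C <= (w + h + 1) / 2 ^ n).
        { eapply Rle_trans; [apply Cmod_le_sum|].
          simpl Re; simpl Im. eapply Rle_trans; [|apply Hwh].
          pose proof (HX n). pose proof (HY n).
          apply Rplus_le_compat; apply Rabs_le; simpl in *; lra. }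
        replace (x, y) with ((X, Y) + ((x, y) - (X, Y)))%C at 1 by ring.
        replace (G ((X, Y) + ((x, y) - (X, Y)))%C - (G (X, Y) - D * (X, Y) + D * (x, y)))%C
          with (G ((X, Y) + ((x, y) - (X, Y)))%C - G (X, Y) - D * ((x, y) - (X, Y)))%C by ring.
        eapply Rle_trans; [apply Hloc; lra|].
        apply Rmult_le_compat_l; lra.
    - right. ring. }
  assert (Hfin : Cmod (I 0 p) / 4 ^ n <= Cmod (I 0 p) / 4 ^ n / 2).
  { eapply Rle_trans; [exact Hint|]. eapply Rle_trans; [exact Hup|].
    apply Rle_trans with (2 * ((w + h + 1) / 2 ^ n) * (eps * ((w + h + 1) / 2 ^ n))).
    - apply Rmult_le_compat_r; [|lra].
      apply Rmult_le_pos; [lra|]. apply Rdiv_le_0_compat; lra.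
    - right. unfold eps. replace (4 ^ n) with (2 ^ n * 2 ^ n) by (rewrite <- Rpow_mult_distr; f_equal; ring). field. lra. }
  assert (0 < Cmod (I 0 p) / 4 ^ n) by (apply Rdiv_lt_0_compat; [lra|apply pow_lt; lra]).
  lra.
Qed.
End Goursat.

Lemma goursat (G : C -> C) (x0 x1 y0 y1 : R) : hol G -> x0 <= x1 -> y0 <= y1 ->
  rect_int G x0 x1 y0 y1 = RtoC 0.
Proof.
  intros HG Hx Hy.
  pose proof (goursat_zero G HG (x1 - x0) (y1 - y0) ltac:(lra) ltac:(lra) (x0, y0)) as H.
  simpl in H. replace (x0 + (x1 - x0) / 1) with x1 in H by field.
  replace (y0 + (y1 - y0) / 1) with y1 in H by field. exact H.
Qed.

Lemma exp_le (x y : R) : x <= y -> exp x <= exp y.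
Proof. intros [H|H]; [left; now apply exp_increasing|subst; lra]. Qed.

Lemma exp_le_1 (x : R) : x <= 0 -> exp x <= 1.
Proof. intros H. rewrite <- exp_0. now apply exp_le. Qed.

Lemma cdiff_Cexp_at (z : C) : cdiff Cexp z.
Proof.
  exists (Cexp z). intros eps Heps.
  set (A := 5 * Cmod (Cexp z) * exp 1 + 1).
  assert (HA : 0 < A).
  { pose proof (Cmod_ge_0 (Cexp z)). pose proof (exp_pos 1). unfold A. nra. }
  assert (Hq : 0 < eps / A) by now apply Rdiv_lt_0_compat.
  exists (Rmin 1 (eps / A)). split; [apply Rmin_glb_lt; lra|]. intros h Hh.
  pose proof (Rlt_le_trans _ _ _ Hh (Rmin_l _ _)) as h1.
  pose proof (Rlt_le_trans _ _ _ Hh (Rmin_r _ _)) as h2.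
  rewrite Cexp_plus.
  replace (Cexp z * Cexp h - Cexp z - Cexp z * h)%C with (Cexp z * (Cexp h - 1 - h))%C by ring.
  rewrite Cmod_mult. pose proof (Cmod_ge_0 h). pose proof (Cmod_ge_0 (Cexp z)).
  assert (B : Cmod (Cexp h - 1 - h) <= 5 * Cmod h ^ 2 * exp 1).
  { eapply Rle_trans; [apply Cexp_sub_bound|]. apply Rmult_le_compat_l; [nra|]. apply exp_le. lra. }
  apply Rle_trans with (Cmod (Cexp z) * (5 * Cmod h ^ 2 * exp 1)); [now apply Rmult_le_compat_l|].
  apply Rmult_lt_compat_r with (r := A) in h2; [|exact HA].
  replace (eps / A * A) with eps in h2 by (field; lra). unfold A in h2.
  replace (Cmod (Cexp z) * (5 * Cmod h ^ 2 * exp 1)) with (Cmod h * (5 * Cmod (Cexp z) * exp 1) * Cmod h) by ring.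
  apply Rmult_le_compat_r; lra.
Qed.

Lemma cdiff_Cexp (P : C -> C) (z : C) : cdiff P z -> cdiff (fun w => Cexp (P w)) z.
Proof.
  intros HP. apply C_ex_derive_cdiff.
  apply cdiff_C_ex_derive in HP as [D HD].
  destruct (cdiff_C_ex_derive _ _ (cdiff_Cexp_at (P z))) as [E HE].
  eexists. exact (is_derive_comp (V := AbsRing_NormedModule C_AbsRing) Cexp P z E D HE HD).
Qed.

Lemma continuous_CV_Cmod (f : R -> C) (x : R) :
  @continuous R_UniformSpace CV f x -> continuity_pt (fun t => Cmod (f t)) x.
Proof.
  intros H. apply continuity_pt_filterlim. apply filterlim_locally. intros eps.
  destruct (continuous_CV_inv f x H eps (cond_pos eps)) as [d [Hd Hy]].
  exists (mkposreal d Hd). intros y By. specialize (Hy y By).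
  change (Rabs (Cmod (f y) - Cmod (f x)) < eps).
  pose proof (Cmod_triangle (f y - f x) (f x)) as T1.
  pose proof (Cmod_triangle (f x - f y) (f y)) as T2.
  replace (f y - f x + f x)%C with (f y) in T1 by ring.
  replace (f x - f y + f y)%C with (f x) in T2 by ring.
  replace (f x - f y)%C with (- (f y - f x))%C in T2 by ring. rewrite Cmod_opp in T2.
  apply Rabs_def1; lra.
Qed.

Lemma continuous_bounded (f : R -> C) (a b : R) : a <= b ->
  (forall x, a <= x <= b -> @continuous R_UniformSpace CV f x) ->
  exists M, 0 <= M /\ forall x, a <= x <= b -> Cmod (f x) <= M.
Proof.
  intros Hab Hc.
  destruct (continuity_ab_maj (fun t => Cmod (f t)) a b Hab) as [m [Hm _]].
  - intros x Hx. apply continuous_CV_Cmod. now apply Hc.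
  - exists (Cmod (f m)). split; [apply Cmod_ge_0|exact Hm].
Qed.

Lemma gauss_continuous (N c y : R) : continuous (fun y => exp (- (N * (y - c) ^ 2))) y.
Proof. apply (ex_derive_continuous (fun y => exp (- (N * (y - c) ^ 2)))). auto_derive; easy. Qed.

(** Only the window of radius [d / 2] is kept. Its rate [(d / 2) ^ 2] is smaller than the rate
    [d ^ 2] reached at distance [d], and [vanish_at] lives on this gap. *)
Lemma gauss_int_lower (N c h d : R) : 0 <= N -> 0 < d -> d <= h ->
  d * exp (- (N * (d / 2) ^ 2)) <= RInt (fun y => exp (- (N * (y - c) ^ 2))) (c - h) (c + h).
Proof.
  intros HN Hd Hh.
  assert (Hex : forall a b, ex_RInt (fun y => exp (- (N * (y - c) ^ 2))) a b).
  { intros. apply (@ex_RInt_continuous R_CompleteNormedModule). intros; apply gauss_continuous. }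
  rewrite <- (RInt_Chasles _ (c - h) (c - d / 2) (c + h)) by apply Hex.
  rewrite <- (RInt_Chasles _ (c - d / 2) (c + d / 2) (c + h)) by apply Hex.
  assert (P1 : 0 <= RInt (fun y => exp (- (N * (y - c) ^ 2))) (c - h) (c - d / 2)).
  { apply RInt_ge_0; [lra|apply Hex|]. intros; left; apply exp_pos. }
  assert (P2 : 0 <= RInt (fun y => exp (- (N * (y - c) ^ 2))) (c + d / 2) (c + h)).
  { apply RInt_ge_0; [lra|apply Hex|]. intros; left; apply exp_pos. }
  assert (P3 : d * exp (- (N * (d / 2) ^ 2)) <= RInt (fun y => exp (- (N * (y - c) ^ 2))) (c - d / 2) (c + d / 2)).
  { replace (d * exp (- (N * (d / 2) ^ 2)))
      with (RInt (fun _ => exp (- (N * (d / 2) ^ 2))) (c - d / 2) (c + d / 2)).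
    - apply RInt_le; [lra| |apply Hex|].
      + apply ex_RInt_const.
      + intros x Hx. apply exp_le. apply Ropp_le_contravar, Rmult_le_compat_l; [lra|].
        rewrite <- (pow2_abs (x - c)). apply pow_incr. split; [apply Rabs_pos|].
        apply Rabs_le; lra.
    - rewrite RInt_const. unfold scal; simpl; unfold mult; simpl. field. }
  set (I1 := RInt _ _ (c - d / 2)) in *. set (I2 := RInt _ _ (c + d / 2)) in *. set (I3 := RInt _ _ (c + h)) in *.
  change (d * exp (- (N * (d / 2) ^ 2)) <= I1 + (I2 + I3)). lra.
Qed.

Lemma is_RInt_RtoC_mult (e : R -> R) (c : C) (a b J : R) :
  is_RInt e a b J -> is_RInt (fun y => RtoC (e y) * c)%C a b (RtoC J * c)%C.
Proof.
  intros He. destruct c as [u v].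
  replace (RtoC J * (u, v))%C with (J * u, J * v) by (apply injective_projections; simpl; ring).
  apply is_RInt_pair.
  - rewrite Rmult_comm. apply (is_RInt_ext (fun y => scal u (e y))).
    + intros; unfold scal; simpl; unfold mult; simpl; ring.
    + apply (is_RInt_scal e a b u J He).
  - rewrite Rmult_comm. apply (is_RInt_ext (fun y => scal v (e y))).
    + intros; unfold scal; simpl; unfold mult; simpl; ring.
    + apply (is_RInt_scal e a b v J He).
Qed.

Section UniqueContinuation.
Variables (E : C -> C) (HE : hol E) (sigma : R) (H0 : forall s, sigma < Re s -> E s = RtoC 0).
Variables (c1 c2 : R) (Hc : c1 <= sigma).

(** The rectangle reaches from abscissa [c1] to [sigma + 1], so [x1] is its width, and it has
    half-height [h]. On the horizontal sides the weight has modulus at most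
    [exp (N * (x1 ^ 2 - h ^ 2))], and [h ^ 2 - x1 ^ 2 >= 1]. *)
Let x1 := sigma + 1 - c1.
Let h := x1 + 1.
Let wt (N : R) (z : C) : C := Cexp (RtoC N * ((RtoC (-1) * (c1, c2) + RtoC 1 * z) * (RtoC (-1) * (c1, c2) + RtoC 1 * z)))%C.

Lemma wt_Re (N x y : R) :
  Re (RtoC N * ((RtoC (-1) * (c1, c2) + RtoC 1 * (x, y)) * (RtoC (-1) * (c1, c2) + RtoC 1 * (x, y))))%C
  = N * ((x - c1) ^ 2 - (y - c2) ^ 2).
Proof. unfold Cmult, Cplus, RtoC, Re; simpl.  ring. Qed.

Lemma hol_weighted (N : R) : hol (fun z => E z * wt N z)%C.
Proof.
  intros z. apply cdiff_mult; [apply HE|]. unfold wt. apply cdiff_Cexp.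
  apply (cdiff_mult (fun _ => RtoC N)).
  - destruct (cdiff_affine (RtoC N) (RtoC 0) z) as [D HD]. exists D. intros eps Heps.
    destruct (HD eps Heps) as [d [Hd H]]. exists d; split; [exact Hd|]. intros h' Hh'.
    specialize (H h' Hh'). replace (RtoC N - RtoC N - D * h')%C
      with (RtoC N + RtoC 0 * (z + h') - (RtoC N + RtoC 0 * z) - D * h')%C by ring. exact H.
  - apply cdiff_mult; apply cdiff_affine.
Qed.

(** On the left side [z - c] is purely imaginary, so the weight is a real Gaussian that peaks at
    [c2]. *)
Lemma weighted_left (N y : R) :
  (E (c1, y) * wt N (c1, y))%C = (RtoC (exp (- (N * (y - c2) ^ 2))) * E (c1, y))%C.
Proof.
  rewrite Cmult_comm. f_equal. unfold wt. rewrite <- Cexp_RtoC. f_equal.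
  apply injective_projections; simpl; ring.
Qed.

(** By Goursat's theorem the left side equals the other three. The right side vanishes with [E], and
    the horizontal sides carry the factor [exp (- N)]. *)
Lemma left_integral_small :
  exists M, 0 <= M /\ forall N, 0 <= N ->
    Cmod (vint (fun z => E z * wt N z)%C c1 (c2 - h) (c2 + h)) <= M * exp (- N).
Proof.
  destruct (continuous_bounded (fun x => E (x, c2 - h)) c1 (sigma + 1) ltac:(lra)) as [M1 [HM1 B1]].
  { intros; now apply hol_continuous_h. }
  destruct (continuous_bounded (fun x => E (x, c2 + h)) c1 (sigma + 1) ltac:(lra)) as [M2 [HM2 B2]].
  { intros; now apply hol_continuous_h. }
  assert (Hx1 : 1 <= x1) by (unfold x1; lra).
  exists (x1 * M1 + x1 * M2). split; [nra|]. intros N HN.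
  pose proof (goursat _ c1 (sigma + 1) (c2 - h) (c2 + h) (hol_weighted N) ltac:(lra) ltac:(unfold h; lra)) as G0.
  unfold rect_int in G0.
  assert (R0 : vint (fun z => E z * wt N z)%C (sigma + 1) (c2 - h) (c2 + h) = RtoC 0).
  { unfold vint. transitivity (RInt (V := CV) (fun _ => RtoC 0) (c2 - h) (c2 + h)).
    - apply (RInt_ext (V := CV)). intros y _. rewrite H0 by (simpl; lra). apply Cmult_0_l.
    - rewrite RInt_const. apply (scal_zero_r (V := CV)). }
  rewrite R0 in G0.
  assert (Bound : forall y M, (y - c2) ^ 2 = h ^ 2 -> 0 <= M ->
    (forall x, c1 <= x <= sigma + 1 -> Cmod (E (x, y)) <= M) ->
    Cmod (hint (fun z => E z * wt N z)%C y c1 (sigma + 1)) <= x1 * (M * exp (- N))).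
  { intros y M Hy HM B. unfold hint, x1. apply Cmod_RInt_le; [lra| |].
    - apply (hol_ex_RInt_h (fun z => E z * wt N z)%C), hol_weighted.
    - intros x Hx. rewrite Cmod_mult. apply Rmult_le_compat; try apply Cmod_ge_0; [now apply B|].
      unfold wt. rewrite Cmod_Cexp, wt_Re, Hy. apply exp_le.
      assert ((x - c1) ^ 2 <= x1 ^ 2) by (apply pow_incr; unfold x1; lra).
      unfold h in *. nra. }
  pose proof (Bound (c2 - h) M1 ltac:(ring) HM1 B1).
  pose proof (Bound (c2 + h) M2 ltac:(ring) HM2 B2).
  set (V := vint _ c1 _ _) in *. set (P := hint _ (c2 - h) _ _) in *. set (Q := hint _ (c2 + h) _ _) in *.
  assert (HV : (Ci * V)%C = (P - Q)%C).
  { transitivity (P - Q - (P - Q + Ci * (RtoC 0 - V)))%C; [ring|]. rewrite G0. ring. }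
  replace (Cmod V) with (Cmod (Ci * V)) by (rewrite Cmod_mult, Cmod_Ci; ring).
  rewrite HV.
  eapply Rle_trans; [apply Cmod_sub_triangle|]. nra.
Qed.

(** If [E] had modulus [A > 0] at the centre, the Gaussian integral along the left side would be
    comparable to [A] times the Gaussian mass, which decays more slowly in [N] than
    [left_integral_small] and the contribution of far points allow. *)
Lemma vanish_at : E (c1, c2) = RtoC 0.
Proof.
  apply Cmod_eq_0. apply Rle_antisym; [|apply Cmod_ge_0]. apply Rnot_lt_le. intros Hpos.
  set (A := Cmod (E (c1, c2))) in *.
  assert (Hx1 : 1 <= x1) by (unfold x1; lra).
  destruct left_integral_small as [M [HM Hleft]].
  destruct (continuous_bounded (fun y => E (c1, y)) (c2 - h) (c2 + h) ltac:(unfold h; lra)) as [B [HB HBd]].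
  { intros; now apply hol_continuous_v. }
  destruct (continuous_CV_inv _ _ (hol_continuous_v E c1 c2 HE) (A / 2) ltac:(lra)) as [d0 [Hd0 Hloc]].
  (* Since [d <= 1], the bound [exp (- N)] for the whole integral is absorbed in
     [exp (- (N * d ^ 2))]. *)
  set (d := Rmin 1 (d0 / 2)).
  assert (Hd : 0 < d) by (apply Rmin_glb_lt; lra).
  assert (Hd1 : d <= 1) by apply Rmin_l.
  assert (Hd2 : d < d0) by (apply Rle_lt_trans with (d0 / 2); [apply Rmin_r|lra]).
  assert (HBA : A <= B) by (apply (HBd c2); unfold h; lra).
  assert (Key : forall N, 0 <= N ->
    A / 2 * (d * exp (- (N * (d / 2) ^ 2))) <= (M + 4 * h * B) * exp (- (N * d ^ 2))).
  { intros N HN.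
    set (e := fun y => exp (- (N * (y - c2) ^ 2))).
    set (J := RInt e (c2 - h) (c2 + h)).
    assert (HJ : d * exp (- (N * (d / 2) ^ 2)) <= J) by (apply gauss_int_lower; unfold h; lra).
    assert (Hexe : ex_RInt e (c2 - h) (c2 + h)).
    { apply (@ex_RInt_continuous R_CompleteNormedModule). intros; apply gauss_continuous. }
    set (V := vint (fun z => E z * wt N z)%C c1 (c2 - h) (c2 + h)).
    assert (HV : is_RInt (fun y => RtoC (e y) * E (c1, y))%C (c2 - h) (c2 + h) V).
    { eapply (is_RInt_ext); [intros y _; apply weighted_left|].
      apply (RInt_correct (V := CV)). apply (hol_ex_RInt_v (fun z => E z * wt N z)%C), hol_weighted. }
    assert (HJc : is_RInt (fun y => RtoC (e y) * E (c1, c2))%C (c2 - h) (c2 + h) (RtoC J * E (c1, c2))%C).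
    { apply is_RInt_RtoC_mult, (RInt_correct (V := R_CompleteNormedModule)). exact Hexe. }
    pose proof (is_RInt_minus _ _ _ _ _ _ HJc HV) as Hdiff.
    assert (Hmaj : is_RInt (fun y => plus (scal (A / 2) (e y)) (2 * B * exp (- (N * d ^ 2)))) (c2 - h) (c2 + h)
        (plus (scal (A / 2) J) (scal ((c2 + h) - (c2 - h)) (2 * B * exp (- (N * d ^ 2)))))).
    { apply (is_RInt_plus (V := R_NormedModule)).
      - apply (is_RInt_scal (V := R_NormedModule)). apply (RInt_correct (V := R_CompleteNormedModule)). exact Hexe.
      - apply (is_RInt_const (V := R_NormedModule)). }
    assert (Hpt : forall y, c2 - h <= y <= c2 + h ->
      @norm R_AbsRing CV (minus (RtoC (e y) * E (c1, c2))%C (RtoC (e y) * E (c1, y))%C)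
      <= plus (scal (A / 2) (e y)) (2 * B * exp (- (N * d ^ 2)))).
    { intros y Hy.
      change (@norm R_AbsRing C_R_NormedModule (RtoC (e y) * E (c1, c2) - RtoC (e y) * E (c1, y))%C <= A / 2 * e y + 2 * B * exp (- (N * d ^ 2))).
      rewrite norm_CV.
      replace (RtoC (e y) * E (c1, c2) - RtoC (e y) * E (c1, y))%C
        with (RtoC (e y) * - (E (c1, y) - E (c1, c2)))%C by ring.
      rewrite Cmod_mult, Cmod_opp, Cmod_R.
      assert (Hey : 0 < e y) by apply exp_pos. rewrite Rabs_pos_eq by lra.
      pose proof (exp_pos (- (N * d ^ 2))).
      (* Near [c2] continuity bounds the oscillation of [E] by [A / 2]; further away the Gaussian is
         at most [exp (- (N * d ^ 2))]. *)
      destruct (Rlt_dec (Rabs (y - c2)) d) as [Hy1|Hy1].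
      - specialize (Hloc y ltac:(lra)). simpl in Hloc.
        nra.
      - assert (Hed : e y <= exp (- (N * d ^ 2))).
        { unfold e. apply exp_le, Ropp_le_contravar, Rmult_le_compat_l; [lra|].
          rewrite <- (pow2_abs (y - c2)). apply pow_incr; lra. }
        assert (Cmod (E (c1, y) - E (c1, c2)) <= 2 * B).
        { eapply Rle_trans; [apply Cmod_sub_triangle|]. pose proof (HBd y Hy). fold A. lra. }
        pose proof (Cmod_ge_0 (E (c1, y) - E (c1, c2))).
        nra. }
    assert (Hn := norm_RInt_le _ _ (c2 - h) (c2 + h) _ _ ltac:(unfold h; lra) Hpt Hdiff Hmaj). clear Hpt.
    change (@norm R_AbsRing C_R_NormedModule (RtoC J * E (c1, c2) - V)%C <=
       A / 2 * J + ((c2 + h) - (c2 - h)) * (2 * B * exp (- (N * d ^ 2)))) in Hn.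
    rewrite norm_CV in Hn.
    assert (HVb : Cmod V <= M * exp (- N)) by (now apply Hleft).
    assert (HJ0 : 0 < J).
    { eapply Rlt_le_trans; [|exact HJ]. apply Rmult_lt_0_compat; [lra|apply exp_pos]. }
    assert (HAJ : A * J <= A / 2 * J + ((c2 + h) - (c2 - h)) * (2 * B * exp (- (N * d ^ 2))) + M * exp (- N)).
    { replace (A * J) with (Cmod (RtoC J * E (c1, c2))%C)
        by (rewrite Cmod_mult, Cmod_R, Rabs_pos_eq by lra; fold A; ring).
      replace (RtoC J * E (c1, c2))%C with ((RtoC J * E (c1, c2) - V) + V)%C by ring.
      eapply Rle_trans; [apply Cmod_triangle|]. lra. }
    assert (Hd2' : d ^ 2 <= 1) by (rewrite <- (pow1 2); apply pow_incr; lra).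
    assert (HeN : exp (- N) <= exp (- (N * d ^ 2))).
    { apply exp_le. clear - HN Hd2'. nra. }
    assert (M * exp (- N) <= M * exp (- (N * d ^ 2))) by (apply Rmult_le_compat_l; lra).
    assert (A / 2 * (d * exp (- (N * (d / 2) ^ 2))) <= A / 2 * J) by (apply Rmult_le_compat_l; lra).
    lra. }
  set (K := M + 4 * h * B) in *.
  assert (Hg : 0 < A / 2 * d * (3 / 4 * d ^ 2)).
  { apply Rmult_lt_0_compat; [nra|]. assert (0 < d ^ 2) by (apply pow_lt; lra). lra. }
  (* [3 / 4 * d ^ 2] is the gap between the two rates. By [1 + x <= exp x], this [N] already pushes
     [A / 2 * d * exp (3 / 4 * d ^ 2 * N)] above [K]. *)
  set (N := Rabs K / (A / 2 * d * (3 / 4 * d ^ 2))).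
  assert (HN : 0 <= N) by (apply Rdiv_le_0_compat; [apply Rabs_pos|exact Hg]).
  specialize (Key N HN).
  assert (Hs : exp (- (N * (d / 2) ^ 2)) = exp (3 / 4 * d ^ 2 * N) * exp (- (N * d ^ 2)))
    by (rewrite <- exp_plus; f_equal; field).
  rewrite Hs in Key. pose proof (exp_pos (- (N * d ^ 2))).
  assert (Key' : A / 2 * d * exp (3 / 4 * d ^ 2 * N) <= K).
  { apply Rmult_le_reg_r with (exp (- (N * d ^ 2))); [lra|]. nra. }
  pose proof (exp_ineq1_le (3 / 4 * d ^ 2 * N)).
  assert (A / 2 * d * (3 / 4 * d ^ 2) * N = Rabs K) by (unfold N; field; lra).
  pose proof (Rle_abs K). nra.
Qed.
End UniqueContinuation.

Lemma unique_continuation (E : C -> C) (sigma : R) : hol E ->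
  (forall s, sigma < Re s -> E s = RtoC 0) -> forall s, E s = RtoC 0.
Proof.
  intros HE H0 [c1 c2]. destruct (Rle_dec c1 sigma) as [Hc|Hc].
  - now apply (vanish_at E HE sigma H0).
  - apply H0. simpl; lra.
Qed.

(** * Real powers of power series *)

Definition geom_bounded (b : nat -> R) (r C : R) : Prop := forall n, Rabs (b n) * r ^ n <= C.

Lemma geom_bounded_nonneg (b : nat -> R) (r C : R) : 0 < r -> geom_bounded b r C -> 0 <= C.
Proof.
  intros Hr H. specialize (H 0%nat). simpl in H. pose proof (Rabs_pos (b 0%nat)). lra.
Qed.

Lemma geom_bounded_radius (b : nat -> R) (r C x : R) :
  geom_bounded b r C -> Rabs x < r -> Rbar_lt (Rabs x) (CV_radius b).
Proof.
  intros H Hx. destruct (CV_radius_bounded b) as [Hub _].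
  apply Rbar_lt_le_trans with (Finite r); [exact Hx|].
  apply Hub. exists C. intros n. rewrite Rabs_mult, <- RPow_abs, (Rabs_pos_eq r); [apply H|].
  pose proof (Rabs_pos x); lra.
Qed.

Lemma geom_bounded_term (b : nat -> R) (r C x : R) (n : nat) : 0 < r ->
  geom_bounded b r C -> Rabs (b n * x ^ n) <= C * (Rabs x / r) ^ n.
Proof.
  intros Hr H. assert (Hp : 0 < r ^ n) by (apply pow_lt; lra).
  rewrite Rabs_mult, <- RPow_abs. unfold Rdiv. rewrite Rpow_mult_distr, pow_inv.
  apply Rmult_le_reg_r with (r ^ n); [exact Hp|].
  replace (C * (Rabs x ^ n * / r ^ n) * r ^ n) with (C * Rabs x ^ n) by (field; lra).
  replace (Rabs (b n) * Rabs x ^ n * r ^ n) with (Rabs (b n) * r ^ n * Rabs x ^ n) by ring.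
  apply Rmult_le_compat_r; [apply pow_le, Rabs_pos|apply H].
Qed.

Lemma geom_ratio (r x : R) : Rabs x < r -> Rabs (Rabs x / r) < 1.
Proof.
  intros Hx. pose proof (Rabs_pos x).
  rewrite Rabs_pos_eq by (apply Rdiv_le_0_compat; lra).
  apply Rmult_lt_reg_r with r; [lra|]. field_simplify; lra.
Qed.

Lemma geom_bounded_PSeries (b : nat -> R) (r C x : R) :
  geom_bounded b r C -> Rabs x < r -> Rabs (PSeries b x) <= C * (r / (r - Rabs x)).
Proof.
  intros H Hx. pose proof (Rabs_pos x).
  pose proof (is_series_geom _ (geom_ratio r x Hx)) as G.
  assert (G2 : is_series (fun n => C * (Rabs x / r) ^ n) (C * (r / (r - Rabs x)))).
  { replace (r / (r - Rabs x)) with (/ (1 - Rabs x / r)) by (field; lra).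
    apply (is_series_scal C _ _ G). }
  assert (E1 : ex_series (fun n => Rabs (b n * x ^ n))).
  { apply (ex_series_le (V := R_CompleteNormedModule) _ (fun n => C * (Rabs x / r) ^ n)).
    - intros n. change (Rabs (Rabs (b n * x ^ n)) <= C * (Rabs x / r) ^ n).
      rewrite Rabs_Rabsolu. apply geom_bounded_term; [lra|exact H].
    - eexists; exact G2. }
  unfold PSeries. eapply Rle_trans; [apply Series_Rabs; exact E1|].
  rewrite <- (is_series_unique _ _ G2). apply Series_le.
  - intros n. split; [apply Rabs_pos|]. apply geom_bounded_term; [lra|exact H].
  - eexists; exact G2.
Qed.

(* Division by [x - T]: the quotient has coefficients e_n = sum_j b_(n+1+j) T^j. *)
Lemma PSeries_divide (b : nat -> R) (r C T : R) :
  geom_bounded b r C -> Rabs T < r -> PSeries b T = 0 ->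
  exists e, geom_bounded e r (C / (r - Rabs T)) /\
    forall x, Rabs x < r -> PSeries b x = (x - T) * PSeries e x.
Proof.
  intros H HT H0. pose proof (Rabs_pos T) as HT0.
  assert (Hdec : forall n, geom_bounded (PS_decr_n b n) r (C / r ^ n)).
  { intros n k. unfold PS_decr_n. assert (Hp : 0 < r ^ n) by (apply pow_lt; lra).
    apply Rmult_le_reg_r with (r ^ n); [exact Hp|].
    replace (C / r ^ n * r ^ n) with C by (field; lra).
    rewrite Rmult_assoc, <- pow_add, (Nat.add_comm k n). apply H. }
  assert (Hex : forall n, ex_pseries (PS_decr_n b n) T).
  { intros n. apply CV_radius_inside. eapply geom_bounded_radius; [apply Hdec|exact HT]. }
  set (e := fun n => PSeries (PS_decr_n b (S n)) T).
  assert (Hrec : forall n, PSeries (PS_decr_n b n) T = b n + T * e n).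
  { intros n. rewrite PSeries_decr_1 by apply Hex. f_equal.
    - unfold PS_decr_n. now rewrite Nat.add_0_r.
    - unfold e. f_equal. apply PSeries_ext. intros k. unfold PS_decr_1, PS_decr_n. f_equal. lia. }
  assert (He : geom_bounded e r (C / (r - Rabs T))).
  { intros n. unfold e.
    pose proof (geom_bounded_PSeries _ _ _ T (Hdec (S n)) HT) as B.
    assert (Hp : 0 < r ^ n) by (apply pow_lt; lra).
    apply Rle_trans with (C / r ^ S n * (r / (r - Rabs T)) * r ^ n).
    - apply Rmult_le_compat_r; [lra|exact B].
    - right. simpl. field. lra. }
  exists e. split; [exact He|]. intros x Hx.
  assert (Ee : ex_pseries e x) by (apply CV_radius_inside; eapply geom_bounded_radius; [exact He|exact Hx]).
  rewrite (PSeries_ext b (PS_plus (PS_incr_1 e) (PS_scal (- T) e))).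
  - rewrite PSeries_plus.
    + rewrite PSeries_incr_1, PSeries_scal. ring.
    + now apply ex_pseries_incr_1.
    + apply ex_pseries_scal; [apply Rmult_comm|exact Ee].
  - intros n. unfold PS_plus, PS_scal. destruct n.
    + change (b 0%nat = 0 + - T * e 0%nat). pose proof (Hrec 0%nat) as R0.
      rewrite (PSeries_ext _ b) in R0 by reflexivity. lra.
    + change (b (S n) = e n + - T * e (S n)). pose proof (Hrec (S n)) as R1. fold (e n) in R1. lra.
Qed.

(** A zero of infinite order would allow division by [x - T] any number of times. Each division
    costs a factor [1 / d] in the coefficient bound and gains a factor [x0 - T] in the value at
    [x0]; as [Rabs (x0 - T) < d], that value would be zero. *)
Lemma PSeries_order (b : nat -> R) (r C T : R) :
  geom_bounded b r C -> Rabs T < r ->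
  (exists x, Rabs x < r /\ Rabs (x - T) < r - Rabs T /\ PSeries b x <> 0) ->
  exists (j : nat) e C', geom_bounded e r C' /\ PSeries e T <> 0 /\
    forall x, Rabs x < r -> PSeries b x = (x - T) ^ j * PSeries e x.
Proof.
  intros H HT [x0 [Hx0 [Hx0' Hne]]].
  set (d := r - Rabs T) in *. assert (Hd : 0 < d) by (unfold d; lra).
  apply NNPP. intros HN.
  assert (Hall : forall N : nat, exists e, geom_bounded e r (C / d ^ N) /\
    forall x, Rabs x < r -> PSeries b x = (x - T) ^ N * PSeries e x).
  { induction N as [|N [e [He1 He2]]].
    - exists b. split; [intros n; specialize (H n); simpl; lra|intros; simpl; ring].
    - destruct (Req_dec (PSeries e T) 0) as [Hz|Hz].
      + destruct (PSeries_divide e r _ T He1 HT Hz) as [e' [He1' He2']].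
        exists e'. split.
        * intros n. eapply Rle_trans; [apply He1'|]. right. fold d. simpl. field. split; first [lra | apply pow_nonzero; lra].
        * intros x Hx. rewrite He2, He2' by exact Hx. simpl; ring.
      + exfalso. apply HN. exists N, e, (C / d ^ N). auto. }
  apply Hne.
  set (q := Rabs (x0 - T) / d).
  assert (Hq0 : 0 <= q) by (apply Rdiv_le_0_compat; [apply Rabs_pos|lra]).
  assert (Hq : Rabs q < 1).
  { rewrite Rabs_pos_eq by lra. unfold q. apply Rmult_lt_reg_r with d; [lra|]. field_simplify; lra. }
  pose proof (geom_bounded_nonneg b r C ltac:(pose proof (Rabs_pos T); lra) H) as HC.
  set (K := C * (r / (r - Rabs x0))).
  assert (HK : 0 <= K).
  { apply Rmult_le_pos; [lra|]. pose proof (Rabs_pos x0). apply Rdiv_le_0_compat; lra. }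
  assert (Hb : forall N, Rabs (PSeries b x0) <= q ^ N * K).
  { intros N. destruct (Hall N) as [e [He1 He2]]. rewrite He2 by exact Hx0.
    rewrite Rabs_mult, <- RPow_abs.
    pose proof (geom_bounded_PSeries e r _ x0 He1 Hx0) as B.
    apply Rle_trans with (Rabs (x0 - T) ^ N * (C / d ^ N * (r / (r - Rabs x0)))).
    - apply Rmult_le_compat_l; [apply pow_le, Rabs_pos|exact B].
    - right. unfold q, K, Rdiv. rewrite Rpow_mult_distr, pow_inv. ring. }
  destruct (Req_dec (PSeries b x0) 0) as [Hz|Hz]; [exact Hz|exfalso].
  assert (Hpos : 0 < Rabs (PSeries b x0)) by now apply Rabs_pos_lt.
  destruct (pow_lt_1_zero q Hq (Rabs (PSeries b x0) / (K + 1))) as [N HNN].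
  { apply Rdiv_lt_0_compat; lra. }
  specialize (HNN N (Nat.le_refl N)). specialize (Hb N).
  rewrite Rabs_pos_eq in HNN by (apply pow_le; lra).
  assert (q ^ N * (K + 1) < Rabs (PSeries b x0)).
  { apply Rmult_lt_compat_r with (r := K + 1) in HNN; [|lra].
    replace (Rabs (PSeries b x0) / (K + 1) * (K + 1)) with (Rabs (PSeries b x0)) in HNN by (field; lra).
    exact HNN. }
  nra.
Qed.

Lemma continuity_pt_eq_0 (Q : R -> R) (T d : R) : 0 < d -> continuity_pt Q T ->
  (forall x, 0 < Rabs (x - T) < d -> Q x = 0) -> Q T = 0.
Proof.
  intros Hd HQ H. apply NNPP. intros Hne.
  destruct (HQ (Rabs (Q T))) as [a [Ha Hc]]; [now apply Rabs_pos_lt|].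
  set (x := T + Rmin a d / 2).
  assert (Hm : 0 < Rmin a d) by (apply Rmin_glb_lt; lra).
  pose proof (Rmin_l a d). pose proof (Rmin_r a d).
  assert (Hx : Rabs (x - T) = Rmin a d / 2).
  { unfold x. replace (T + Rmin a d / 2 - T) with (Rmin a d / 2) by ring. apply Rabs_pos_eq; lra. }
  specialize (Hc x). rewrite (H x) in Hc by lra.
  assert (Hdist : dist R_met 0 (Q T) < Rabs (Q T)).
  { apply Hc. split.
    - split; [exact I|]. unfold x; lra.
    - simpl. unfold Rdist. rewrite Hx. lra. }
  simpl in Hdist. unfold Rdist in Hdist. rewrite Rminus_0_l, Rabs_Ropp in Hdist. lra.
Qed.

Lemma continuity_pt_neq_0 (Q : R -> R) (T : R) : continuity_pt Q T -> Q T <> 0 ->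
  exists d, 0 < d /\ forall x, Rabs (x - T) < d -> Q x <> 0.
Proof.
  intros HQ Hne.
  destruct (HQ (Rabs (Q T))) as [a [Ha Hc]]; [now apply Rabs_pos_lt|].
  exists a. split; [exact Ha|]. intros x Hx Hz.
  destruct (Req_dec x T) as [->|HxT]; [contradiction|].
  assert (Hdist : dist R_met (Q x) (Q T) < Rabs (Q T)).
  { apply Hc. split; [split; [exact I|auto]|exact Hx]. }
  simpl in Hdist. unfold Rdist in Hdist. rewrite Hz, Rminus_0_l, Rabs_Ropp in Hdist. lra.
Qed.

(** * The relation [w = K * p ^ alpha] across the zeros of [p] *)

Ltac cont_alg :=
  repeat first [assumption | apply continuity_pt_minus | apply continuity_pt_plus
    | apply continuity_pt_mult | apply continuity_pt_const; intros ? ?; reflexivity].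

(** Encodes [w = exp kappa * p ^ alpha] through logarithms, with zeros of [p] matched by zeros of
    [w]. *)
Definition power_at (alpha kappa p w : R) : Prop :=
  (p = 0 /\ w = 0) \/ (0 < p /\ 0 < w /\ ln w - alpha * ln p = kappa).

Lemma derive_zero_const (L : R -> R) (T d : R) :
  (forall x, Rabs (x - T) < d -> is_derive L x 0) ->
  forall x, Rabs (x - T) < d -> L x = L T.
Proof.
  intros H x Hx.
  assert (Hb : forall y, Rmin T x <= y <= Rmax T x -> Rabs (y - T) < d).
  { intros y Hy. eapply Rle_lt_trans; [|exact Hx]. unfold Rmin, Rmax in Hy.
    destruct (Rle_dec T x); split_Rabs; lra. }
  destruct (MVT_gen L T x (fun _ => 0)) as [c [_ Hc]].
  - intros y Hy. apply H, Hb. lra.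
  - intros y Hy. apply continuity_pt_filterlim.
    apply (ex_derive_continuous (V := R_NormedModule)). exists 0. apply H, Hb, Hy.
  - lra.
Qed.

(* At a zero T of p write p = (x-T)^j P and w = (x-T)^l W; the equation p w' = alpha p' w
   forces l = alpha j and then the same equation for (P, W), which do not vanish at T.
   Hence the constant in w = K p^alpha is the same on both sides of T. *)
Lemma power_relation_local (alpha : R) (p w p' w' P W P' W' : R -> R) (T d : R) (j l : nat) :
  0 < alpha -> 0 < d ->
  (forall x, Rabs (x - T) < d -> 0 <= p x /\ 0 <= w x) ->
  (forall x, Rabs (x - T) < d -> is_derive p x (p' x) /\ is_derive w x (w' x) /\
     is_derive P x (P' x) /\ is_derive W x (W' x)) ->
  continuity_pt P' T -> continuity_pt W' T ->
  (forall x, Rabs (x - T) < d -> p x * w' x = alpha * p' x * w x) ->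
  (forall x, Rabs (x - T) < d -> p x = (x - T) ^ j * P x /\ w x = (x - T) ^ l * W x) ->
  P T <> 0 -> W T <> 0 ->
  exists e kappa, 0 < e /\ forall x, Rabs (x - T) < e ->
    power_at alpha kappa (p x) (w x) /\ (x <> T -> 0 < p x).
Proof.
  intros Ha Hd Hpw Hder HP' HW' Hode Hfac HPT HWT.
  assert (cont : forall F F' : R -> R, (forall x, Rabs (x - T) < d -> is_derive F x (F' x)) -> continuity_pt F T).
  { intros F F' HF. apply continuity_pt_filterlim.
    apply (ex_derive_continuous (V := R_NormedModule)). exists (F' T). apply HF.
    rewrite Rminus_diag, Rabs_R0. exact Hd. }
  assert (HPc : continuity_pt P T) by (apply (cont P P'); intros x Hx; apply (Hder x Hx)).
  assert (HWc : continuity_pt W T) by (apply (cont W W'); intros x Hx; apply (Hder x Hx)).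
  destruct (continuity_pt_neq_0 P T HPc HPT) as [d1 [Hd1 HP]].
  destruct (continuity_pt_neq_0 W T HWc HWT) as [d2 [Hd2 HW]].
  (* The product rule multiplied by [x - T], so that the exponent [pred m] disappears and [m = 0] is
     no exception. *)
  assert (Hfd : forall (F F' G G' : R -> R) (m : nat),
    (forall x, Rabs (x - T) < d -> is_derive F x (F' x)) ->
    (forall x, Rabs (x - T) < d -> is_derive G x (G' x)) ->
    (forall x, Rabs (x - T) < d -> F x = (x - T) ^ m * G x) ->
    forall x, Rabs (x - T) < d -> (x - T) * F' x = (x - T) ^ m * (INR m * G x + (x - T) * G' x)).
  { intros F F' G G' m HF HG HFG x Hx.
    assert (HD : is_derive F x (INR m * (x - T) ^ pred m * G x + (x - T) ^ m * G' x)).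
    { apply (is_derive_ext_loc (fun y => (y - T) ^ m * G y)).
      - exists (mkposreal (d - Rabs (x - T)) ltac:(lra)). intros y Hy. symmetry. apply HFG.
        change (Rabs (y - x) < d - Rabs (x - T)) in Hy.
        replace (y - T) with ((y - x) + (x - T)) by ring.
        eapply Rle_lt_trans; [apply Rabs_triang|]. lra.
      - pose proof (HG x Hx) as HGx.
        assert (HpwD : is_derive (fun y => (y - T) ^ m) x (INR m * (x - T) ^ pred m)).
        { replace (INR m * (x - T) ^ pred m) with (INR m * 1 * (x - T) ^ pred m) by ring.
          apply (is_derive_pow (fun y => y - T)). auto_derive; [easy|ring]. }
        apply (is_derive_mult (fun y => (y - T) ^ m) G x _ _ HpwD HGx). apply Rmult_comm. }
    apply is_derive_unique in HD. rewrite (is_derive_unique _ _ _ (HF x Hx)) in HD. rewrite HD.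
    destruct m; simpl; ring. }
  (* Multiplied by [x - T] and freed of [(x - T) ^ (j + l)], the differential equation reads [Q = 0]
     away from [T]. By continuity [Q T = 0] too, and its value there is
     [(l - alpha * j) * P T * W T]. *)
  set (Q := fun x => P x * (INR l * W x + (x - T) * W' x) - alpha * (INR j * P x + (x - T) * P' x) * W x).
  assert (HQ0 : forall x, 0 < Rabs (x - T) < d -> Q x = 0).
  { intros x [Hx1 Hx2].
    pose proof (Hfd p p' P P' j (fun y Hy => proj1 (Hder y Hy)) (fun y Hy => proj1 (proj2 (proj2 (Hder y Hy)))) (fun y Hy => proj1 (Hfac y Hy)) x Hx2) as E1.
    pose proof (Hfd w w' W W' l (fun y Hy => proj1 (proj2 (Hder y Hy))) (fun y Hy => proj2 (proj2 (proj2 (Hder y Hy)))) (fun y Hy => proj2 (Hfac y Hy)) x Hx2) as E2.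
    pose proof (Hode x Hx2) as E3. destruct (Hfac x Hx2) as [E4 E5].
    assert (Hxn : x - T <> 0) by (intros Hz; rewrite Hz, Rabs_R0 in Hx1; lra).
    apply Rmult_eq_reg_l with ((x - T) ^ j * (x - T) ^ l); [|apply Rmult_integral_contrapositive; split; now apply pow_nonzero].
    rewrite Rmult_0_r.
    transitivity (p x * ((x - T) * w' x) - alpha * ((x - T) * p' x) * w x).
    - rewrite E1, E2, E4, E5. unfold Q. ring.
    - transitivity ((x - T) * (p x * w' x - alpha * p' x * w x)); [ring|]. rewrite E3. ring. }
  assert (cid : continuity_pt (fun x => x - T) T) by (apply derivable_continuous_pt; reg).
  assert (HQT : Q T = 0).
  { apply (continuity_pt_eq_0 Q T d Hd); [unfold Q; cont_alg|exact HQ0]. }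
  assert (Hl : INR l = alpha * INR j).
  { unfold Q in HQT. rewrite Rminus_diag in HQT.
    apply Rmult_eq_reg_r with (P T * W T); [|now apply Rmult_integral_contrapositive].
    lra. }
  set (Q1 := fun x => P x * W' x - alpha * P' x * W x).
  assert (HQ1 : forall x, 0 < Rabs (x - T) < d -> Q1 x = 0).
  { intros x Hx. pose proof (HQ0 x Hx) as E. unfold Q in E. rewrite Hl in E.
    assert (Hxn : x - T <> 0) by (intros Hz; rewrite Hz, Rabs_R0 in Hx; lra).
    apply Rmult_eq_reg_l with (x - T); [|exact Hxn]. unfold Q1. lra. }
  assert (HQ1T : Q1 T = 0).
  { apply (continuity_pt_eq_0 Q1 T d Hd); [unfold Q1; cont_alg|exact HQ1]. }
  (* The squares spare any discussion of the signs of [P], [W] and [x - T]. They also explain why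
     the constant found below is half of [L T]. *)
  set (L := fun x => ln (W x ^ 2) - alpha * ln (P x ^ 2)).
  set (e := Rmin d (Rmin d1 d2)).
  assert (He : 0 < e) by (repeat apply Rmin_glb_lt; lra).
  assert (e1 : e <= d) by apply Rmin_l.
  assert (e2 : e <= d1) by (eapply Rle_trans; [apply Rmin_r|apply Rmin_l]).
  assert (e3 : e <= d2) by (eapply Rle_trans; [apply Rmin_r|apply Rmin_r]).
  assert (HL : forall x, Rabs (x - T) < e -> L x = L T).
  { apply derive_zero_const. intros x Hx.
    assert (EQ1 : Q1 x = 0).
    { destruct (Req_dec x T) as [->|HxT]; [exact HQ1T|]. apply HQ1. split; [|lra].
      apply Rabs_pos_lt. lra. }
    destruct (Hder x ltac:(lra)) as [_ [_ [D1 D2]]].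
    pose proof (HP x ltac:(lra)) as NP. pose proof (HW x ltac:(lra)) as NW.
    assert (sq : forall t, t <> 0 -> 0 < t ^ 2) by (intros t Ht; apply pow2_gt_0; exact Ht).
    unfold L. unfold Q1 in EQ1.
    auto_derive.
    - repeat split; try (now apply sq); try (now exists (W' x)); try (now exists (P' x)).
    - replace (Derive (fun y => P y) x) with (P' x) by (symmetry; apply is_derive_unique, D1).
      replace (Derive (fun y => W y) x) with (W' x) by (symmetry; apply is_derive_unique, D2).
      replace (W' x) with (alpha * P' x * W x / P x).
      + field. split; assumption.
      + apply Rmult_eq_reg_l with (P x); [|exact NP]. field_simplify; [lra|exact NP]. }
  exists e, (L T / 2). split; [exact He|]. intros x Hx.
  destruct (Hfac x ltac:(lra)) as [F1 F2].
  pose proof (HP x ltac:(lra)) as NP. pose proof (HW x ltac:(lra)) as NW.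
  (* The premises also admit [x = T] when [j = l = 0], where the powers are 1. *)
  assert (Hreg : (x - T) ^ j <> 0 -> (x - T) ^ l <> 0 -> (INR j <> 0 -> x <> T) ->
    0 < p x /\ 0 < w x /\ ln (w x) - alpha * ln (p x) = L T / 2).
  { intros N1 N2 N3.
    assert (Hpx : p x <> 0) by (rewrite F1; now apply Rmult_integral_contrapositive).
    assert (Hwx : w x <> 0) by (rewrite F2; now apply Rmult_integral_contrapositive).
    destruct (Hpw x ltac:(lra)).
    assert (Hp0 : 0 < p x) by lra. assert (Hw0 : 0 < w x) by lra.
    split; [exact Hp0|]. split; [exact Hw0|].
    rewrite <- (HL x Hx). unfold L.
    assert (lnsq : forall t, 0 < t -> ln (t ^ 2) = 2 * ln t).
    { intros t Ht. rewrite ln_pow by exact Ht. simpl; ring. }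
    assert (lnp : forall m G, G <> 0 -> (INR m <> 0 -> x <> T) ->
      ln (((x - T) ^ m * G) ^ 2) = INR m * ln ((x - T) ^ 2) + ln (G ^ 2)).
    { intros m G HG Hm. rewrite Rpow_mult_distr.
      assert (Hm2 : 0 < ((x - T) ^ m) ^ 2).
      { apply pow2_gt_0. destruct m; [simpl; lra|]. apply pow_nonzero.
        assert (INR (S m) <> 0) by (apply not_0_INR; lia). lra. }
      rewrite ln_mult; [|exact Hm2|now apply pow2_gt_0]. f_equal.
      rewrite <- pow_mult, Nat.mul_comm, pow_mult.
      destruct m; [simpl; rewrite ln_1; ring|].
      rewrite ln_pow; [reflexivity|]. apply pow2_gt_0.
      assert (INR (S m) <> 0) by (apply not_0_INR; lia). lra. }
    assert (E1 : 2 * ln (p x) = INR j * ln ((x - T) ^ 2) + ln (P x ^ 2)).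
    { rewrite <- lnsq by exact Hp0. rewrite F1. now apply lnp. }
    assert (E2 : 2 * ln (w x) = INR l * ln ((x - T) ^ 2) + ln (W x ^ 2)).
    { rewrite <- lnsq by exact Hw0. rewrite F2. apply lnp; [exact NW|].
      intros Hl0. apply N3. intros Hj0. rewrite Hj0, Rmult_0_r in Hl. contradiction. }
    rewrite Hl in E2. nra. }
  destruct (Req_dec x T) as [->|HxT].
  - split; [|intros HH; now elim HH]. rewrite Rminus_diag in *.
    destruct j as [|j].
    + assert (l = 0%nat) as -> by (apply INR_eq; rewrite Hl; simpl; ring).
      right. apply Hreg; simpl; lra.
    + left. assert (l <> 0%nat).
      { intros ->.
        assert (0 < alpha * INR (S j)) by (apply Rmult_lt_0_compat; [lra|apply lt_0_INR; lia]). simpl INR at 1 in Hl. simpl (INR 0) in Hl. lra. }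
      destruct l as [|l]; [contradiction|]. rewrite F1, F2. simpl. split; ring.
  - assert (x - T <> 0) by lra.
    destruct Hreg as [R1 R2]; [now apply pow_nonzero|now apply pow_nonzero|auto|].
    split; [right; split; assumption|auto].
Qed.

(** Radius of convergence at least one, phrased through coefficient bounds so that it passes to
    termwise smaller series at once. *)
Definition disk_series (b : nat -> R) : Prop :=
  forall r, 0 < r < 1 -> exists C, geom_bounded b r C.

Lemma disk_series_radius (b : nat -> R) (x : R) : disk_series b -> Rabs x < 1 ->
  Rbar_lt (Rabs x) (CV_radius b).
Proof.
  intros H Hx. pose proof (Rabs_pos x).
  destruct (H ((Rabs x + 1) / 2) ltac:(lra)) as [C HC].
  eapply geom_bounded_radius; [exact HC|lra].
Qed.

Lemma geom_bounded_derive (b : nat -> R) (r C x : R) :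
  geom_bounded b r C -> Rabs x < r ->
  is_derive (PSeries b) x (PSeries (PS_derive b) x) /\ continuity_pt (PSeries (PS_derive b)) x.
Proof.
  intros H Hx. pose proof (geom_bounded_radius b r C x H Hx) as R.
  split; [now apply is_derive_PSeries|]. apply PSeries_continuity. now rewrite CV_radius_derive.
Qed.

Section PowerRelation.
Variables (alpha : R) (bp bw : nat -> R).
Hypotheses (Ha : 0 < alpha) (Hbp : disk_series bp) (Hbw : disk_series bw).
Let p := PSeries bp.
Let w := PSeries bw.
Hypotheses (Hpos : forall x, Rabs x < 1 -> 0 <= p x /\ 0 <= w x)
  (Hode : forall x, Rabs x < 1 ->
     p x * PSeries (PS_derive bw) x = alpha * PSeries (PS_derive bp) x * w x)
  (Hp0 : p 0 = 1) (Hw0 : w 0 = 1).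

Lemma power_relation_near (T : R) : 0 <= T < 1 ->
  (exists x, Rabs (x - T) < (1 - T) / 2 /\ p x <> 0 /\ w x <> 0) ->
  exists e kappa, 0 < e /\ forall x, Rabs (x - T) < e ->
    power_at alpha kappa (p x) (w x) /\ (x <> T -> 0 < p x).
Proof.
  intros HT [x0 [Hx0 [Np Nw]]].
  (* Halfway from [T] to the unit circle: then [r - Rabs T] equals [(1 - T) / 2], the radius within
     which [PSeries_order] wants a point with non-zero value. *)
  set (r := (1 + T) / 2). assert (Hr : 0 < r < 1) by (unfold r; lra).
  assert (ET : Rabs T = T) by (apply Rabs_pos_eq; lra).
  set (d := (1 - T) / 2) in *. assert (Ed : d = r - Rabs T) by (rewrite ET; unfold d, r; lra).
  assert (Hball : forall x, Rabs (x - T) < d -> Rabs x < r).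
  { intros x Hx. replace x with ((x - T) + T) by ring.
    eapply Rle_lt_trans; [apply Rabs_triang|]. lra. }
  destruct (Hbp r Hr) as [Cp HCp]. destruct (Hbw r Hr) as [Cw HCw].
  destruct (PSeries_order bp r Cp T HCp ltac:(unfold r; lra)) as [j [eP [CP [HP1 [HP2 HP3]]]]].
  { exists x0. repeat split; [now apply Hball|lra|exact Np]. }
  destruct (PSeries_order bw r Cw T HCw ltac:(unfold r; lra)) as [l [eW [CW [HW1 [HW2 HW3]]]]].
  { exists x0. repeat split; [now apply Hball|lra|exact Nw]. }
  assert (HTr : Rabs T < r) by (rewrite ET; unfold r; lra).
  apply (power_relation_local alpha p w (PSeries (PS_derive bp)) (PSeries (PS_derive bw))
    (PSeries eP) (PSeries eW) (PSeries (PS_derive eP)) (PSeries (PS_derive eW)) T d j l);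
    try assumption.
  - unfold d; lra.
  - intros x Hx. apply Hpos. pose proof (Hball x Hx). lra.
  - intros x Hx. pose proof (Hball x Hx) as Hxr. split; [|split; [|split]].
    + apply (geom_bounded_derive bp r Cp x HCp Hxr).
    + apply (geom_bounded_derive bw r Cw x HCw Hxr).
    + apply (geom_bounded_derive eP r CP x HP1 Hxr).
    + apply (geom_bounded_derive eW r CW x HW1 Hxr).
  - apply (geom_bounded_derive eP r CP T HP1 HTr).
  - apply (geom_bounded_derive eW r CW T HW1 HTr).
  - intros x Hx. apply Hode. pose proof (Hball x Hx). lra.
  - intros x Hx. split; [apply HP3|apply HW3]; now apply Hball.
Qed.

Let good (x : R) : Prop := power_at alpha 0 (p x) (w x).
(** The last clause asks for points with [p > 0] arbitrarily close to [t] from the left. It rules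
    out that [p] vanishes on an interval ending at [t], where the constant [kappa] would be lost. *)
Let S (t : R) : Prop := 0 <= t < 1 /\ (forall x, 0 <= x <= t -> good x) /\
  (forall h, 0 < h -> exists x, 0 <= x <= t /\ t - h < x /\ 0 < p x).

(** A continuation argument: if the relation failed at [t], the supremum [T] of [S] would be below
    1, and the local relation at [T], valid on both sides with one constant, would carry [S] beyond
    [T]. *)
Lemma power_relation_global (t : R) : 0 <= t < 1 -> power_at alpha 0 (p t) (w t).
Proof.
  intros Ht. apply NNPP. intros Hbad.
  assert (S0 : S 0).
  { split; [lra|]. split.
    - intros x Hx. replace x with 0 by lra. right. rewrite Hp0, Hw0, ln_1. lra.
    - intros h Hh. exists 0. rewrite Hp0. lra. }
  assert (Sub : forall s, S s -> s <= t).
  { intros s [_ [Hs _]]. apply Rnot_lt_le. intros Hlt. apply Hbad, Hs. lra. }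
  destruct (completeness S) as [T [HT1 HT2]].
  { exists t. intros s Hs. now apply Sub. }
  { exists 0. exact S0. }
  assert (T0 : 0 <= T) by (apply HT1, S0).
  assert (T1 : T < 1) by (apply Rle_lt_trans with t; [apply HT2; intros s Hs; now apply Sub|lra]).
  assert (Happrox : forall h, 0 < h -> exists s x, S s /\ T - h < s <= T /\ 0 <= x <= s /\ Rabs (x - T) < h /\ 0 < p x).
  { intros h Hh.
    assert (exists s, S s /\ T - h / 2 < s) as [s [Hs1 Hs2]].
    { apply NNPP. intros HN. assert (T <= T - h / 2); [|lra]. apply HT2. intros s Hs.
      apply Rnot_lt_le. intros Hlt. apply HN. now exists s. }
    pose proof (HT1 s Hs1). destruct (Hs1) as [_ [_ Hx]].
    destruct (Hx (h / 2) ltac:(lra)) as [x Hx'].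
    exists s, x. refine (conj Hs1 (conj _ (conj _ (conj _ _)))); try lra. apply Rabs_def1; lra. }
  destruct (power_relation_near T ltac:(lra)) as [e [kappa [He Hnear]]].
  { destruct (Happrox ((1 - T) / 2) ltac:(lra)) as [s [x [Hs [Hs' [Hx [Hx' Hpx]]]]]].
    exists x. split; [exact Hx'|]. split; [lra|].
    destruct Hs as [_ [Hs _]]. destruct (Hs x Hx) as [[H1 _]|[_ [H1 _]]]; lra. }
  destruct (Happrox e He) as [s [x1 [Hs [Hs' [Hx1 [Hx1' Hpx1]]]]]].
  (* At [x1] both relations hold and [p x1 > 0], so the logarithms identify the local constant with
     the global one. *)
  assert (K0 : kappa = 0).
  { destruct (Hnear x1 Hx1') as [[[H1 _]|[_ [_ H1]]] _]; [lra|].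
    destruct Hs as [_ [Hs _]]. destruct (Hs x1 Hx1) as [[H2 _]|[_ [_ H2]]]; lra. }
  subst kappa.
  set (m := Rmin e (1 - T)). assert (Hm : 0 < m) by (apply Rmin_glb_lt; lra).
  assert (Hm1 : m <= e) by apply Rmin_l. assert (Hm2 : m <= 1 - T) by apply Rmin_r.
  assert (ST : S (T + m / 2)).
  { split; [lra|]. split.
    - intros x Hx. destruct (Rle_dec x s) as [Hxs|Hxs].
      + apply Hs; lra.
      + apply Hnear. apply Rabs_def1; lra.
    - intros h Hh. exists (T + m / 2 - Rmin h (m / 2) / 2).
      assert (0 < Rmin h (m / 2)) by (apply Rmin_glb_lt; lra).
      pose proof (Rmin_l h (m / 2)). pose proof (Rmin_r h (m / 2)).
      repeat split; try lra. apply Hnear; [apply Rabs_def1; lra|lra]. }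
  pose proof (HT1 _ ST). lra.
Qed.

(** For [alpha <= 1] the power [p ^ alpha] is at most the larger of 1 and [p]. *)
Lemma power_relation_bound (t : R) : alpha <= 1 -> 0 <= t < 1 -> w t <= 1 + p t.
Proof.
  intros Ha1 Ht. destruct (power_relation_global t Ht) as [[-> ->]|[H1 [H2 H3]]]; [lra|].
  destruct (Rle_dec (p t) 1) as [Hp|Hp].
  - assert (ln (p t) <= 0) by (rewrite <- ln_1; apply ln_le; lra).
    assert (ln (w t) <= 0) by nra.
    assert (w t <= 1); [|lra].
    rewrite <- (exp_ln (w t)), <- exp_0 by lra. now apply exp_le.
  - assert (0 <= ln (p t)) by (rewrite <- ln_1; apply ln_le; lra).
    assert (ln (w t) <= ln (p t)) by nra.
    assert (w t <= p t); [|lra].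
    rewrite <- (exp_ln (w t)), <- (exp_ln (p t)) by lra. now apply exp_le.
Qed.
End PowerRelation.

(** * Operations on power series converging in the unit disk *)

Lemma disk_series_of_ex (b : nat -> R) :
  (forall x, 0 < x < 1 -> ex_series (fun n => b n * x ^ n)) -> disk_series b.
Proof.
  intros H r Hr. pose proof (ex_series_lim_0 _ (H r Hr)) as Hlim.
  apply is_lim_seq_Reals in Hlim.
  destruct (maj_by_pos (fun n => b n * r ^ n)) as [M [HM HB]].
  { exists 0. exact Hlim. }
  exists M. intros n. rewrite <- (Rabs_pos_eq (r ^ n)) by (apply pow_le; lra).
  rewrite <- Rabs_mult. apply HB.
Qed.

Lemma disk_series_le (b c : nat -> R) :
  (forall n, Rabs (c n) <= Rabs (b n)) -> disk_series b -> disk_series c.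
Proof.
  intros Hle Hb r Hr. destruct (Hb r Hr) as [C HC]. exists C. intros n.
  eapply Rle_trans; [|apply (HC n)]. apply Rmult_le_compat_r; [apply pow_le; lra|apply Hle].
Qed.

Lemma disk_series_ex (b : nat -> R) (x : R) : disk_series b -> Rabs x < 1 -> ex_pseries b x.
Proof. intros Hb Hx. now apply CV_radius_inside, disk_series_radius. Qed.

Lemma disk_series_plus (b c : nat -> R) : disk_series b -> disk_series c -> disk_series (PS_plus b c).
Proof.
  intros Hb Hc. apply disk_series_of_ex. intros x Hx.
  apply (proj1 (ex_pseries_R (PS_plus b c) x)). apply ex_pseries_plus; apply disk_series_ex; try assumption; rewrite Rabs_pos_eq; lra.
Qed.

Lemma disk_series_mult (b c : nat -> R) : disk_series b -> disk_series c -> disk_series (PS_mult b c).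
Proof.
  intros Hb Hc. apply disk_series_of_ex. intros x Hx.
  apply (proj1 (ex_pseries_R (PS_mult b c) x)). apply ex_pseries_mult; apply disk_series_radius; try assumption; rewrite Rabs_pos_eq; lra.
Qed.

Lemma disk_series_scal (k : R) (b : nat -> R) : disk_series b -> disk_series (fun n => k * b n).
Proof.
  intros Hb r Hr. destruct (Hb r Hr) as [C HC]. exists (Rabs k * C). intros n.
  rewrite Rabs_mult, Rmult_assoc. apply Rmult_le_compat_l; [apply Rabs_pos|apply HC].
Qed.

Lemma disk_series_derive (b : nat -> R) : disk_series b -> disk_series (PS_derive b).
Proof.
  intros Hb. apply disk_series_of_ex. intros x Hx.
  apply (proj1 (ex_pseries_R (PS_derive b) x)), CV_radius_inside. rewrite CV_radius_derive. apply disk_series_radius; [exact Hb|].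
  rewrite Rabs_pos_eq; lra.
Qed.

Lemma disk_series_decr_n (b : nat -> R) (n : nat) : disk_series b -> disk_series (PS_decr_n b n).
Proof.
  intros Hb r Hr. destruct (Hb r Hr) as [C HC]. exists (C / r ^ n). intros k.
  assert (0 < r ^ n) by (apply pow_lt; lra).
  apply Rmult_le_reg_r with (r ^ n); [assumption|]. unfold PS_decr_n.
  replace (C / r ^ n * r ^ n) with C by (field; lra).
  rewrite Rmult_assoc, <- pow_add, (Nat.add_comm k n). apply HC.
Qed.

(** Strong induction: once the lower coefficients vanish, the series is [x ^ n] times the shifted
    one, which therefore vanishes for positive [x], and by continuity at 0, where its value is
    [b n]. *)
Lemma disk_series_zero (b : nat -> R) : disk_series b ->
  (forall x, 0 < x < 1 -> PSeries b x = 0) -> forall n, b n = 0.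
Proof.
  intros Hb H0 n. induction n as [n IH] using (well_founded_induction Nat.lt_wf_0).
  assert (Hz : forall x, 0 < x < 1 -> PSeries (PS_decr_n b n) x = 0).
  { intros x Hx. pose proof (PSeries_decr_n_aux b n x IH) as E. rewrite H0 in E by exact Hx.
    symmetry in E. apply Rmult_integral in E. destruct E as [E|E]; [|exact E].
    exfalso. revert E. apply pow_nonzero. lra. }
  pose proof (disk_series_decr_n b n Hb) as Hd.
  assert (Hc : continuity_pt (PSeries (PS_decr_n b n)) 0).
  { apply PSeries_continuity, disk_series_radius; [exact Hd|]. rewrite Rabs_R0; lra. }
  assert (E0 : PSeries (PS_decr_n b n) 0 = 0).
  { apply NNPP. intros Hne. destruct (continuity_pt_neq_0 _ _ Hc Hne) as [d [Hd0 Hnz]].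
    set (x := Rmin d 1 / 2). assert (0 < Rmin d 1) by (apply Rmin_glb_lt; lra).
    pose proof (Rmin_l d 1). pose proof (Rmin_r d 1).
    apply (Hnz x); [|apply Hz; unfold x; lra]. rewrite Rminus_0_r, Rabs_pos_eq; unfold x; lra. }
  rewrite PSeries_decr_1 in E0 by (apply disk_series_ex; [exact Hd|rewrite Rabs_R0; lra]).
  rewrite Rmult_0_l, Rplus_0_r in E0. unfold PS_decr_n in E0. now rewrite Nat.add_0_r in E0.
Qed.

Lemma disk_series_unique (b c : nat -> R) : disk_series b -> disk_series c ->
  (forall x, 0 < x < 1 -> PSeries b x = PSeries c x) -> forall n, b n = c n.
Proof.
  intros Hb Hc H n.
  assert (E : PS_plus b (fun n => -1 * c n) n = 0).
  { apply disk_series_zero; [apply disk_series_plus; [exact Hb|now apply disk_series_scal]|].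
    intros x Hx.
    assert (Hx' : Rabs x < 1) by (rewrite Rabs_pos_eq; lra).
    rewrite PSeries_plus.
    - rewrite (PSeries_ext (fun n => -1 * c n) (PS_scal (-1) c)) by reflexivity.
      rewrite PSeries_scal, H by exact Hx. ring.
    - now apply disk_series_ex.
    - apply disk_series_ex; [now apply disk_series_scal|exact Hx']. }
  unfold PS_plus, plus in E; simpl in E. lra.
Qed.

Lemma sum_f_R0_lin2 (f g h : nat -> R) (k : R) (n : nat) :
  (forall i, (i <= n)%nat -> f i + g i = k * h i) ->
  sum_f_R0 f n + sum_f_R0 g n = k * sum_f_R0 h n.
Proof.
  induction n; intros H; simpl.
  - apply H; lia.
  - rewrite Rmult_plus_distr_l, <- IHn by (intros; apply H; lia).
    rewrite <- (H (S n)) by lia. ring.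
Qed.

Lemma PSeries_abs_le (b d : nat -> R) (x : R) : disk_series b ->
  (forall n, Rabs (d n) <= Rabs (b n)) -> 0 <= x < 1 ->
  Rabs (PSeries d x) <= PSeries (fun n => Rabs (b n)) x.
Proof.
  intros Hb Hle Hx. assert (Hx' : Rabs x < 1) by (rewrite Rabs_pos_eq; lra).
  assert (Hab : forall (u : nat -> R) n, Rabs (u n * x ^ n) = Rabs (u n) * x ^ n).
  { intros u n. rewrite Rabs_mult, (Rabs_pos_eq (x ^ n)) by (apply pow_le; lra). reflexivity. }
  unfold PSeries. eapply Rle_trans.
  - apply Series_Rabs, CV_disk_inside, disk_series_radius; [|exact Hx'].
    now apply (disk_series_le b).
  - apply Series_le.
    + intros n. split; [apply Rabs_pos|]. rewrite Hab.
      apply Rmult_le_compat_r; [apply pow_le; lra|apply Hle].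
    + apply (ex_series_ext (fun n => Rabs (b n * x ^ n))); [apply Hab|].
      now apply CV_disk_inside, disk_series_radius.
Qed.

(** * Moduli of a series and of its real power along a ray *)

Section Ray.
Variables (A c : nat -> R) (alpha : R).
Hypotheses (Ha : 0 < alpha <= 1) (HA : disk_series A) (Hc : disk_series c) (HA0 : A 0%nat = 1)
  (HFpos : forall x, 0 < x < 1 -> 0 < PSeries A x)
  (HFc : forall x, 0 < x < 1 -> PSeries c x = exp (alpha * ln (PSeries A x))).

(** Differentiating [c = A ^ alpha] on the interval [0 < x < 1] gives [A c' = alpha A' c] there.
    Uniqueness of coefficients makes it a formal identity, which can be used in all directions
    without a complex power of [A]. *)
Lemma power_ode_coeff (n : nat) :
  PS_mult A (PS_derive c) n = alpha * PS_mult (PS_derive A) c n.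
Proof.
  revert n. apply disk_series_unique.
  - apply disk_series_mult; [exact HA|now apply disk_series_derive].
  - apply disk_series_scal, disk_series_mult; [now apply disk_series_derive|exact Hc].
  - intros x Hx. assert (Hx' : Rabs x < 1) by (rewrite Rabs_pos_eq; lra).
    pose proof (disk_series_radius A x HA Hx') as RA. pose proof (disk_series_radius c x Hc Hx') as Rc.
    rewrite PSeries_mult by (try rewrite CV_radius_derive; assumption).
    rewrite (PSeries_ext (fun n => alpha * PS_mult (PS_derive A) c n) (PS_scal alpha (PS_mult (PS_derive A) c))) by reflexivity.
    rewrite PSeries_scal, PSeries_mult by (try rewrite CV_radius_derive; assumption).
    pose proof (is_derive_PSeries A x RA) as DA. pose proof (is_derive_PSeries c x Rc) as Dc.
    pose proof (HFpos x Hx) as Fp.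
    assert (D2 : is_derive (fun x => exp (alpha * ln (PSeries A x))) x
      (PSeries (PS_derive A) x * (alpha * / PSeries A x * exp (alpha * ln (PSeries A x))))).
    { auto_derive.
      - repeat split; [now exists (PSeries (PS_derive A) x)|exact Fp].
      - replace (Derive (fun y => PSeries A y) x) with (PSeries (PS_derive A) x)
          by (symmetry; apply is_derive_unique, DA). ring. }
    assert (D3 : is_derive (PSeries c) x
      (PSeries (PS_derive A) x * (alpha * / PSeries A x * exp (alpha * ln (PSeries A x))))).
    { apply (is_derive_ext_loc (fun x => exp (alpha * ln (PSeries A x)))); [|exact D2].
      exists (mkposreal (Rmin x (1 - x)) ltac:(apply Rmin_glb_lt; lra)).
      intros y Hy. change (Rabs (y - x) < Rmin x (1 - x)) in Hy.
      pose proof (Rmin_l x (1 - x)). pose proof (Rmin_r x (1 - x)).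
      symmetry. apply HFc. split_Rabs; lra. }
    apply is_derive_unique in Dc. apply is_derive_unique in D3. rewrite Dc in D3.
    rewrite D3, HFc by exact Hx. field. lra.
Qed.

(** The power relation is given for positive [x] only; continuity of both sides carries it to 0. *)
Lemma power_coeff_0 : c 0%nat = 1.
Proof.
  assert (EA : PSeries A 0 = 1) by (rewrite PSeries_0; exact HA0).
  set (g := fun x => PSeries c x - exp (alpha * ln (PSeries A x))).
  assert (Hg : continuity_pt g 0).
  { assert (R0 : Rabs 0 < 1) by (rewrite Rabs_R0; lra).
    pose proof (is_derive_PSeries A 0 (disk_series_radius A 0 HA R0)) as DA.
    pose proof (is_derive_PSeries c 0 (disk_series_radius c 0 Hc R0)) as Dc.
    apply continuity_pt_filterlim. apply (ex_derive_continuous g).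
    unfold g. auto_derive. repeat split; [eexists; exact Dc|eexists; exact DA|rewrite EA; lra]. }
  destruct (Req_dec (g 0) 0) as [Hz|Hz].
  - unfold g in Hz. rewrite EA, ln_1, Rmult_0_r, exp_0, PSeries_0 in Hz. lra.
  - exfalso. destruct (continuity_pt_neq_0 g 0 Hg Hz) as [d [Hd H]].
    pose proof (Rmin_l d 1). pose proof (Rmin_r d 1).
    assert (0 < Rmin d 1) by (apply Rmin_glb_lt; lra).
    apply (H (Rmin d 1 / 2)).
    + rewrite Rminus_0_r, Rabs_pos_eq; lra.
    + unfold g. rewrite HFc by lra. ring.
Qed.

Variable theta : R.
(** With [twist_sin], the real and imaginary parts of the series at [x e^(i theta)], as real power
    series in [x]. *)
Definition twist_cos (b : nat -> R) (n : nat) : R := b n * cos (INR n * theta).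
Definition twist_sin (b : nat -> R) (n : nat) : R := b n * sin (INR n * theta).

Lemma twist_cos_le (b : nat -> R) (n : nat) : Rabs (twist_cos b n) <= Rabs (b n).
Proof.
  unfold twist_cos. rewrite Rabs_mult.
  pose proof (Rabs_cos_le_1 (INR n * theta)). pose proof (Rabs_pos (b n)). nra.
Qed.

Lemma twist_sin_le (b : nat -> R) (n : nat) : Rabs (twist_sin b n) <= Rabs (b n).
Proof.
  unfold twist_sin. rewrite Rabs_mult.
  pose proof (Rabs_sin_le_1 (INR n * theta)). pose proof (Rabs_pos (b n)). nra.
Qed.

Lemma disk_series_cos (b : nat -> R) : disk_series b -> disk_series (twist_cos b).
Proof. apply disk_series_le, twist_cos_le. Qed.

Lemma disk_series_sin (b : nat -> R) : disk_series b -> disk_series (twist_sin b).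
Proof. apply disk_series_le, twist_sin_le. Qed.

(* |sum b_n (x e^(i theta))^n|^2 as a power series in x. *)
Definition ray_sq (b : nat -> R) : nat -> R :=
  PS_plus (PS_mult (twist_cos b) (twist_cos b)) (PS_mult (twist_sin b) (twist_sin b)).

Lemma disk_series_ray_sq (b : nat -> R) : disk_series b -> disk_series (ray_sq b).
Proof.
  intros Hb. apply disk_series_plus; apply disk_series_mult;
    first [now apply disk_series_cos | now apply disk_series_sin].
Qed.

Lemma ray_sq_eq (b : nat -> R) (x : R) : disk_series b -> Rabs x < 1 ->
  PSeries (ray_sq b) x = PSeries (twist_cos b) x ^ 2 + PSeries (twist_sin b) x ^ 2.
Proof.
  intros Hb Hx. pose proof (disk_series_cos b Hb) as H1. pose proof (disk_series_sin b Hb) as H2.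
  unfold ray_sq. rewrite PSeries_plus by (apply disk_series_ex; [now apply disk_series_mult|exact Hx]).
  rewrite !PSeries_mult by now apply disk_series_radius. ring.
Qed.

Lemma ray_sq_derive (b : nat -> R) (x : R) : disk_series b -> Rabs x < 1 ->
  PSeries (PS_derive (ray_sq b)) x =
  2 * (PSeries (twist_cos b) x * PSeries (PS_derive (twist_cos b)) x
       + PSeries (twist_sin b) x * PSeries (PS_derive (twist_sin b)) x).
Proof.
  intros Hb Hx. pose proof (disk_series_cos b Hb) as H1. pose proof (disk_series_sin b Hb) as H2.
  pose proof (is_derive_PSeries _ x (disk_series_radius _ x H1 Hx)) as D1.
  pose proof (is_derive_PSeries _ x (disk_series_radius _ x H2 Hx)) as D2.
  pose proof (is_derive_PSeries _ x (disk_series_radius _ x (disk_series_ray_sq b Hb) Hx)) as D3.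
  apply is_derive_unique in D3. rewrite <- D3. apply is_derive_unique.
  apply (is_derive_ext_loc (fun x => PSeries (twist_cos b) x ^ 2 + PSeries (twist_sin b) x ^ 2)).
  - exists (mkposreal (1 - Rabs x) ltac:(lra)). intros y Hy. change (Rabs (y - x) < 1 - Rabs x) in Hy.
    symmetry. apply ray_sq_eq; [exact Hb|]. replace y with ((y - x) + x) by ring.
    eapply Rle_lt_trans; [apply Rabs_triang|]. lra.
  - auto_derive.
    + repeat split; eexists; eassumption.
    + replace (Derive (fun y => PSeries (twist_cos b) y) x) with (PSeries (PS_derive (twist_cos b)) x)
        by (symmetry; apply is_derive_unique, D1).
      replace (Derive (fun y => PSeries (twist_sin b) y) x) with (PSeries (PS_derive (twist_sin b)) x)
        by (symmetry; apply is_derive_unique, D2). ring.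
Qed.

Lemma PSeries_lin2 (a b d : nat -> R) (s x : R) : disk_series a -> disk_series b -> disk_series d ->
  Rabs x < 1 -> (forall n, a n + s * b n = d n) -> PSeries a x + s * PSeries b x = PSeries d x.
Proof.
  intros H1 H2 H3 Hx H. rewrite <- PSeries_scal, <- PSeries_plus.
  - apply PSeries_ext. intros n. rewrite <- H. reflexivity.
  - now apply disk_series_ex.
  - apply disk_series_ex; [now apply disk_series_scal|exact Hx].
Qed.

(** Twisting is multiplicative by the addition formula. The angle is [S (i + j)] times [theta]
    because one factor is a derivative, whose coefficient at [x ^ n] comes from index [n + 1]. *)
Lemma twisted_product (trig : R -> R) (a1 a2 b1 b2 d e : nat -> R) (sg x : R) :
  (forall t, Rabs (trig t) <= 1) ->
  disk_series a1 -> disk_series a2 -> disk_series b1 -> disk_series b2 ->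
  disk_series d -> disk_series e -> Rabs x < 1 ->
  (forall i j, a1 i * b1 j + sg * (a2 i * b2 j) = trig (INR (S (i + j)) * theta) * (d i * e j)) ->
  PSeries a1 x * PSeries b1 x + sg * (PSeries a2 x * PSeries b2 x)
  = PSeries (fun n => trig (INR (S n) * theta) * PS_mult d e n) x.
Proof.
  intros Ht A1 A2 B1 B2 Hd He Hx H.
  rewrite <- !PSeries_mult by now apply disk_series_radius.
  apply PSeries_lin2; try (now apply disk_series_mult); [|exact Hx|].
  - apply (disk_series_le (PS_mult d e)); [|now apply disk_series_mult].
    intros n. rewrite Rabs_mult. specialize (Ht (INR (S n) * theta)).
    pose proof (Rabs_pos (PS_mult d e n)). nra.
  - intros n. unfold PS_mult. rewrite scal_sum.
    apply sum_f_R0_lin2. intros i Hi. specialize (H i (n - i)%nat).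
    replace (i + (n - i))%nat with n in H by lia.
    transitivity (a1 i * b1 (n - i)%nat + sg * (a2 i * b2 (n - i)%nat)); [ring|]. rewrite H. ring.
Qed.

(** Real and imaginary parts of [v u' = alpha v' u], where [v] and [u] are the series of [A] and [c]
    on the ray. Differentiation in [x] puts the same factor [e^(i theta)] on both sides. *)
Lemma ray_ode (x : R) : Rabs x < 1 ->
  PSeries (twist_cos A) x * PSeries (PS_derive (twist_cos c)) x
  + -1 * (PSeries (twist_sin A) x * PSeries (PS_derive (twist_sin c)) x)
  = alpha * (PSeries (PS_derive (twist_cos A)) x * PSeries (twist_cos c) x
  + -1 * (PSeries (PS_derive (twist_sin A)) x * PSeries (twist_sin c) x)) /\
  PSeries (twist_cos A) x * PSeries (PS_derive (twist_sin c)) x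
  + 1 * (PSeries (twist_sin A) x * PSeries (PS_derive (twist_cos c)) x)
  = alpha * (PSeries (PS_derive (twist_cos A)) x * PSeries (twist_sin c) x
  + 1 * (PSeries (PS_derive (twist_sin A)) x * PSeries (twist_cos c) x)).
Proof.
  intros Hx.
  pose proof (disk_series_cos A HA) as A1. pose proof (disk_series_sin A HA) as A2.
  pose proof (disk_series_cos c Hc) as C1. pose proof (disk_series_sin c Hc) as C2.
  pose proof (disk_series_derive _ A1). pose proof (disk_series_derive _ A2).
  pose proof (disk_series_derive _ C1). pose proof (disk_series_derive _ C2).
  pose proof (disk_series_derive _ HA). pose proof (disk_series_derive _ Hc).
  assert (E1 : forall i j, INR (S (i + j)) * theta = INR i * theta + INR (S j) * theta)
    by (intros; rewrite !S_INR, plus_INR; ring).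
  assert (E2 : forall i j, INR (S (i + j)) * theta = INR (S i) * theta + INR j * theta)
    by (intros; rewrite !S_INR, plus_INR; ring).
  split.
  - rewrite (twisted_product cos _ _ _ _ A (PS_derive c)), (twisted_product cos _ _ _ _ (PS_derive A) c);
      try assumption; try apply Rabs_cos_le_1.
    + rewrite <- PSeries_scal. apply PSeries_ext. intros n. rewrite power_ode_coeff.
      unfold PS_scal, scal; simpl; unfold mult; simpl. ring.
    + intros i j. unfold twist_cos, twist_sin, PS_derive. rewrite E2, cos_plus. ring.
    + intros i j. unfold twist_cos, twist_sin, PS_derive. rewrite E1, cos_plus. ring.
  - rewrite (twisted_product sin _ _ _ _ A (PS_derive c)), (twisted_product sin _ _ _ _ (PS_derive A) c);
      try assumption; try apply Rabs_sin_le_1.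
    + rewrite <- PSeries_scal. apply PSeries_ext. intros n. rewrite power_ode_coeff.
      unfold PS_scal, scal; simpl; unfold mult; simpl. ring.
    + intros i j. unfold twist_cos, twist_sin, PS_derive. rewrite E2, sin_plus. ring.
    + intros i j. unfold twist_cos, twist_sin, PS_derive. rewrite E1, sin_plus. ring.
Qed.

Lemma ray_sq_0 (b : nat -> R) : b 0%nat = 1 -> disk_series b -> PSeries (ray_sq b) 0 = 1.
Proof.
  intros H0 Hb. rewrite ray_sq_eq by (try rewrite Rabs_R0; try lra; exact Hb).
  rewrite !PSeries_0. unfold twist_cos, twist_sin. rewrite H0. simpl INR.
  rewrite Rmult_0_l, cos_0, sin_0. ring.
Qed.

(** The squared moduli are non-negative real series tied by the differential equation of an
    [alpha]-th power, with value 1 at 0. So they fall under [power_relation_bound], wherever the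
    zeros on the ray may be. *)
Lemma ray_power_bound (x : R) : 0 <= x < 1 ->
  PSeries (twist_cos c) x ^ 2 + PSeries (twist_sin c) x ^ 2
  <= 1 + (PSeries (twist_cos A) x ^ 2 + PSeries (twist_sin A) x ^ 2).
Proof.
  intros Hx. assert (Hx' : Rabs x < 1) by (rewrite Rabs_pos_eq; lra).
  rewrite <- !ray_sq_eq by assumption.
  apply (power_relation_bound alpha (ray_sq A) (ray_sq c)); try lra.
  - now apply disk_series_ray_sq.
  - now apply disk_series_ray_sq.
  - intros y Hy. rewrite !ray_sq_eq by assumption.
    split; apply Rplus_le_le_0_compat; apply pow2_ge_0.
  - intros y Hy. destruct (ray_ode y Hy) as [E1 E2].
    rewrite !ray_sq_derive, !ray_sq_eq by assumption.
    set (V1 := PSeries (twist_cos A) y) in *. set (V2 := PSeries (twist_sin A) y) in *.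
    set (U1 := PSeries (twist_cos c) y) in *. set (U2 := PSeries (twist_sin c) y) in *.
    set (V1' := PSeries (PS_derive (twist_cos A)) y) in *. set (V2' := PSeries (PS_derive (twist_sin A)) y) in *.
    set (U1' := PSeries (PS_derive (twist_cos c)) y) in *. set (U2' := PSeries (PS_derive (twist_sin c)) y) in *.
    apply Rminus_diag_uniq.
    (* Re (conj v conj u (v u' - alpha v' u)) = 0 *)
    transitivity (2 * ((V1 * U1 - V2 * U2) * ((V1 * U1' + -1 * (V2 * U2')) - alpha * (V1' * U1 + -1 * (V2' * U2)))
      + (V1 * U2 + V2 * U1) * ((V1 * U2' + 1 * (V2 * U1')) - alpha * (V1' * U2 + 1 * (V2' * U1))))).
    + ring.
    + rewrite E1, E2. ring.
  - apply ray_sq_0; assumption.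
  - apply ray_sq_0; [apply power_coeff_0|assumption].
Qed.

(** With [M] the series of absolute values, [1 + 2 * M ^ 2 <= (1 + 2 * M) ^ 2]. *)
Lemma ray_cos_bound (x : R) : 0 <= x < 1 ->
  Rabs (PSeries (twist_cos c) x) <= 1 + 2 * PSeries (fun n => Rabs (A n)) x.
Proof.
  intros Hx. pose proof (ray_power_bound x Hx) as H.
  pose proof (PSeries_abs_le A _ x HA (twist_cos_le A) Hx) as H1.
  pose proof (PSeries_abs_le A _ x HA (twist_sin_le A) Hx) as H2.
  set (U := PSeries (twist_cos c) x) in *. set (U2 := PSeries (twist_sin c) x) in *.
  set (V1 := PSeries (twist_cos A) x) in *. set (V2 := PSeries (twist_sin A) x) in *.
  set (M := PSeries (fun n => Rabs (A n)) x) in *.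
  pose proof (Rabs_pos V1). pose proof (Rabs_pos V2).
  rewrite <- (pow2_abs V1), <- (pow2_abs V2), <- (pow2_abs U) in H.
  apply Rnot_lt_le. intros Hlt.
  nra.
Qed.
End Ray.

(** * Cauchy's estimate and polynomial growth of the coefficients *)

Ltac as_R_eq := match goal with |- @eq _ ?a ?b => change (@eq R a b) end.

Lemma sin_nat_period (n : nat) : sin (INR n * (2 * PI)) = 0.
Proof.
  replace (INR n * (2 * PI)) with (0 + 2 * INR n * PI) by ring. rewrite sin_period. apply sin_0.
Qed.

Lemma is_RInt_cos_lin (k : R) : k <> 0 -> sin (k * (2 * PI)) = 0 ->
  is_RInt (fun t => cos (k * t)) 0 (2 * PI) 0.
Proof.
  intros Hk Hs.
  replace 0 with (minus (sin (k * (2 * PI)) / k) (sin (k * 0) / k)) at 2.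
  - apply (is_RInt_derive (fun t => sin (k * t) / k)).
    + intros t _. auto_derive; [easy|field; exact Hk].
    + intros t _. apply (ex_derive_continuous (fun t => cos (k * t))). auto_derive; easy.
  - rewrite Hs, Rmult_0_r, sin_0. unfold minus, plus, opp; simpl. field. exact Hk.
Qed.

Lemma cos_orthogonal (m n : nat) : (0 < m)%nat ->
  is_RInt (fun t => cos (INR n * t) * cos (INR m * t)) 0 (2 * PI) (if Nat.eqb n m then PI else 0).
Proof.
  intros Hm.
  assert (Hsum : is_RInt (fun t => cos ((INR n + INR m) * t)) 0 (2 * PI) 0).
  { apply is_RInt_cos_lin.
    - rewrite <- plus_INR. apply not_0_INR. lia.
    - rewrite <- plus_INR. apply sin_nat_period. }
  assert (Hdif : is_RInt (fun t => cos ((INR n - INR m) * t)) 0 (2 * PI) (if Nat.eqb n m then 2 * PI else 0)).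
  { destruct (Nat.eqb_spec n m) as [->|Hne].
    - apply (is_RInt_ext (fun _ => 1)).
      + intros t _. rewrite Rminus_diag, Rmult_0_l, cos_0. reflexivity.
      + replace (2 * PI) with (scal (2 * PI - 0) 1) at 2 by (unfold scal; simpl; unfold mult; simpl; ring).
        apply (is_RInt_const (V := R_NormedModule)).
    - apply is_RInt_cos_lin.
      + intros H. apply Hne, INR_eq. lra.
      + rewrite Rmult_minus_distr_r, sin_minus, !sin_nat_period. ring. }
  pose proof (is_RInt_scal _ _ _ (/ 2) _ (is_RInt_plus _ _ _ _ _ _ Hdif Hsum)) as H.
  change (is_RInt (fun t => / 2 * (cos ((INR n - INR m) * t) + cos ((INR n + INR m) * t))) 0 (2 * PI)
    (/ 2 * ((if Nat.eqb n m then 2 * PI else 0) + 0))) in H.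
  replace (/ 2 * ((if Nat.eqb n m then 2 * PI else 0) + 0)) with (if Nat.eqb n m then PI else 0) in H
    by (destruct (Nat.eqb n m); field).
  eapply is_RInt_ext; [|exact H]. intros t _; cbv beta; as_R_eq.
  rewrite Rmult_minus_distr_r, Rmult_plus_distr_r, cos_minus, cos_plus. field.
Qed.

Lemma trig_sum_coeff (b : nat -> R) (m N : nat) : (0 < m)%nat ->
  is_RInt (fun t => sum_f_R0 (fun n => b n * cos (INR n * t)) N * cos (INR m * t)) 0 (2 * PI)
    (if Nat.leb m N then PI * b m else 0).
Proof.
  intros Hm.
  assert (Hterm : forall n, is_RInt (fun t => b n * cos (INR n * t) * cos (INR m * t)) 0 (2 * PI)
    (if Nat.eqb n m then PI * b m else 0)).
  { intros n. pose proof (is_RInt_scal _ _ _ (b n) _ (cos_orthogonal m n Hm)) as H.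
    change (is_RInt (fun t => b n * (cos (INR n * t) * cos (INR m * t))) 0 (2 * PI)
      (b n * (if Nat.eqb n m then PI else 0))) in H.
    replace (b n * (if Nat.eqb n m then PI else 0)) with (if Nat.eqb n m then PI * b m else 0) in H
      by (destruct (Nat.eqb_spec n m) as [Hnm|]; [rewrite Hnm|]; ring).
    eapply is_RInt_ext; [|exact H]. intros t _; cbv beta; as_R_eq. ring. }
  induction N as [|N IH].
  - destruct m; [lia|]. exact (Hterm 0%nat).
  - pose proof (is_RInt_plus _ _ _ _ _ _ IH (Hterm (S N))) as H.
    change (is_RInt (fun t => sum_f_R0 (fun n => b n * cos (INR n * t)) N * cos (INR m * t)
      + b (S N) * cos (INR (S N) * t) * cos (INR m * t)) 0 (2 * PI)
      ((if Nat.leb m N then PI * b m else 0) + (if Nat.eqb (S N) m then PI * b m else 0))) in H.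
    replace ((if Nat.leb m N then PI * b m else 0) + (if Nat.eqb (S N) m then PI * b m else 0))
      with (if Nat.leb m (S N) then PI * b m else 0) in H
      by (destruct (Nat.leb_spec m N), (Nat.eqb_spec (S N) m), (Nat.leb_spec m (S N)); first [lia|ring]).
    eapply is_RInt_ext; [|exact H]. intros t _; cbn [sum_f_R0]; as_R_eq. ring.
Qed.

(** Carries a bound for the full sum over to partial sums at the price of the tail of the majorant;
    thus only finite trigonometric sums have to be integrated. *)
Lemma partial_sum_le (a b : nat -> R) (N : nat) : (forall n, Rabs (a n) <= b n) -> ex_series b ->
  Rabs (sum_f_R0 a N) <= Rabs (Series a) + (Series b - sum_f_R0 b N).
Proof.
  intros Hle Hb. pose proof (proj1 (ex_series_incr_n b (S N)) Hb) as Hb'.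
  assert (Ha : ex_series a) by exact (ex_series_le a b Hle Hb).
  rewrite (Series_incr_n a (S N)) by (try lia; exact Ha).
  rewrite (Series_incr_n b (S N)) by (try lia; exact Hb). simpl pred.
  set (t := Series (fun k => a (S N + k)%nat)).
  assert (B : Rabs t <= Series (fun k => b (S N + k)%nat)).
  { eapply Rle_trans; [apply Series_Rabs|].
    - apply (ex_series_le (V := R_CompleteNormedModule) _ (fun k => b (S N + k)%nat)); [|exact Hb'].
      intros n. change (Rabs (Rabs (a (S N + n)%nat)) <= b (S N + n)%nat). rewrite Rabs_Rabsolu. apply Hle.
    - apply Series_le; [|exact Hb']. intros n. split; [apply Rabs_pos|apply Hle]. }
  pose proof (Rabs_triang (sum_f_R0 a N + t) (- t)) as T.
  replace (sum_f_R0 a N + t + - t) with (sum_f_R0 a N) in T by ring. rewrite Rabs_Ropp in T. lra.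
Qed.

(** Integration against [cos (m t)] over a period isolates [PI * c m * x ^ m]; the factor 2 is the
    period divided by [PI]. The coefficients are real, so the cosine part is enough. The truncation
    is taken so late that its tail stays below a quarter of the supposed excess. *)
Lemma cauchy_estimate (c : nat -> R) (x B : R) (m : nat) : disk_series c -> 0 <= x < 1 ->
  (0 < m)%nat -> (forall theta, Rabs (PSeries (twist_cos theta c) x) <= B) ->
  Rabs (c m) * x ^ m <= 2 * B.
Proof.
  intros Hc Hx Hm HB. assert (Hx' : Rabs x < 1) by (rewrite Rabs_pos_eq; lra).
  apply Rnot_lt_le. intros Hlt.
  pose proof (CV_disk_inside _ _ (disk_series_radius c x Hc Hx')) as Ea.
  pose proof (Series_correct _ Ea) as Sa. apply is_series_Reals in Sa.
  destruct (Sa ((Rabs (c m) * x ^ m - 2 * B) / 4) ltac:(lra)) as [N0 HN0].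
  set (N := max N0 m). specialize (HN0 N ltac:(unfold N; lia)).
  unfold Rdist in HN0.
  set (Sig := Series (fun n => Rabs (c n * x ^ n))) in *.
  set (sN := sum_f_R0 (fun n => Rabs (c n * x ^ n)) N) in *.
  assert (Ht : Sig - sN < (Rabs (c m) * x ^ m - 2 * B) / 4) by (split_Rabs; lra).
  assert (Hpt : forall t, 0 <= t <= 2 * PI ->
    @norm R_AbsRing R_NormedModule (sum_f_R0 (fun n => c n * x ^ n * cos (INR n * t)) N * cos (INR m * t)) <= B + (Sig - sN)).
  { intros t _. change (Rabs (sum_f_R0 (fun n => c n * x ^ n * cos (INR n * t)) N * cos (INR m * t)) <= B + (Sig - sN)).
    rewrite Rabs_mult.
    assert (H1 : Rabs (sum_f_R0 (fun n => c n * x ^ n * cos (INR n * t)) N) <= B + (Sig - sN)).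
    { eapply Rle_trans; [apply (partial_sum_le _ (fun n => Rabs (c n * x ^ n)) N); [|exact Ea]|].
      - intros n. rewrite Rabs_mult. pose proof (Rabs_cos_le_1 (INR n * t)).
        pose proof (Rabs_pos (c n * x ^ n)). nra.
      - apply Rplus_le_compat_r. eapply Rle_trans; [|apply (HB t)]. right. f_equal.
        apply Series_ext. intros n. unfold twist_cos. ring. }
    pose proof (Rabs_cos_le_1 (INR m * t)).
    pose proof (Rabs_pos (sum_f_R0 (fun n => c n * x ^ n * cos (INR n * t)) N)). nra. }
  pose proof (trig_sum_coeff (fun n => c n * x ^ n) m N Hm) as Hint.
  replace (Nat.leb m N) with true in Hint by (symmetry; apply Nat.leb_le; unfold N; lia).
  pose proof PI_RGT_0 as HPI.
  pose proof (norm_RInt_le_const _ 0 (2 * PI) _ _ ltac:(lra) Hpt Hint) as Hn.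
  change (Rabs (PI * (c m * x ^ m)) <= (2 * PI - 0) * (B + (Sig - sN))) in Hn.
  rewrite !Rabs_mult, (Rabs_pos_eq PI), (Rabs_pos_eq (x ^ m)) in Hn by (try apply pow_le; lra).
  assert (Rabs (c m) * x ^ m <= 2 * (B + (Sig - sN))); [|lra].
  apply Rmult_le_reg_l with PI; [exact HPI|]. lra.
Qed.

Lemma exp_INR_mult (x : R) (n : nat) : exp (INR n * x) = exp x ^ n.
Proof.
  induction n; [simpl; now rewrite Rmult_0_l, exp_0|].
  rewrite S_INR, Rmult_plus_distr_r, Rmult_1_l, exp_plus, IHn. simpl; ring.
Qed.

(** The [N]-th power of [u / N <= exp (u / N)]. *)
Lemma pow_le_exp (u : R) (N : nat) : 0 <= u -> u ^ N <= INR N ^ N * exp u.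
Proof.
  intros Hu. destruct N as [|N].
  - simpl. pose proof (exp_ineq1_le u). lra.
  - set (n := S N). assert (Hn : 0 < INR n) by (apply lt_0_INR; unfold n; lia).
    replace (exp u) with (exp (u / INR n) ^ n).
    + rewrite <- Rpow_mult_distr. apply pow_incr. split; [exact Hu|].
      pose proof (exp_ineq1_le (u / INR n)).
      apply Rle_trans with (INR n * (u / INR n)); [right; field; lra|].
      apply Rmult_le_compat_l; lra.
    + rewrite <- exp_INR_mult. f_equal. field. lra.
Qed.

Lemma exp_ge_pow (a : R) (N : nat) : 0 < a -> exists K, 0 <= K /\ forall t, 0 <= t -> t ^ N <= K * exp (a * t).
Proof.
  intros Ha. exists (INR N ^ N * (/ a) ^ N). split.
  - apply Rmult_le_pos; apply pow_le; [apply pos_INR|left; now apply Rinv_0_lt_compat].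
  - intros t Ht. replace t with (/ a * (a * t)) at 1 by (field; lra). rewrite Rpow_mult_distr.
    pose proof (pow_le_exp (a * t) N ltac:(nra)) as H.
    replace (INR N ^ N * (/ a) ^ N * exp (a * t)) with ((/ a) ^ N * (INR N ^ N * exp (a * t))) by ring.
    apply Rmult_le_compat_l; [|exact H]. apply pow_le. left; now apply Rinv_0_lt_compat.
Qed.

(** The partial sums stay below the telescoping bound [2 - / (n + 1)]. *)
Lemma ex_series_inv_sq : ex_series (fun n => / (INR n + 1) ^ 2).
Proof.
  set (u := fun n : nat => / (INR n + 1) ^ 2).
  assert (Hb : forall n, sum_n u n <= 2 - / (INR n + 1)).
  { induction n.
    - rewrite sum_O. unfold u. simpl. lra.
    - rewrite sum_Sn. unfold plus; simpl AbelianMonoid.plus. unfold u at 2. rewrite S_INR.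
      pose proof (pos_INR n) as Hn. set (t := INR n + 1) in *. 
      assert (Ht : 1 <= t) by (unfold t; lra).
      assert (/ (t + 1) ^ 2 <= / t - / (t + 1)).
      { replace (/ t - / (t + 1)) with (/ (t * (t + 1))) by (field; lra).
        apply Rinv_le_contravar; nra. }
      change (sum_n u n + / (t + 1) ^ 2 <= 2 - / (t + 1)). lra. }
  destruct (ex_finite_lim_seq_incr (sum_n u) 2) as [l Hl].
  - intros n. rewrite sum_Sn. assert (0 < u (S n)).
    { unfold u. apply Rinv_0_lt_compat, pow_lt. pose proof (pos_INR (S n)). lra. }
    change (sum_n u n <= sum_n u n + u (S n)). lra.
  - intros n. specialize (Hb n). assert (0 < / (INR n + 1)).
    { apply Rinv_0_lt_compat. pose proof (pos_INR n). lra. }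
    lra.
  - exists l. exact Hl.
Qed.

(* The surplus power of [y] buys the summable weight [(m + 1)^(-2)]. *)
Lemma poly_exp_decay (N : nat) (a : R) : 0 < a -> exists K, 0 <= K /\
  forall (m : nat) y, 0 < y ->
    (INR m + 1) ^ N * exp (- (a * (INR m + 1) * y))
    <= K * / (INR m + 1) ^ 2 * ((/ y) ^ (N + 2) * exp (- (a / 2 * y))).
Proof.
  intros Ha. destruct (exp_ge_pow (a / 2) (N + 2) ltac:(lra)) as [K [HK H]].
  exists K. split; [exact HK|]. intros m y Hy. pose proof (pos_INR m) as Hm.
  set (t := INR m + 1). assert (Ht : 1 <= t) by (unfold t; lra).
  assert (Hty : 0 <= t * y) by nra. specialize (H (t * y) Hty).
  assert (Hy2 : 0 < y ^ (N + 2)) by (apply pow_lt; lra).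
  assert (Ht2 : 0 < t ^ 2) by (apply pow_lt; lra).
  rewrite Rpow_mult_distr, (pow_add t) in H.
  assert (E : exp (- (a * t * y)) = exp (- (a / 2 * (t * y))) * exp (- (a / 2 * (t * y)))).
  { rewrite <- exp_plus. f_equal. field. }
  assert (E2 : exp (a / 2 * (t * y)) * exp (- (a / 2 * (t * y))) = 1).
  { rewrite <- exp_plus, Rplus_opp_r, exp_0. reflexivity. }
  assert (E3 : exp (- (a / 2 * (t * y))) <= exp (- (a / 2 * y))).
  { apply exp_le. apply Ropp_le_contravar. apply Rmult_le_compat_l; [lra|]. nra. }
  set (X := exp (- (a / 2 * (t * y)))) in *. assert (HX : 0 < X) by apply exp_pos.
  rewrite E, pow_inv.
  apply Rmult_le_reg_r with (t ^ 2 * y ^ (N + 2)); [now apply Rmult_lt_0_compat|].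
  replace (K * / t ^ 2 * (/ y ^ (N + 2) * exp (- (a / 2 * y))) * (t ^ 2 * y ^ (N + 2)))
    with (K * exp (- (a / 2 * y))) by (field; lra).
  replace (t ^ N * (X * X) * (t ^ 2 * y ^ (N + 2))) with ((t ^ N * t ^ 2 * y ^ (N + 2)) * X * X) by ring.
  apply Rle_trans with (K * exp (a / 2 * (t * y)) * X * X).
  - apply Rmult_le_compat_r; [lra|]. apply Rmult_le_compat_r; lra.
  - replace (K * exp (a / 2 * (t * y)) * X * X) with (K * (exp (a / 2 * (t * y)) * X) * X) by ring.
    rewrite E2. nra.
Qed.

(** The radius is [exp (- y)] with [/ y = m + 1], so the factor [(/ y) ^ (N + 2)] of
    [poly_exp_decay] is the polynomial in [m]. *)
Lemma poly_series_bound (A : nat -> R) (K : R) (N : nat) : 0 <= K ->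
  (forall n, Rabs (A n) <= K * (INR n + 1) ^ N) ->
  exists B, 0 <= B /\ forall m,
    PSeries (fun n => Rabs (A n)) (exp (- / (INR m + 1))) <= B * (INR m + 1) ^ (N + 2).
Proof.
  intros HK HA. destruct (poly_exp_decay N 1 Rlt_0_1) as [K1 [HK1 H1]].
  set (Z := Series (fun n => / (INR n + 1) ^ 2)).
  assert (Hsq : forall n, 0 <= / (INR n + 1) ^ 2).
  { intros n. pose proof (pos_INR n). left. apply Rinv_0_lt_compat, pow_lt. lra. }
  assert (HZ : 0 <= Z).
  { unfold Z. rewrite <- (Rmult_0_l (Series (fun n => / (INR n + 1) ^ 2))), <- Series_scal_l.
    apply Series_le; [|exact ex_series_inv_sq]. intros n. specialize (Hsq n). lra. }
  pose proof (exp_pos 1) as He.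
  exists (K * exp 1 * K1 * Z). split; [repeat apply Rmult_le_pos; lra|].
  intros m. pose proof (pos_INR m) as Hm.
  set (y := / (INR m + 1)). assert (Hy : 0 < y) by (apply Rinv_0_lt_compat; lra).
  assert (Hy1 : y <= 1) by (unfold y; rewrite <- Rinv_1; apply Rinv_le_contravar; lra).
  assert (Hiy : / y = INR m + 1) by (unfold y; apply Rinv_inv).
  set (T := (INR m + 1) ^ (N + 2)). assert (HT : 0 < T) by (apply pow_lt; lra).
  unfold PSeries. apply Rle_trans with (Series (fun n => K * exp 1 * K1 * T * / (INR n + 1) ^ 2)).
  - apply Series_le.
    + intros n. split; [apply Rmult_le_pos; [apply Rabs_pos|apply pow_le; left; apply exp_pos]|].
      specialize (H1 n y Hy). rewrite Hiy in H1. fold T in H1.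
      (* The decay lemma has [n + 1] in the exponent where the series has [n]; the shift costs
         [exp y <= exp 1]. *)
      replace (exp (- y) ^ n) with (exp (- (1 * (INR n + 1) * y)) * exp y)
        by (rewrite <- exp_INR_mult, <- exp_plus; f_equal; ring).
      set (X := exp (- (1 * (INR n + 1) * y))) in *. assert (HX : 0 < X) by apply exp_pos.
      pose proof (exp_pos y) as Hey. pose proof (exp_le y 1 Hy1) as Hey1.
      assert (Hh : exp (- (1 / 2 * y)) <= 1) by (apply exp_le_1; lra).
      specialize (Hsq n). set (q := / (INR n + 1) ^ 2) in *.
      apply Rle_trans with (K * (INR n + 1) ^ N * (X * exp y)).
      * apply Rmult_le_compat_r; [nra|apply HA].
      * replace (K * (INR n + 1) ^ N * (X * exp y)) with (K * ((INR n + 1) ^ N * X) * exp y) by ring.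
        replace (K * exp 1 * K1 * T * q) with (K * (K1 * q * (T * 1)) * exp 1) by ring.
        assert (0 <= (INR n + 1) ^ N) by (apply pow_le; pose proof (pos_INR n); lra).
        apply Rmult_le_compat; [|lra| |exact Hey1].
        -- apply Rmult_le_pos; [exact HK|]. apply Rmult_le_pos; lra.
        -- apply Rmult_le_compat_l; [exact HK|]. eapply Rle_trans; [exact H1|].
           apply Rmult_le_compat_l; [now apply Rmult_le_pos|]. apply Rmult_le_compat_l; lra.
    + apply (ex_series_scal (V := R_NormedModule)). exact ex_series_inv_sq.
  - rewrite Series_scal_l. fold Z. right. ring.
Qed.

(** Cauchy's estimate at radius [exp (- / (m + 1))]: there [x ^ m >= exp (- 1)], so dividing by it
    costs only a factor [exp 1], while the bound on the circle is still polynomial in [m]. *)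
Lemma power_coeff_bound (A c : nat -> R) (alpha K : R) (N : nat) :
  0 < alpha <= 1 -> disk_series A -> disk_series c -> A 0%nat = 1 ->
  (forall x, 0 < x < 1 -> 0 < PSeries A x) ->
  (forall x, 0 < x < 1 -> PSeries c x = exp (alpha * ln (PSeries A x))) ->
  (forall n, Rabs (A n) <= K * (INR n + 1) ^ N) ->
  exists K', 0 <= K' /\ forall m, Rabs (c m) <= K' * (INR m + 1) ^ (N + 2).
Proof.
  intros Ha HA Hc HA0 Hpos HFc Hb.
  assert (HK : 1 <= K).
  { specialize (Hb 0%nat). rewrite HA0, Rabs_R1 in Hb. simpl INR in Hb. rewrite Rplus_0_l, pow1 in Hb. lra. }
  destruct (poly_series_bound A K N ltac:(lra) Hb) as [B [HB HS]].
  exists (exp 1 * (2 * (1 + 2 * B))). pose proof (exp_pos 1) as He1.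
  split; [nra|]. intros m. pose proof (pos_INR m) as Hm.
  assert (Hpw : 1 <= (INR m + 1) ^ (N + 2)) by (apply pow_R1_Rle; lra).
  (* The constant coefficient is handled apart, since [cauchy_estimate] requires a positive
     index. *)
  destruct m as [|m].
  { rewrite (power_coeff_0 A c alpha HA Hc HA0 HFc), Rabs_R1.
    pose proof (exp_ineq1_le 1).
    assert (1 <= exp 1 * (2 * (1 + 2 * B))) by nra.
    rewrite <- (Rmult_1_l 1) at 1. apply Rmult_le_compat; lra. }
  set (M := S m) in *.
  set (x := exp (- / (INR M + 1))).
  assert (Hi : 0 < / (INR M + 1)) by (apply Rinv_0_lt_compat; lra).
  assert (Hx : 0 <= x < 1).
  { split; [left; apply exp_pos|]. rewrite <- exp_0. unfold x. apply exp_increasing. lra. }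
  specialize (HS M). fold x in HS.
  pose proof (cauchy_estimate c x (1 + 2 * (B * (INR M + 1) ^ (N + 2))) M Hc Hx ltac:(unfold M; lia)) as HC.
  assert (HC' : Rabs (c M) * x ^ M <= 2 * (1 + 2 * (B * (INR M + 1) ^ (N + 2)))).
  { apply HC. intros theta.
    eapply Rle_trans; [apply (ray_cos_bound A c alpha Ha HA Hc HA0 Hpos HFc theta x Hx)|]. lra. }
  assert (Hxm : exp (- 1) <= x ^ M).
  { unfold x. rewrite <- exp_INR_mult. apply exp_le.
    assert (INR M * / (INR M + 1) <= 1).
    { apply Rmult_le_reg_r with (INR M + 1); [lra|]. field_simplify; lra. }
    lra. }
  pose proof (Rabs_pos (c M)).
  assert (E1 : exp (- 1) * exp 1 = 1) by (rewrite <- exp_plus; replace (-1 + 1) with 0 by ring; apply exp_0).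
  assert (Rabs (c M) * exp (- 1) <= 2 * (1 + 2 * (B * (INR M + 1) ^ (N + 2)))).
  { eapply Rle_trans; [|exact HC']. apply Rmult_le_compat_l; lra. }
  replace (Rabs (c M)) with (exp 1 * (Rabs (c M) * exp (- 1))).
  - rewrite Rmult_assoc. apply Rmult_le_compat_l; lra.
  - transitivity (Rabs (c M) * (exp (- 1) * exp 1)); [ring|]. rewrite E1. ring.
Qed.

(** * Improper integrals *)

Definition continuous_pos (f : R -> C) : Prop :=
  forall y, 0 < y -> @continuous R_UniformSpace CV f y.

(** One parameter governs both ends, lower limit below [d] and upper limit above [/ d]; an inversion
    of the variable then exchanges the two conditions. *)
Definition int_conv (f : R -> C) (l : C) : Prop :=
  forall eps, 0 < eps -> exists d, 0 < d <= 1 /\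
    forall a b, 0 < a < d -> / d < b -> Cmod (@RInt CV f a b - l)%C < eps.

Lemma continuous_pos_ex_RInt (f : R -> C) (a b : R) : continuous_pos f -> 0 < a -> 0 < b ->
  @ex_RInt CV f a b.
Proof.
  intros Hf Ha Hb. apply (@ex_RInt_continuous CV). intros z Hz. apply Hf.
  eapply Rlt_le_trans; [|apply Hz]. now apply Rmin_glb_lt.
Qed.

Lemma int_conv_is_RInt_gen (f : R -> C) (l : C) : continuous_pos f -> int_conv f l ->
  @is_RInt_gen CV f (at_right 0) (Rbar_locally p_infty) l.
Proof.
  intros Hf H. intros P [eps HP].
  destruct (H eps (cond_pos eps)) as [d [[Hd Hd1] Hab]].
  exists (fun a => 0 < a < d) (fun b => / d < b).
  - exists (mkposreal d Hd). intros y Hy Hy0. change (Rabs (y - 0) < d) in Hy.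
    rewrite Rminus_0_r in Hy. split; [exact Hy0|]. split_Rabs; lra.
  - exists (/ d). auto.
  - intros a b Ha Hb. exists (@RInt CV f a b). split.
    + apply (RInt_correct). apply continuous_pos_ex_RInt; [exact Hf|lra|].
      cbn [fst snd]. assert (0 < / d) by now apply Rinv_0_lt_compat. lra.
    + apply HP. apply C_NormedModule_mixin_compat1. apply Hab; assumption.
Qed.

Lemma int_conv_integral (f : R -> C) (l : C) : continuous_pos f -> int_conv f l ->
  integral_0_infty f = l.
Proof.
  intros Hf H. unfold integral_0_infty.
  exact (@is_RInt_gen_unique CV (at_right 0) (Rbar_locally p_infty) _ _ f l (int_conv_is_RInt_gen f l Hf H)).
Qed.

Lemma int_conv_ext (f g : R -> C) (l : C) : (forall y, 0 < y -> f y = g y) ->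
  int_conv f l -> int_conv g l.
Proof.
  intros Hfg H eps Heps. destruct (H eps Heps) as [d [Hd Hab]]. exists d. split; [exact Hd|].
  intros a b Ha Hb. rewrite <- (RInt_ext (V := CV) f g); [now apply Hab|].
  intros y Hy. apply Hfg. assert (0 < / d) by (apply Rinv_0_lt_compat; lra).
  assert (0 < Rmin a b) by (apply Rmin_glb_lt; lra). lra.
Qed.

Lemma continuous_pos_ext (f g : R -> C) : (forall y, 0 < y -> f y = g y) ->
  continuous_pos f -> continuous_pos g.
Proof.
  intros Hfg Hf y Hy. apply (continuous_ext_loc _ f); [|now apply Hf].
  exists (mkposreal y Hy). intros z Hz. apply Hfg. change (Rabs (z - y) < y) in Hz. split_Rabs; lra.
Qed.

(** This weight is below both 1 and [/ y ^ 2], which gives explicit bounds for the integral near 0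
    and near infinity. *)
Definition dominated (M : R) (f : R -> C) : Prop := forall y, 0 < y -> Cmod (f y) <= M / (1 + y ^ 2).

Lemma dominated_nonneg (M : R) (f : R -> C) : dominated M f -> 0 <= M.
Proof.
  intros H. specialize (H 1 Rlt_0_1). pose proof (Cmod_ge_0 (f 1)).
  replace (M / (1 + 1 ^ 2)) with (M / 2) in H by (f_equal; ring). lra.
Qed.

Lemma dominated_RInt_near_0 (M : R) (f : R -> C) (a b : R) : continuous_pos f -> dominated M f ->
  0 < a <= b -> Cmod (@RInt CV f a b) <= M * (b - a).
Proof.
  intros Hf HM Hab. rewrite Rmult_comm. apply Cmod_RInt_le; [lra| |].
  - apply continuous_pos_ex_RInt; [exact Hf|lra|lra].
  - intros x Hx. pose proof (dominated_nonneg M f HM). eapply Rle_trans; [apply HM; lra|].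
    assert (0 <= x ^ 2) by apply pow2_ge_0.
    apply Rmult_le_reg_r with (1 + x ^ 2); [lra|].
    replace (M / (1 + x ^ 2) * (1 + x ^ 2)) with M by (field; lra). nra.
Qed.

Lemma dominated_RInt_near_infty (M : R) (f : R -> C) (a b : R) : continuous_pos f -> dominated M f ->
  0 < a <= b -> Cmod (@RInt CV f a b) <= M * (/ a - / b).
Proof.
  intros Hf HM Hab. rewrite <- norm_CV.
  apply (@norm_RInt_le C_R_NormedModule f (fun y => M * / y ^ 2) a b); [lra| | |].
  - intros x Hx. rewrite norm_CV. eapply Rle_trans; [apply HM; lra|].
    pose proof (dominated_nonneg M f HM).
    apply Rmult_le_compat_l; [lra|]. assert (0 < x ^ 2) by (apply pow_lt; lra).
    apply Rinv_le_contravar; lra.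
  - apply (RInt_correct (V := CV)). apply continuous_pos_ex_RInt; [exact Hf|lra|lra].
  - replace (M * (/ a - / b)) with (minus (- M / b) (- M / a))
      by (unfold minus, plus, opp; simpl; field; lra).
    apply (is_RInt_derive (fun y => - M / y)).
    + intros x Hx. rewrite Rmin_left, Rmax_right in Hx by lra. auto_derive; [lra|field; lra].
    + intros x Hx. rewrite Rmin_left, Rmax_right in Hx by lra.
      apply (ex_derive_continuous (fun y => M * / y ^ 2)). auto_derive.
      assert (0 < x ^ 2) by (apply pow_lt; lra). simpl in *; lra.
Qed.

Lemma RInt_sub_Chasles (f : R -> C) (a b c : R) : continuous_pos f -> 0 < a -> 0 < b -> 0 < c ->
  @RInt CV f a c = (@RInt CV f a b + @RInt CV f b c)%C.
Proof.
  intros Hf Ha Hb Hc. symmetry. apply (RInt_Chasles (V := CV)); now apply continuous_pos_ex_RInt.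
Qed.

Lemma RInt_swap_CV (f : R -> C) (a b : R) : continuous_pos f -> 0 < a -> 0 < b ->
  @RInt CV f a b = (- @RInt CV f b a)%C.
Proof.
  intros Hf Ha Hb. symmetry. apply (opp_RInt_swap (V := CV)). now apply continuous_pos_ex_RInt.
Qed.

Lemma dominated_RInt_abs (M : R) (f : R -> C) (a b : R) : continuous_pos f -> dominated M f ->
  0 < a -> 0 < b ->
  Cmod (@RInt CV f a b) <= M * Rabs (b - a) /\ Cmod (@RInt CV f a b) <= M * Rabs (/ b - / a).
Proof.
  intros Hf HM Ha Hb. destruct (Rle_dec a b) as [Hab|Hab].
  - assert (/ b <= / a) by (apply Rinv_le_contravar; lra).
    rewrite Rabs_pos_eq, (Rabs_left1 (/ b - / a)) by lra.
    split; [apply dominated_RInt_near_0; (assumption || lra)|].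
    replace (- (/ b - / a)) with (/ a - / b) by ring. apply dominated_RInt_near_infty; (assumption || lra).
  - assert (/ a <= / b) by (apply Rinv_le_contravar; lra).
    rewrite Rabs_left1, (Rabs_pos_eq (/ b - / a)) by lra. rewrite RInt_swap_CV, Cmod_opp by assumption.
    split; [|apply dominated_RInt_near_infty; (assumption || lra)].
    replace (- (b - a)) with (a - b) by ring. apply dominated_RInt_near_0; (assumption || lra).
Qed.

Lemma dominated_int_conv (M : R) (f : R -> C) : continuous_pos f -> dominated M f ->
  exists l, int_conv f l.
Proof.
  intros Hf HM. pose proof (dominated_nonneg M f HM) as HM0.
  destruct (proj1 (filterlim_locally_cauchy
    (F := filter_prod (at_right 0) (Rbar_locally p_infty))
    (fun ab => @RInt CV f (fst ab) (snd ab)))) as [l Hl].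
  (* Changing the limits costs at most [M * d] at each end, and this choice gives
     [M * d < eps / 2]. *)
  - intros eps. set (d := Rmin 1 (eps / (4 * (M + 1)))).
    pose proof (cond_pos eps) as He.
    assert (Hq : 0 < eps / (4 * (M + 1))) by (apply Rdiv_lt_0_compat; lra).
    assert (Hd : 0 < d) by (apply Rmin_glb_lt; lra).
    assert (Hd2 : d <= eps / (4 * (M + 1))) by apply Rmin_r.
    assert (HMd : M * d < eps / 2).
    { apply Rle_lt_trans with (M * (eps / (4 * (M + 1)))); [now apply Rmult_le_compat_l|].
      apply Rmult_lt_reg_r with (4 * (M + 1)); [lra|].
      replace (M * (eps / (4 * (M + 1))) * (4 * (M + 1))) with (M * eps) by (field; lra). nra. }
    exists (fun ab => 0 < fst ab < d /\ / d < snd ab). split.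
    + exists (fun a => 0 < a < d) (fun b => / d < b).
      * exists (mkposreal d Hd). intros y Hy Hy0. change (Rabs (y - 0) < d) in Hy.
        rewrite Rminus_0_r in Hy. split; [exact Hy0|]. split_Rabs; lra.
      * exists (/ d). auto.
      * auto.
    + intros [a b] [a' b'] [Ha Hb] [Ha' Hb']. cbn [fst snd] in *.
      assert (Hid : 0 < / d) by now apply Rinv_0_lt_compat.
      apply C_NormedModule_mixin_compat1.
      change (Cmod (@RInt CV f a' b' - @RInt CV f a b)%C < eps).
      rewrite (RInt_sub_Chasles f a' a b'), (RInt_sub_Chasles f a b b') by (assumption || lra).
      replace (@RInt CV f a' a + (@RInt CV f a b + @RInt CV f b b') - @RInt CV f a b)%C
        with (@RInt CV f a' a + @RInt CV f b b')%C by ring.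
      eapply Rle_lt_trans; [apply Cmod_triangle|].
      destruct (dominated_RInt_abs M f a' a Hf HM ltac:(lra) ltac:(lra)) as [B1 _].
      destruct (dominated_RInt_abs M f b b' Hf HM ltac:(lra) ltac:(lra)) as [_ B2].
      assert (Rabs (a - a') <= d) by (apply Rabs_le; lra).
      assert (Hib : forall b, / d < b -> 0 < / b < d).
      { intros c Hc. split; [apply Rinv_0_lt_compat; lra|]. rewrite <- (Rinv_inv d).
        apply Rinv_lt_contravar; [|exact Hc]. apply Rmult_lt_0_compat; lra. }
      pose proof (Hib b Hb). pose proof (Hib b' Hb').
      assert (Rabs (/ b' - / b) <= d) by (apply Rabs_le; lra).
      assert (M * Rabs (a - a') <= M * d) by now apply Rmult_le_compat_l.
      assert (M * Rabs (/ b' - / b) <= M * d) by now apply Rmult_le_compat_l.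
      lra.
  - exists l. intros eps Heps.
    destruct (ball_Cmod eps Heps) as [e He].
    destruct (proj1 (filterlim_locally _ _) Hl e) as [Q1 Q2 HQ1 HQ2 HQ].
    destruct HQ1 as [d1 H1]. destruct HQ2 as [B H2].
    (* Merges the thresholds [d1] at 0 and [B] at infinity into one number. *)
    set (d := Rmin 1 (Rmin d1 (/ (Rabs B + 1)))).
    pose proof (Rabs_pos B). pose proof (cond_pos d1).
    assert (HB : 0 < / (Rabs B + 1)) by (apply Rinv_0_lt_compat; lra).
    exists d. assert (Hd : 0 < d) by (repeat apply Rmin_glb_lt; lra).
    split; [split; [exact Hd|apply Rmin_l]|].
    intros a b Ha Hb.
    assert (Hd1 : d <= d1) by (eapply Rle_trans; [apply Rmin_r|apply Rmin_l]).
    assert (Hd2 : d <= / (Rabs B + 1)) by (eapply Rle_trans; [apply Rmin_r|apply Rmin_r]).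
    assert (HBd : Rabs B + 1 <= / d).
    { rewrite <- (Rinv_inv (Rabs B + 1)). now apply Rinv_le_contravar. }
    apply He, HQ.
    + apply H1; [|lra]. change (Rabs (a - 0) < d1). rewrite Rminus_0_r, Rabs_pos_eq; lra.
    + apply H2. pose proof (Rle_abs B). lra.
Qed.

(** Splitting at 1, each of the two parts contributes at most [M]. *)
Lemma int_conv_bound (M : R) (f : R -> C) (l : C) : continuous_pos f -> dominated M f ->
  int_conv f l -> Cmod l <= 2 * M.
Proof.
  intros Hf HM H. pose proof (dominated_nonneg M f HM). apply Rnot_lt_le. intros Hlt.
  destruct (H (Cmod l - 2 * M) ltac:(lra)) as [d [Hd Hab]].
  set (a := d / 2). set (b := / d + 1).
  assert (Hi : 1 <= / d) by (rewrite <- Rinv_1; apply Rinv_le_contravar; lra).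
  specialize (Hab a b ltac:(unfold a; lra) ltac:(unfold b; lra)).
  rewrite (RInt_sub_Chasles f a 1 b) in Hab by (assumption || unfold a, b; lra).
  pose proof (dominated_RInt_near_0 M f a 1 Hf HM ltac:(unfold a; lra)) as B1.
  pose proof (dominated_RInt_near_infty M f 1 b Hf HM ltac:(unfold b; lra)) as B2.
  set (I1 := @RInt CV f a 1) in *. set (I2 := @RInt CV f 1 b) in *.
  pose proof (Cmod_triangle (I1 + I2) (- (I1 + I2 - l))) as T.
  replace (I1 + I2 + - (I1 + I2 - l))%C with l in T by ring. rewrite Cmod_opp in T.
  pose proof (Cmod_triangle I1 I2).
  assert (M * (1 - a) <= M * 1) by (apply Rmult_le_compat_l; unfold a; lra).
  assert (M * (/ 1 - / b) <= M * 1).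
  { apply Rmult_le_compat_l; [lra|]. rewrite Rinv_1. assert (0 < / b) by (apply Rinv_0_lt_compat; unfold b; lra). lra. }
  lra.
Qed.

Lemma int_conv_unique (f : R -> C) (l l' : C) : continuous_pos f -> int_conv f l -> int_conv f l' -> l = l'.
Proof.
  intros Hf H1 H2. rewrite <- (int_conv_integral f l Hf H1). now apply int_conv_integral.
Qed.

Lemma continuous_pos_plus (f g : R -> C) : continuous_pos f -> continuous_pos g ->
  continuous_pos (fun y => f y + g y)%C.
Proof. intros Hf Hg y Hy. apply (continuous_plus (V := CV)); [now apply Hf|now apply Hg]. Qed.

Lemma int_conv_plus (f g : R -> C) (l m : C) : continuous_pos f -> continuous_pos g ->
  int_conv f l -> int_conv g m -> int_conv (fun y => f y + g y)%C (l + m)%C.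
Proof.
  intros Hf Hg H1 H2 eps Heps.
  destruct (H1 (eps / 2) ltac:(lra)) as [d1 [Hd1 B1]]. destruct (H2 (eps / 2) ltac:(lra)) as [d2 [Hd2 B2]].
  set (d := Rmin d1 d2). assert (Hd : 0 < d) by (apply Rmin_glb_lt; lra).
  assert (e1 : d <= d1) by apply Rmin_l. assert (e2 : d <= d2) by apply Rmin_r.
  exists d. split; [lra|]. intros a b Ha Hb.
  assert (/ d1 <= / d) by (apply Rinv_le_contravar; lra).
  assert (/ d2 <= / d) by (apply Rinv_le_contravar; lra).
  assert (0 < / d) by (apply Rinv_0_lt_compat; lra).
  specialize (B1 a b ltac:(lra) ltac:(lra)). specialize (B2 a b ltac:(lra) ltac:(lra)).
  replace (@RInt CV (fun y => f y + g y)%C a b) with (@RInt CV f a b + @RInt CV g a b)%C.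
  - replace (@RInt CV f a b + @RInt CV g a b - (l + m))%C
      with ((@RInt CV f a b - l) + (@RInt CV g a b - m))%C by ring.
    eapply Rle_lt_trans; [apply Cmod_triangle|]. lra.
  - symmetry. apply (RInt_plus (V := CV)); apply continuous_pos_ex_RInt; (assumption || lra).
Qed.

Lemma RInt_Cmult (c : C) (f : R -> C) (a b : R) : @ex_RInt CV f a b ->
  @is_RInt CV (fun y => c * f y)%C a b (c * @RInt CV f a b)%C.
Proof.
  intros H. apply (RInt_correct) in H.
  set (I := @RInt CV f a b) in *.
  pose proof (is_RInt_fct_extend_fst f a b I H) as H1.
  pose proof (is_RInt_fct_extend_snd f a b I H) as H2.
  destruct c as [u v].
  replace ((u, v) * I)%C with (u * fst I - v * snd I, u * snd I + v * fst I)
    by (destruct I; reflexivity).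
  apply is_RInt_pair.
  - apply (is_RInt_minus (fun y => u * fst (f y)) (fun y => v * snd (f y))).
    + apply (is_RInt_scal (fun y => fst (f y)) a b u _ H1).
    + apply (is_RInt_scal (fun y => snd (f y)) a b v _ H2).
  - apply (is_RInt_plus (fun y => u * snd (f y)) (fun y => v * fst (f y))).
    + apply (is_RInt_scal (fun y => snd (f y)) a b u _ H2).
    + apply (is_RInt_scal (fun y => fst (f y)) a b v _ H1).
Qed.

Lemma continuous_pos_Cmult (f g : R -> C) : continuous_pos f -> continuous_pos g ->
  continuous_pos (fun y => f y * g y)%C.
Proof.
  intros Hf Hg y Hy.
  assert (H1 : forall h : R -> C, @continuous R_UniformSpace CV h y ->
    continuous (fun t => fst (h t)) y /\ continuous (fun t => snd (h t)) y).
  { intros h Hh. split.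
    - apply (continuous_comp h fst y Hh). destruct (h y). apply continuous_fst.
    - apply (continuous_comp h snd y Hh). destruct (h y). apply continuous_snd. }
  destruct (H1 f (Hf y Hy)) as [f1 f2]. destruct (H1 g (Hg y Hy)) as [g1 g2].
  apply (continuous_pair (fun t => fst (f t) * fst (g t) - snd (f t) * snd (g t))
    (fun t => fst (f t) * snd (g t) + snd (f t) * fst (g t))).
  - apply (continuous_minus (fun t => fst (f t) * fst (g t)));
      now apply (continuous_mult (K := R_AbsRing)).
  - apply (continuous_plus (fun t => fst (f t) * snd (g t)));
      now apply (continuous_mult (K := R_AbsRing)).
Qed.

Lemma continuous_pos_const (c : C) : continuous_pos (fun _ => c).
Proof. intros y _. apply continuous_const. Qed.

Lemma int_conv_Cmult (c : C) (f : R -> C) (l : C) : continuous_pos f -> int_conv f l ->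
  int_conv (fun y => c * f y)%C (c * l)%C.
Proof.
  intros Hf H eps Heps. pose proof (Cmod_ge_0 c).
  destruct (H (eps / (Cmod c + 1))) as [d [Hd B]]; [apply Rdiv_lt_0_compat; lra|].
  exists d. split; [exact Hd|]. intros a b Ha Hb. specialize (B a b Ha Hb).
  assert (0 < / d) by (apply Rinv_0_lt_compat; lra).
  rewrite (is_RInt_unique _ _ _ _ (RInt_Cmult c f a b (continuous_pos_ex_RInt f a b Hf ltac:(lra) ltac:(lra)))).
  replace (c * @RInt CV f a b - c * l)%C with (c * (@RInt CV f a b - l))%C by ring.
  rewrite Cmod_mult.
  apply Rmult_lt_compat_r with (r := Cmod c + 1) in B; [|lra].
  replace (eps / (Cmod c + 1) * (Cmod c + 1)) with eps in B by (field; lra). nra.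
Qed.

(** * Complex series and termwise integration *)

Lemma RtoC_m1 : RtoC (-1) = (- RtoC 1)%C.
Proof. apply injective_projections; simpl; ring. Qed.

Definition csum (u : nat -> C) (n : nat) : C := @sum_n C_AbelianMonoid u n.

Lemma csum_O (u : nat -> C) : csum u 0 = u 0%nat.
Proof. apply sum_O. Qed.

Lemma csum_S (u : nat -> C) (n : nat) : csum u (S n) = (csum u n + u (S n))%C.
Proof. apply (sum_Sn (G := C_AbelianMonoid)). Qed.

Lemma C_series_eps (u : nat -> C) (l : C) : C_series u l <->
  forall eps, 0 < eps -> exists N, forall n, (N <= n)%nat -> Cmod (csum u n - l)%C < eps.
Proof.
  split.
  - intros H eps Heps.
    destruct (ball_Cmod eps Heps) as [e He].
    destruct (H (fun y => Cmod (y - l)%C < eps)) as [N HN].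
    + exists e. intros y. apply He.
    + exists N. intros n Hn. exact (HN n Hn).
  - intros H P [eps HP]. destruct (H eps (cond_pos eps)) as [N HN].
    exists N. intros n Hn. apply HP. apply C_NormedModule_mixin_compat1. exact (HN n Hn).
Qed.

Lemma C_series_unique (u : nat -> C) (l l' : C) : C_series u l -> C_series u l' -> l = l'.
Proof.
  intros H1 H2.
  assert (Hz : (l - l')%C = RtoC 0).
  { apply Cmod_eq_0. apply Rle_antisym; [|apply Cmod_ge_0]. apply Rnot_lt_le. intros Hlt.
    pose proof (proj1 (C_series_eps u l) H1 (Cmod (l - l') / 2) ltac:(lra)) as [N1 A1].
    pose proof (proj1 (C_series_eps u l') H2 (Cmod (l - l') / 2) ltac:(lra)) as [N2 A2].
    specialize (A1 (max N1 N2) ltac:(lia)). specialize (A2 (max N1 N2) ltac:(lia)).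
    set (s := csum u (max N1 N2)) in *.
    pose proof (Cmod_sub_triangle (s - l') (s - l)) as T.
    replace (s - l' - (s - l))%C with (l - l')%C in T by ring. lra. }
  replace l with (l - l' + l')%C by ring. rewrite Hz. ring.
Qed.

Lemma C_series_ext (u v : nat -> C) (l : C) : (forall n, u n = v n) -> C_series u l -> C_series v l.
Proof. intros H. apply is_series_ext. exact H. Qed.

Lemma C_series_Cmult (c : C) (u : nat -> C) (l : C) : C_series u l ->
  C_series (fun n => c * u n)%C (c * l)%C.
Proof. intros H. apply (is_series_scal c u l H). Qed.

Lemma csum_Re (u : nat -> C) (n : nat) : Re (csum u n) = sum_n (fun k => Re (u k)) n.
Proof.
  induction n; [rewrite csum_O, sum_O; reflexivity|].
  rewrite csum_S, sum_Sn. simpl. rewrite <- IHn. reflexivity.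
Qed.

Lemma csum_Im (u : nat -> C) (n : nat) : Im (csum u n) = sum_n (fun k => Im (u k)) n.
Proof.
  induction n; [rewrite csum_O, sum_O; reflexivity|].
  rewrite csum_S, sum_Sn. simpl. rewrite <- IHn. reflexivity.
Qed.

Lemma C_series_Re (u : nat -> C) (l : C) : C_series u l -> is_series (fun n => Re (u n)) (Re l).
Proof.
  intros H P [eps HP]. destruct (proj1 (C_series_eps u l) H eps (cond_pos eps)) as [N HN].
  exists N. intros n Hn. apply HP. specialize (HN n Hn). rewrite <- csum_Re.
  change (Rabs (Re (csum u n) - Re l) < eps).
  eapply Rle_lt_trans; [|exact HN]. apply (re_le_Cmod (csum u n - l)).
Qed.

Lemma C_series_Im (u : nat -> C) (l : C) : C_series u l -> is_series (fun n => Im (u n)) (Im l).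
Proof.
  intros H P [eps HP]. destruct (proj1 (C_series_eps u l) H eps (cond_pos eps)) as [N HN].
  exists N. intros n Hn. apply HP. specialize (HN n Hn). rewrite <- csum_Im.
  change (Rabs (Im (csum u n) - Im l) < eps).
  eapply Rle_lt_trans; [|exact HN]. apply (im_le_Cmod (csum u n - l)).
Qed.

Lemma is_series_RtoC (b : nat -> R) (l : R) : is_series b l -> C_series (fun n => RtoC (b n)) (RtoC l).
Proof.
  intros H. apply C_series_eps. intros eps Heps.
  apply is_series_Reals in H. destruct (H eps Heps) as [N HN]. exists N. intros n Hn.
  specialize (HN n Hn). unfold Rdist in HN. rewrite <- sum_n_Reals in HN.
  replace (csum (fun n => RtoC (b n)) n) with (RtoC (sum_n b n)).
  - replace (RtoC (sum_n b n) - RtoC l)%C with (RtoC (sum_n b n - l)) by (apply injective_projections; simpl; ring).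
    rewrite Cmod_R. exact HN.
  - clear. induction n; [rewrite csum_O, sum_O; reflexivity|].
    rewrite csum_S, sum_Sn, <- IHn. apply RtoC_plus.
Qed.

Lemma sum_n_le_Series (M : nat -> R) (n : nat) : (forall n, 0 <= M n) -> ex_series M ->
  sum_n M n <= Series M.
Proof.
  intros HM Hex. rewrite sum_n_Reals. rewrite (Series_incr_n M (S n)) by (try lia; exact Hex).
  simpl pred.
  assert (0 <= Series (fun k => M (S n + k)%nat)); [|lra].
  rewrite <- (Rmult_0_l (Series (fun k => M (S n + k)%nat))), <- Series_scal_l. apply Series_le.
  - intros k. rewrite Rmult_0_l. split; [lra|apply HM].
  - now apply (ex_series_incr_n M).
Qed.

Lemma C_series_tail (v : nat -> C) (V : C) (M : nat -> R) (g : R) (N : nat) :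
  0 <= g -> (forall n, 0 <= M n) -> ex_series M -> (forall n, Cmod (v n) <= M n * g) ->
  C_series v V -> Cmod (V - csum v N)%C <= (Series M - sum_n M N) * g.
Proof.
  intros Hg HM Hex Hb HV.
  assert (Hinc : forall k, Cmod (csum v (N + k) - csum v N) <= (sum_n M (N + k) - sum_n M N) * g).
  { induction k.
    - rewrite Nat.add_0_r. replace (csum v N - csum v N)%C with (RtoC 0) by ring. rewrite Cmod_0. lra.
    - rewrite Nat.add_succ_r, csum_S, sum_Sn.
      replace (csum v (N + k) + v (S (N + k)) - csum v N)%C
        with ((csum v (N + k) - csum v N) + v (S (N + k)))%C by ring.
      eapply Rle_trans; [apply Cmod_triangle|]. specialize (Hb (S (N + k))).
      unfold plus; simpl. lra. }
  apply Rnot_lt_le. intros Hlt.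
  set (D := Cmod (V - csum v N) - (Series M - sum_n M N) * g) in *.
  destruct (proj1 (C_series_eps v V) HV D ltac:(unfold D; lra)) as [K HK].
  specialize (HK (N + K)%nat ltac:(lia)). specialize (Hinc K).
  pose proof (sum_n_le_Series M (N + K) HM Hex) as Hs.
  pose proof (Cmod_sub_triangle (csum v (N + K) - csum v N) (csum v (N + K) - V)) as T.
  replace (csum v (N + K) - csum v N - (csum v (N + K) - V))%C with (V - csum v N)%C in T by ring.
  assert ((sum_n M (N + K) - sum_n M N) * g <= (Series M - sum_n M N) * g) by (apply Rmult_le_compat_r; lra).
  unfold D in *. lra.
Qed.

(** The pointwise tail is dominated by the tail of the majorant series, so its integral is at most
    twice that tail. Domination of the sum [U] is returned as well, because the iterated series
    needs it to apply the lemma a second time. *)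
Lemma series_int_exchange (u : nat -> R -> C) (U : R -> C) (l : nat -> C) (M : nat -> R) :
  (forall n, continuous_pos (u n)) -> continuous_pos U ->
  (forall n, dominated (M n) (u n)) -> ex_series M ->
  (forall y, 0 < y -> C_series (fun n => u n y) (U y)) ->
  (forall n, int_conv (u n) (l n)) ->
  dominated (Series M) U /\ exists L, int_conv U L /\ C_series l L.
Proof.
  intros Hu HU Hdom Hex Hpt Hl.
  assert (HM : forall n, 0 <= M n) by (intros n; apply (dominated_nonneg (M n) (u n)), Hdom).
  assert (Hg : forall y, 0 <= / (1 + y ^ 2)).
  { intros y. left. apply Rinv_0_lt_compat. pose proof (pow2_ge_0 y). lra. }
  assert (Htail : forall N, dominated (Series M - sum_n M N) (fun y => U y - csum (fun n => u n y) N)%C).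
  { intros N y Hy. apply (C_series_tail (fun n => u n y)); auto. intros n. now apply Hdom. }
  assert (HD : dominated (Series M) U).
  { intros y Hy. replace (U y) with ((U y - csum (fun n => u n y) 0) + u 0%nat y)%C by (rewrite csum_O; ring).
    eapply Rle_trans; [apply Cmod_triangle|].
    pose proof (Htail 0%nat y Hy) as H1. pose proof (Hdom 0%nat y Hy) as H2. rewrite sum_O in H1.
    replace (Series M / (1 + y ^ 2)) with ((Series M - M 0%nat) / (1 + y ^ 2) + M 0%nat / (1 + y ^ 2))
      by (field; pose proof (pow2_ge_0 y); lra). lra. }
  split; [exact HD|].
  destruct (dominated_int_conv _ U HU HD) as [L HL]. exists L. split; [exact HL|].
  assert (Hpart : forall N, continuous_pos (fun y => csum (fun n => u n y) N) /\
    int_conv (fun y => csum (fun n => u n y) N) (csum l N)).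
  { induction N as [|N [IH1 IH2]].
    - split.
      + apply (continuous_pos_ext (u 0%nat)); [intros; now rewrite csum_O|apply Hu].
      + rewrite csum_O. apply (int_conv_ext (u 0%nat)); [intros; now rewrite csum_O|apply Hl].
    - split.
      + apply (continuous_pos_ext (fun y => csum (fun n => u n y) N + u (S N) y)%C);
          [intros; now rewrite csum_S|]. apply continuous_pos_plus; [exact IH1|apply Hu].
      + rewrite csum_S. apply (int_conv_ext (fun y => csum (fun n => u n y) N + u (S N) y)%C);
          [intros; now rewrite csum_S|]. apply int_conv_plus; auto. }
  apply C_series_eps. intros eps Heps.
  pose proof (Series_correct M Hex) as HS. apply is_series_Reals in HS.
  destruct (HS (eps / 2) ltac:(lra)) as [N HN]. exists N. intros n Hn.
  specialize (HN n Hn). unfold Rdist in HN. rewrite <- sum_n_Reals in HN.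
  destruct (Hpart n) as [P1 P2].
  assert (HB : Cmod (L + RtoC (-1) * csum l n)%C <= 2 * (Series M - sum_n M n)).
  { apply (int_conv_bound _ (fun y => U y + RtoC (-1) * csum (fun n => u n y) n)%C).
    - apply continuous_pos_plus; [exact HU|]. apply continuous_pos_Cmult; [apply continuous_pos_const|exact P1].
    - intros y Hy. replace (U y + RtoC (-1) * csum (fun n => u n y) n)%C
        with (U y - csum (fun n => u n y) n)%C by (rewrite RtoC_m1; ring). now apply Htail.
    - apply int_conv_plus; [exact HU| |exact HL|now apply int_conv_Cmult].
      apply continuous_pos_Cmult; [apply continuous_pos_const|exact P1]. }
  replace (csum l n - L)%C with (- (L + RtoC (-1) * csum l n))%C by (rewrite RtoC_m1; ring).
  rewrite Cmod_opp. eapply Rle_lt_trans; [exact HB|]. split_Rabs; lra.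
Qed.

(** * Changes of variable in improper integrals *)

Lemma continuous_pos_comp (f : R -> C) (g : R -> R) : continuous_pos f ->
  (forall y, 0 < y -> 0 < g y /\ ex_derive g y) -> continuous_pos (fun y => f (g y)).
Proof.
  intros Hf Hg y Hy. destruct (Hg y Hy) as [H1 H2].
  apply (continuous_comp g f).
  - apply (ex_derive_continuous (V := R_NormedModule)). exact H2.
  - now apply Hf.
Qed.

(** The common core of the substitutions: a truncated integral of [F] is one of [f] whose limits are
    as extreme as desired. The upper limit enters through [/ b], so that [scale_threshold] serves
    both ends. *)
Lemma int_conv_limits (f F : R -> C) (l : C) : int_conv f l ->
  (forall d, 0 < d <= 1 -> exists d', 0 < d' <= 1 /\ forall a b, 0 < a < d' -> 0 < / b < d' -> 0 < b ->
     exists a' b', 0 < a' < d /\ / d < b' /\ @RInt CV F a b = @RInt CV f a' b') ->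
  int_conv F l.
Proof.
  intros H HF eps Heps. destruct (H eps Heps) as [d [Hd B]].
  destruct (HF d Hd) as [d' [Hd' H']]. exists d'. split; [exact Hd'|]. intros a b Ha Hb.
  assert (Hid : 0 < / d') by (apply Rinv_0_lt_compat; lra).
  assert (Hib : / b < d').
  { rewrite <- (Rinv_inv d'). apply Rinv_lt_contravar; [apply Rmult_lt_0_compat; lra|lra]. }
  assert (Hib0 : 0 < / b) by (apply Rinv_0_lt_compat; lra).
  destruct (H' a b Ha ltac:(lra) ltac:(lra)) as [a' [b' [Ha' [Hb' ->]]]]. now apply B.
Qed.

Lemma scale_threshold (k d : R) : 0 < k -> 0 < d ->
  exists d', 0 < d' <= 1 /\ forall t, 0 < t < d' -> 0 < k * t < d /\ / d < k * / t.
Proof.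
  intros Hk Hd. exists (Rmin 1 (Rmin (d / k) (d * k))).
  assert (Hdk : 0 < d / k) by (apply Rdiv_lt_0_compat; lra).
  assert (Hdk' : 0 < d * k) by (apply Rmult_lt_0_compat; lra).
  split; [split; [repeat apply Rmin_glb_lt; lra|apply Rmin_l]|]. intros t [Ht Hlt].
  assert (t1 : t < d / k).
  { eapply Rlt_le_trans; [exact Hlt|]. eapply Rle_trans; [apply Rmin_r|apply Rmin_l]. }
  assert (t2 : t < d * k).
  { eapply Rlt_le_trans; [exact Hlt|]. eapply Rle_trans; [apply Rmin_r|apply Rmin_r]. }
  split; [split; [now apply Rmult_lt_0_compat|]|].
  - replace d with (k * (d / k)) by (field; lra). now apply Rmult_lt_compat_l.
  - replace (/ d) with (k * / (d * k)) by (field; lra). apply Rmult_lt_compat_l; [exact Hk|].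
    apply Rinv_lt_contravar; [now apply Rmult_lt_0_compat|exact t2].
Qed.

Lemma int_conv_scale (k : R) (f : R -> C) (l : C) : 0 < k -> continuous_pos f -> int_conv f l ->
  int_conv (fun t => RtoC k * f (k * t)%R)%C l.
Proof.
  intros Hk Hf H. refine (int_conv_limits f _ l H _). intros d Hd.
  destruct (scale_threshold k d Hk ltac:(lra)) as [d' [Hd' Ht]].
  exists d'. split; [exact Hd'|]. intros a b Ha Hb Hb0.
  destruct (Ht a Ha) as [Ha1 _]. destruct (Ht (/ b) Hb) as [_ Hb1]. rewrite Rinv_inv in Hb1.
  exists (k * a), (k * b). split; [exact Ha1|]. split; [exact Hb1|].
  apply (is_RInt_unique).
  apply (is_RInt_ext (fun t => scal k (f (k * t)))); [intros t _; apply scal_CV|].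
  apply (is_RInt_comp (V := CV) f (fun t => k * t) (fun _ => k)).
  - intros x Hx. apply Hf. apply Rmult_lt_0_compat; [lra|].
    eapply Rlt_le_trans; [|apply Hx]. apply Rmin_glb_lt; lra.
  - intros x _. split; [auto_derive; [easy|ring]|apply continuous_const].
Qed.

Lemma int_conv_inv (k : R) (f : R -> C) (l : C) : 0 < k -> continuous_pos f -> int_conv f l ->
  int_conv (fun t => RtoC (k / t ^ 2)%R * f (k / t)%R)%C l.
Proof.
  intros Hk Hf H. refine (int_conv_limits f _ l H _). intros d Hd.
  destruct (scale_threshold k d Hk ltac:(lra)) as [d' [Hd' Ht]].
  exists d'. split; [exact Hd'|]. intros a b Ha Hb Hb0.
  destruct (Ht a Ha) as [_ Ha1]. destruct (Ht (/ b) Hb) as [Hb1 _].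
  exists (k / b), (k / a). split; [exact Hb1|]. split; [exact Ha1|].
  assert (0 < / d) by (apply Rinv_0_lt_compat; lra).
  (* The substitution reverses the orientation; this sign cancels the one in the derivative of
     [k / t]. *)
  rewrite (RInt_swap_CV f (k / b) (k / a) Hf) by (unfold Rdiv; lra).
  apply (is_RInt_unique).
  apply (is_RInt_ext (fun t => opp (scal (- (k / t ^ 2)) (f (k / t))))).
  - intros t _.
    change ((- @scal R_AbsRing C_R_NormedModule (- (k / t ^ 2))%R (f (k / t)%R))%C
      = (RtoC (k / t ^ 2)%R * f (k / t)%R)%C).
    rewrite scal_CV, RtoC_opp. ring.
  - apply (is_RInt_opp (V := CV)).
    apply (is_RInt_comp (V := CV) f (fun t => k / t) (fun t => - (k / t ^ 2))).
    + intros x Hx. apply Hf. apply Rdiv_lt_0_compat; [lra|].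
      eapply Rlt_le_trans; [|apply Hx]. apply Rmin_glb_lt; lra.
    + intros x Hx. assert (0 < x).
      { eapply Rlt_le_trans; [|apply Hx]. apply Rmin_glb_lt; lra. }
      split; [auto_derive; [lra|field; lra]|].
      apply (ex_derive_continuous (fun t => - (k / t ^ 2))). auto_derive.
      assert (0 < x ^ 2) by (apply pow_lt; lra). simpl in *; lra.
Qed.

(** * Gamma, Bessel and Mellin integrals *)

Lemma Re_mul_RtoC (w : C) (x : R) : Re (w * RtoC x)%C = Re w * x.
Proof. destruct w; unfold Re, RtoC, Cmult; simpl; ring. Qed.

Lemma Cmod_Rcpow (x : R) (w : C) : Cmod (Rcpow x w) = Rpower x (Re w).
Proof. unfold Rcpow, Rpower. now rewrite Cmod_Cexp, Re_mul_RtoC. Qed.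

Lemma Rcpow_plus (x : R) (v w : C) : Rcpow x (v + w) = (Rcpow x v * Rcpow x w)%C.
Proof. unfold Rcpow. rewrite <- Cexp_plus. f_equal. ring. Qed.

Lemma Rcpow_mult (x y : R) (w : C) : 0 < x -> 0 < y -> Rcpow (x * y) w = (Rcpow x w * Rcpow y w)%C.
Proof.
  intros Hx Hy. unfold Rcpow. rewrite <- Cexp_plus, ln_mult, RtoC_plus by assumption. f_equal. ring.
Qed.

Lemma Rcpow_inv (x : R) (w : C) : 0 < x -> Rcpow (/ x) w = Rcpow x (- w).
Proof. intros Hx. unfold Rcpow. rewrite ln_Rinv, RtoC_opp by assumption. f_equal. ring. Qed.

Lemma Rcpow_RtoC (x r : R) : Rcpow x (RtoC r) = RtoC (Rpower x r).
Proof. unfold Rcpow, Rpower. now rewrite <- RtoC_mult, Cexp_RtoC. Qed.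

Lemma Rcpow_0 (x : R) : Rcpow x (RtoC 0) = RtoC 1.
Proof. rewrite Rcpow_RtoC. unfold Rpower. now rewrite Rmult_0_l, exp_0. Qed.

Lemma Rcpow_1 (x : R) : 0 < x -> Rcpow x (RtoC 1) = RtoC x.
Proof. intros Hx. now rewrite Rcpow_RtoC, Rpower_1. Qed.

Lemma Rcpow_opp_l (x : R) (w : C) : (Rcpow x (- w) * Rcpow x w)%C = RtoC 1.
Proof. rewrite <- Rcpow_plus. replace (- w + w)%C with (RtoC 0) by ring. apply Rcpow_0. Qed.

Lemma continuous_pos_RtoC_continuous (u : R -> R) : (forall y, 0 < y -> continuous u y) ->
  continuous_pos (fun y => RtoC (u y)).
Proof. intros H y Hy. apply continuous_pair; [now apply H|apply continuous_const]. Qed.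

Lemma continuous_pos_RtoC (u : R -> R) : (forall y, 0 < y -> ex_derive u y) ->
  continuous_pos (fun y => RtoC (u y)).
Proof.
  intros H. apply continuous_pos_RtoC_continuous. intros y Hy.
  apply (ex_derive_continuous (V := R_NormedModule)). now apply H.
Qed.

Lemma continuous_pos_Rcpow (w : C) : continuous_pos (fun y => Rcpow y w).
Proof.
  intros y Hy. destruct w as [u v].
  apply (continuous_ext (fun y => (exp (u * ln y) * cos (v * ln y), exp (u * ln y) * sin (v * ln y)) : C)).
  - intros t. unfold Rcpow, Cexp. rewrite Re_mul_RtoC.
    replace (Im ((u, v) * RtoC (ln t))%C) with (v * ln t) by (unfold Im; simpl; ring). reflexivity.
  - apply continuous_pair; apply (ex_derive_continuous (V := R_NormedModule)); auto_derive; lra.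
Qed.

Lemma Rpower_le_exp (t p : R) (N : nat) : 1 <= t -> p <= INR N -> Rpower t p <= t ^ N.
Proof.
  intros Ht Hp. rewrite <- Rpower_pow by lra. unfold Rpower. apply exp_le.
  apply Rmult_le_compat_r; [|exact Hp]. rewrite <- ln_1. apply ln_le; lra.
Qed.

Lemma nat_above (p : R) : exists N : nat, p <= INR N.
Proof. destruct (INR_unbounded p) as [N HN]. exists N. lra. Qed.

(** For [t <= 1] the left side is at most 1, which accounts for the 2 in the constant; for [t > 1]
    one has [1 + t ^ 2 <= 2 * t ^ 2], and [exp_ge_pow] gives [2 * K]. *)
Lemma power_exp_bounded (p c : R) : 0 <= p -> 0 < c ->
  exists K, 0 <= K /\ forall t, 0 < t -> Rpower t p * exp (- (c * t)) <= K / (1 + t ^ 2).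
Proof.
  intros Hp Hc. destruct (nat_above p) as [N HN].
  destruct (exp_ge_pow c (N + 2) Hc) as [K [HK H]].
  exists (2 + 2 * K). split; [lra|]. intros t Ht.
  assert (Ht2 : 0 < t ^ 2) by (apply pow_lt; lra).
  apply Rmult_le_reg_r with (1 + t ^ 2); [lra|].
  replace ((2 + 2 * K) / (1 + t ^ 2) * (1 + t ^ 2)) with (2 + 2 * K) by (field; lra).
  assert (He : exp (- (c * t)) * exp (c * t) = 1) by (rewrite <- exp_plus, Rplus_opp_l, exp_0; reflexivity).
  assert (He1 : exp (- (c * t)) <= 1) by (apply exp_le_1; nra).
  pose proof (exp_pos (- (c * t))).
  assert (Hrp : 0 < Rpower t p) by apply exp_pos.
  destruct (Rle_dec t 1) as [Ht1|Ht1].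
  - assert (Rpower t p <= 1).
    { unfold Rpower. rewrite <- exp_0. apply exp_le.
      assert (ln t <= 0) by (rewrite <- ln_1; apply ln_le; lra). nra. }
    assert (Rpower t p * exp (- (c * t)) <= 1) by nra. nra.
  - assert (Ht2' : 1 <= t ^ 2) by (rewrite <- (pow1 2); apply pow_incr; lra).
    assert (Rpower t p * (1 + t ^ 2) <= 2 * t ^ (N + 2)).
    { rewrite pow_add. pose proof (Rpower_le_exp t p N ltac:(lra) HN). nra. }
    specialize (H t ltac:(lra)).
    replace (Rpower t p * exp (- (c * t)) * (1 + t ^ 2)) with (exp (- (c * t)) * (Rpower t p * (1 + t ^ 2))) by ring.
    apply Rle_trans with (exp (- (c * t)) * (2 * (K * exp (c * t)))).
    + apply Rmult_le_compat_l; lra.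
    + replace (exp (- (c * t)) * (2 * (K * exp (c * t)))) with (2 * K * (exp (- (c * t)) * exp (c * t))) by ring.
      rewrite He. lra.
Qed.

(** For [y >= 1] the factor [exp (- (a * y))] is used, for [y < 1] the factor [exp (- (b / y))] at
    the variable [/ y]. Passing to [Rabs p] allows exponents of any sign, which is what makes the
    later bounds valid for all [s]. *)
Lemma power_exp_exp_bounded (p a b : R) : 0 < a -> 0 < b ->
  exists K, 0 <= K /\ forall y, 0 < y -> Rpower y p * exp (- (a * y)) * exp (- (b / y)) <= K / (1 + y ^ 2).
Proof.
  intros Ha Hb.
  destruct (power_exp_bounded (Rabs p) a (Rabs_pos p) Ha) as [K1 [HK1 H1]].
  destruct (power_exp_bounded (Rabs p) b (Rabs_pos p) Hb) as [K2 [HK2 H2]].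
  exists (K1 + 2 * K2). split; [lra|]. intros y Hy.
  assert (Hy2 : 0 < y ^ 2) by (apply pow_lt; lra).
  assert (Hby : 0 < b / y) by (apply Rdiv_lt_0_compat; lra).
  assert (E1 : exp (- (a * y)) <= 1) by (apply exp_le_1; nra).
  assert (E2 : exp (- (b / y)) <= 1) by (apply exp_le_1; lra).
  pose proof (exp_pos (- (a * y))). pose proof (exp_pos (- (b / y))).
  assert (Hrp : 0 < Rpower y p) by apply exp_pos.
  apply Rmult_le_reg_r with (1 + y ^ 2); [lra|].
  replace ((K1 + 2 * K2) / (1 + y ^ 2) * (1 + y ^ 2)) with (K1 + 2 * K2) by (field; lra).
  destruct (Rle_dec 1 y) as [Hy1|Hy1].
  - assert (Hle : Rpower y p <= Rpower y (Rabs p)).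
    { unfold Rpower. apply exp_le. apply Rmult_le_compat_r; [rewrite <- ln_1; apply ln_le; lra|apply Rle_abs]. }
    specialize (H1 y Hy). apply Rmult_le_compat_r with (r := 1 + y ^ 2) in H1; [|lra].
    replace (K1 / (1 + y ^ 2) * (1 + y ^ 2)) with K1 in H1 by (field; lra).
    apply Rle_trans with (Rpower y (Rabs p) * exp (- (a * y)) * (1 + y ^ 2)); [|lra].
    apply Rmult_le_compat_r; [lra|].
    rewrite <- (Rmult_1_r (Rpower y (Rabs p) * exp (- (a * y)))).
    apply Rmult_le_compat; [nra|lra| |lra]. apply Rmult_le_compat_r; lra.
  - assert (Hiy : 0 < / y) by (apply Rinv_0_lt_compat; lra).
    assert (Hle : Rpower y p <= Rpower (/ y) (Rabs p)).
    { unfold Rpower. rewrite ln_Rinv by lra. apply exp_le.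
      assert (ln y <= 0) by (rewrite <- ln_1; apply ln_le; lra).
      pose proof (Rle_abs (- p)). rewrite Rabs_Ropp in H4. nra. }
    specialize (H2 (/ y) Hiy). fold (b / y) in H2.
    assert (Hi2 : 0 <= (/ y) ^ 2) by apply pow2_ge_0.
    assert (K2 / (1 + (/ y) ^ 2) <= K2).
    { apply Rmult_le_reg_r with (1 + (/ y) ^ 2); [lra|].
      replace (K2 / (1 + (/ y) ^ 2) * (1 + (/ y) ^ 2)) with K2 by (field; nra). nra. }
    assert (1 + y ^ 2 <= 2) by (assert (y ^ 2 <= 1); [rewrite <- (pow1 2); apply pow_incr; lra|lra]).
    assert (P : Rpower y p * exp (- (a * y)) * exp (- (b / y)) <= K2).
    { apply Rle_trans with (Rpower (/ y) (Rabs p) * exp (- (b / y))); [|lra].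
      apply Rmult_le_compat_r; [lra|]. nra. }
    nra.
Qed.

Lemma int_conv_Gamma (s : C) : 1 <= Re s ->
  continuous_pos (fun t => RtoC (exp (- t)) * Rcpow t (s - RtoC 1))%C /\
  int_conv (fun t => RtoC (exp (- t)) * Rcpow t (s - RtoC 1))%C (Gamma s).
Proof.
  intros Hs.
  assert (Hc : continuous_pos (fun t => RtoC (exp (- t)) * Rcpow t (s - RtoC 1))%C).
  { apply continuous_pos_Cmult; [|apply continuous_pos_Rcpow].
    apply (continuous_pos_RtoC (fun t => exp (- t))). intros; auto_derive; easy. }
  split; [exact Hc|].
  destruct (power_exp_bounded (Re s - 1) 1 ltac:(lra) Rlt_0_1) as [K [HK H]].
  destruct (dominated_int_conv K _ Hc) as [l Hl].
  - intros y Hy. rewrite Cmod_mult, Cmod_R, Cmod_Rcpow, Rabs_pos_eq by (left; apply exp_pos).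
    specialize (H y Hy). rewrite Rmult_1_l in H. rewrite Rmult_comm.
    replace (Re (s - RtoC 1)) with (Re s - 1) by (destruct s; simpl; ring). exact H.
  - unfold Gamma. now rewrite (int_conv_integral _ l Hc Hl).
Qed.

Lemma int_conv_Gamma_scale (s : C) (k : R) : 1 <= Re s -> 0 < k ->
  int_conv (fun t => RtoC (exp (- (k * t))) * Rcpow t (s - RtoC 1))%C (Gamma s * Rcpow k (- s))%C.
Proof.
  intros Hs Hk. destruct (int_conv_Gamma s Hs) as [Hc HG].
  pose proof (int_conv_scale k _ _ Hk Hc HG) as H1. cbv beta in H1.
  apply (int_conv_Cmult (Rcpow k (- s))) in H1.
  - rewrite Cmult_comm. refine (int_conv_ext _ _ _ _ H1).
    intros t Ht. cbv beta. rewrite Rcpow_mult by assumption.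
    rewrite <- (Rcpow_1 k Hk).
    replace (Rcpow k (- s) * (Rcpow k (RtoC 1) * (RtoC (exp (- (k * t))) * (Rcpow k (s - RtoC 1) * Rcpow t (s - RtoC 1)))))%C
      with ((Rcpow k (- s) * (Rcpow k (RtoC 1) * Rcpow k (s - RtoC 1))) * (RtoC (exp (- (k * t))) * Rcpow t (s - RtoC 1)))%C by ring.
    rewrite <- Rcpow_plus. replace (RtoC 1 + (s - RtoC 1))%C with s by ring. rewrite Rcpow_opp_l. ring.
  - apply continuous_pos_Cmult; [apply continuous_pos_const|].
    apply (continuous_pos_comp _ (fun t => k * t) Hc). intros y Hy. split; [now apply Rmult_lt_0_compat|auto_derive; easy].
Qed.

(** The substitution [t -> k / t] in the defining integral, at [x = 2 * sqrt (a * b)]: with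
    [k = sqrt (b / a)] the symmetric exponent becomes [a * t + b / t], and [t ^ (- nu)] becomes
    [t ^ nu] up to a power of [k]. *)
Lemma int_conv_Bessel (nu : C) (a b : R) : 0 < a -> 0 < b ->
  int_conv (fun t => RtoC (exp (- (a * t)) * exp (- (b / t))) * Rcpow t (nu - RtoC 1))%C
    (RtoC 2 * (Rcpow (b / a) (nu / RtoC 2) * BesselK nu (2 * sqrt (a * b))))%C.
Proof.
  intros Ha Hb.
  set (x := 2 * sqrt (a * b)).
  assert (Hab : 0 < a * b) by now apply Rmult_lt_0_compat.
  assert (Hsq : 0 < sqrt (a * b)) by now apply sqrt_lt_R0.
  set (h := fun t => (RtoC (exp (- (x / 2) * (t + / t))) * Rcpow t (- nu) * RtoC (/ t))%C).
  assert (Hc : continuous_pos h).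
  { unfold h. apply continuous_pos_Cmult; [apply continuous_pos_Cmult; [|apply continuous_pos_Rcpow]|].
    - apply (continuous_pos_RtoC (fun t => exp (- (x / 2) * (t + / t)))). intros; auto_derive; lra.
    - apply (continuous_pos_RtoC (fun t => / t)). intros; auto_derive; lra. }
  destruct (power_exp_exp_bounded (- Re nu - 1) (x / 2) (x / 2) ltac:(unfold x; lra) ltac:(unfold x; lra)) as [K [HK H]].
  destruct (dominated_int_conv K h Hc) as [J HJ].
  { intros y Hy. unfold h. rewrite !Cmod_mult, !Cmod_R, Cmod_Rcpow.
    assert (0 < / y) by now apply Rinv_0_lt_compat.
    rewrite (Rabs_pos_eq (exp _)), (Rabs_pos_eq (/ y)) by (try (left; apply exp_pos); lra).
    eapply Rle_trans; [|apply (H y Hy)]. right.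
    replace (Rpower y (- Re nu - 1)) with (Rpower y (Re (- nu)) * / y).
    - replace (exp (- (x / 2) * (y + / y))) with (exp (- (x / 2 * y)) * exp (- (x / 2 / y)));
        [ring|]. rewrite <- exp_plus. f_equal. field. lra.
    - replace (/ y) with (Rpower y (- (1))) by (rewrite Rpower_Ropp, Rpower_1; auto).
      rewrite <- Rpower_plus. f_equal. }
  assert (EB : (RtoC 2 * BesselK nu x)%C = J).
  { unfold BesselK. fold h. rewrite (int_conv_integral h J Hc HJ).
    rewrite Cmult_assoc, <- RtoC_mult. replace (2 * / 2) with 1 by field. ring. }
  set (k := sqrt (b / a)).
  assert (Hba : 0 < b / a) by now apply Rdiv_lt_0_compat.
  assert (Hk : 0 < k) by now apply sqrt_lt_R0.
  assert (Hk1 : sqrt (a * b) * k = b).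
  { unfold k. rewrite <- sqrt_mult by lra. replace (a * b * (b / a)) with (b * b) by (field; lra).
    apply sqrt_square; lra. }
  assert (Hk2 : sqrt (a * b) / k = a).
  { unfold k. rewrite <- sqrt_div by lra. replace (a * b / (b / a)) with (a * a) by (field; lra).
    apply sqrt_square; lra. }
  pose proof (int_conv_inv k h J Hk Hc HJ) as H1. cbv beta in H1.
  apply (int_conv_Cmult (Rcpow k nu)) in H1.
  - replace (RtoC 2 * (Rcpow (b / a) (nu / RtoC 2) * BesselK nu x))%C with (Rcpow k nu * J)%C.
    + refine (int_conv_ext _ _ _ _ H1). intros t Ht. cbv beta. unfold h.
      assert (Hit : 0 < / t) by now apply Rinv_0_lt_compat.
      replace (- (x / 2) * (k / t + / (k / t))) with (- (a * t) + - (b / t)).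
      2: { unfold x. replace (2 * sqrt (a * b) / 2) with (sqrt (a * b)) by field.
           rewrite <- Hk1 at 1. rewrite <- Hk2 at 1. field. split; lra. }
      rewrite exp_plus. unfold Rdiv at 2. rewrite (Rcpow_mult k (/ t)) by assumption.
      rewrite (Rcpow_inv t) by assumption. replace (- - nu)%C with nu by ring.
      replace (nu - RtoC 1)%C with (nu + - RtoC 1)%C by ring.
      rewrite (Rcpow_plus t), <- (Rcpow_inv t (RtoC 1)), (Rcpow_1 (/ t)) by assumption.
      replace (RtoC (k / t ^ 2)) with (RtoC (k * / t) * RtoC (/ t))%C
        by (rewrite <- RtoC_mult; f_equal; field; lra).
      assert (E : (RtoC (k * / t) * RtoC (/ (k * / t)))%C = RtoC 1).
      { rewrite <- RtoC_mult. f_equal. field. split; lra. }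
      unfold Rdiv.
      transitivity ((Rcpow k (- nu) * Rcpow k nu) * (RtoC (k * / t) * RtoC (/ (k * / t)))
        * (RtoC (exp (- (a * t)) * exp (- (b * / t))) * (Rcpow t nu * RtoC (/ t))))%C; [ring|].
      rewrite E, Rcpow_opp_l. ring.
    + rewrite <- EB.
      replace (Rcpow k nu) with (Rcpow (b / a) (nu / RtoC 2)); [ring|].
      unfold Rcpow. f_equal.
      replace (ln (b / a)) with (2 * ln k).
      * rewrite RtoC_mult. field.
      * unfold k. rewrite <- (sqrt_sqrt (b / a)) at 2 by lra. rewrite ln_mult by now apply sqrt_lt_R0. ring.
  - apply continuous_pos_Cmult.
    + apply (continuous_pos_RtoC (fun t => k / t ^ 2)). intros y Hy. auto_derive.
      assert (0 < y ^ 2) by (apply pow_lt; lra). simpl in *; lra.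
    + apply (continuous_pos_comp h (fun t => k / t) Hc). intros y Hy.
      split; [now apply Rdiv_lt_0_compat|auto_derive; lra].
Qed.

(** * Holomorphy of Mellin transforms *)

Definition mellin_kernel (g : R -> R) (s : C) (y : R) : C := (RtoC (g y) * Rcpow y (s - RtoC 1))%C.

Lemma Cmod_mellin_kernel (g : R -> R) (s : C) (y : R) :
  Cmod (mellin_kernel g s y) = Rabs (g y) * Rpower y (Re s - 1).
Proof.
  unfold mellin_kernel. rewrite Cmod_mult, Cmod_R, Cmod_Rcpow. do 2 f_equal.
Qed.

Lemma exp_abs_ln (y : R) : 0 < y -> exp (Rabs (ln y)) <= y + / y.
Proof.
  intros Hy. assert (0 < / y) by now apply Rinv_0_lt_compat.
  unfold Rabs. destruct (Rcase_abs (ln y)).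
  - rewrite <- ln_Rinv, exp_ln by assumption. lra.
  - rewrite exp_ln by assumption. lra.
Qed.

Section MellinEntire.
Variable (g : R -> R).
Hypotheses (Hg : continuous_pos (fun y => RtoC (g y)))
  (Hdom : forall s, exists M, dominated M (mellin_kernel g s)).

Lemma mellin_kernel_continuous (s : C) : continuous_pos (mellin_kernel g s).
Proof. apply continuous_pos_Cmult; [exact Hg|apply continuous_pos_Rcpow]. Qed.

Definition mellin (s : C) : C := integral_0_infty (mellin_kernel g s).

Lemma mellin_int_conv (s : C) : int_conv (mellin_kernel g s) (mellin s).
Proof.
  destruct (Hdom s) as [M HM].
  destruct (dominated_int_conv M _ (mellin_kernel_continuous s) HM) as [l Hl].
  unfold mellin. now rewrite (int_conv_integral _ l (mellin_kernel_continuous s) Hl).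
Qed.

Let dker (s : C) (y : R) : C := (RtoC (ln y) * mellin_kernel g s y)%C.

Lemma continuous_pos_ln : continuous_pos (fun y => RtoC (ln y)).
Proof. apply (continuous_pos_RtoC ln). intros; auto_derive; lra. Qed.

(** Domination at the shifted arguments [s + r] and [s - r] leaves room at [s] for factors as large
    as [y ^ r + y ^ (- r)], hence for powers of [ln y]. *)
Lemma shift_bound (s : C) (r M1 M2 y : R) : 0 < y ->
  dominated M1 (mellin_kernel g (s + RtoC r)) -> dominated M2 (mellin_kernel g (s - RtoC r)) ->
  Cmod (mellin_kernel g s y) * (Rpower y r + Rpower y (- r)) <= (M1 + M2) / (1 + y ^ 2).
Proof.
  intros Hy H1 H2. specialize (H1 y Hy). specialize (H2 y Hy).
  rewrite Cmod_mellin_kernel in *.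
  replace (Re (s + RtoC r) - 1) with ((Re s - 1) + r) in H1 by (destruct s; simpl; ring).
  replace (Re (s - RtoC r) - 1) with ((Re s - 1) + - r) in H2 by (destruct s; simpl; ring).
  rewrite Rpower_plus in H1, H2. unfold Rdiv in *. lra.
Qed.

(** Differentiation under the integral sign, with derivative the integral of [dker]. The remainder
    is the kernel times [Cexp v - 1 - v] at [v = h ln y]; for [Cmod h < 1] it is of order
    [Cmod h ^ 2] times [y ^ 2 + y ^ (- 2)], which [shift_bound] absorbs. *)
Lemma mellin_hol : hol mellin.
Proof.
  intros s.
  destruct (Hdom (s + RtoC 1)) as [A1 HA1]. destruct (Hdom (s - RtoC 1)) as [A2 HA2].
  destruct (Hdom (s + RtoC 2)) as [B1 HB1]. destruct (Hdom (s - RtoC 2)) as [B2 HB2].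
  assert (R1 : forall y, 0 < y -> exp (Rabs (ln y)) <= Rpower y 1 + Rpower y (- (1))).
  { intros y Hy. rewrite Rpower_Ropp, Rpower_1 by exact Hy. now apply exp_abs_ln. }
  assert (Hdc : continuous_pos (dker s)).
  { apply continuous_pos_Cmult; [apply continuous_pos_ln|apply mellin_kernel_continuous]. }
  assert (Hdd : dominated (A1 + A2) (dker s)).
  { intros y Hy. unfold dker. rewrite Cmod_mult, Cmod_R, Rmult_comm.
    eapply Rle_trans; [|apply (shift_bound s 1 A1 A2 y Hy HA1 HA2)].
    apply Rmult_le_compat_l; [apply Cmod_ge_0|].
    eapply Rle_trans; [|apply R1, Hy]. pose proof (exp_ineq1_le (Rabs (ln y))). lra. }
  destruct (dominated_int_conv _ _ Hdc Hdd) as [D HD].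
  exists D. intros eps Heps.
  (* 20 is the 5 of [Cexp_sub_bound] times the 4 of [L ^ 2 <= 4 * exp L], where
     [L = Rabs (ln y)]. *)
  set (Q := 20 * (B1 + B2)).
  assert (HQ : 0 <= B1 + B2).
  { pose proof (dominated_nonneg _ _ HB1). pose proof (dominated_nonneg _ _ HB2). lra. }
  set (d := Rmin 1 (eps / (2 * Q + 1))).
  assert (Hq : 0 < eps / (2 * Q + 1)) by (apply Rdiv_lt_0_compat; unfold Q; lra).
  exists d. split; [apply Rmin_glb_lt; lra|]. intros h Hh.
  assert (h1 : Cmod h < 1) by (eapply Rlt_le_trans; [apply Hh|apply Rmin_l]).
  assert (h2 : Cmod h < eps / (2 * Q + 1)) by (eapply Rlt_le_trans; [apply Hh|apply Rmin_r]).
  pose proof (Cmod_ge_0 h) as h0.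
  assert (Hpt : dominated (Q * Cmod h ^ 2)
    (fun y => mellin_kernel g (s + h) y + (RtoC (-1) * mellin_kernel g s y + - h * dker s y))%C).
  { intros y Hy. unfold dker.
    replace (mellin_kernel g (s + h) y) with (mellin_kernel g s y * Cexp (h * RtoC (ln y)))%C.
    2: { unfold mellin_kernel. change (Cexp (h * RtoC (ln y))) with (Rcpow y h).
         rewrite <- Cmult_assoc, <- Rcpow_plus. do 2 f_equal. ring. }
    set (v := (h * RtoC (ln y))%C).
    replace (mellin_kernel g s y * Cexp v + (RtoC (-1) * mellin_kernel g s y + - h * (RtoC (ln y) * mellin_kernel g s y)))%C
      with (mellin_kernel g s y * (Cexp v - 1 - v))%C by (unfold v; rewrite RtoC_m1; ring).
    rewrite Cmod_mult.
    assert (Hv : Cmod v = Cmod h * Rabs (ln y)) by (unfold v; now rewrite Cmod_mult, Cmod_R).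
    set (L := Rabs (ln y)) in *. assert (HL : 0 <= L) by apply Rabs_pos.
    assert (B : Cmod (Cexp v - 1 - v) <= 20 * Cmod h ^ 2 * (Rpower y 2 + Rpower y (- (2)))).
    { eapply Rle_trans; [apply Cexp_sub_bound|]. rewrite Hv.
      assert (E1 : exp (Cmod h * L) <= exp L) by (apply exp_le; nra).
      assert (E2 : L ^ 2 <= 4 * exp L).
      { pose proof (exp_ineq1_le (L / 2)) as E. assert (EL : exp L = exp (L / 2) * exp (L / 2)) by (rewrite <- exp_plus; f_equal; field).
        rewrite EL. nra. }
      assert (E3 : exp L * exp L <= Rpower y 2 + Rpower y (- (2))).
      { rewrite <- exp_plus. unfold Rpower, L, Rabs. destruct (Rcase_abs (ln y)).
        - replace (- ln y + - ln y) with (- (2) * ln y) by ring. pose proof (exp_pos (2 * ln y)). lra.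
        - replace (ln y + ln y) with (2 * ln y) by ring. pose proof (exp_pos (- (2) * ln y)). lra. }
      pose proof (exp_pos (Cmod h * L)).
      assert (0 <= Cmod h ^ 2) by apply pow2_ge_0.
      apply Rle_trans with (5 * (Cmod h ^ 2 * (4 * exp L)) * exp L).
      - rewrite Rpow_mult_distr. apply Rmult_le_compat; [nra|lra| |exact E1].
        apply Rmult_le_compat_l; [lra|]. apply Rmult_le_compat_l; lra.
      - replace (5 * (Cmod h ^ 2 * (4 * exp L)) * exp L) with (20 * Cmod h ^ 2 * (exp L * exp L)) by ring.
        apply Rmult_le_compat_l; lra. }
    pose proof (shift_bound s 2 B1 B2 y Hy HB1 HB2) as SB.
    pose proof (Cmod_ge_0 (mellin_kernel g s y)).
    apply Rle_trans with (20 * Cmod h ^ 2 * (Cmod (mellin_kernel g s y) * (Rpower y 2 + Rpower y (- (2))))).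
    - replace (20 * Cmod h ^ 2 * (Cmod (mellin_kernel g s y) * (Rpower y 2 + Rpower y (- (2)))))
        with (Cmod (mellin_kernel g s y) * (20 * Cmod h ^ 2 * (Rpower y 2 + Rpower y (- (2))))) by ring.
      now apply Rmult_le_compat_l.
    - unfold Q. assert (0 <= Cmod h ^ 2) by apply pow2_ge_0.
      replace (20 * (B1 + B2) * Cmod h ^ 2 / (1 + y ^ 2)) with (20 * Cmod h ^ 2 * ((B1 + B2) / (1 + y ^ 2)))
        by (unfold Rdiv; ring).
      apply Rmult_le_compat_l; lra. }
  assert (C1 : continuous_pos (fun y => RtoC (-1) * mellin_kernel g s y)%C)
    by (apply continuous_pos_Cmult; [apply continuous_pos_const|apply mellin_kernel_continuous]).
  assert (C2 : continuous_pos (fun y => - h * dker s y)%C)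
    by (apply continuous_pos_Cmult; [apply continuous_pos_const|exact Hdc]).
  assert (C3 : continuous_pos (fun y => RtoC (-1) * mellin_kernel g s y + - h * dker s y)%C)
    by now apply continuous_pos_plus.
  assert (HB : Cmod (mellin (s + h) + (RtoC (-1) * mellin s + - h * D))%C <= 2 * (Q * Cmod h ^ 2)).
  { apply (int_conv_bound _ (fun y => mellin_kernel g (s + h) y + (RtoC (-1) * mellin_kernel g s y + - h * dker s y))%C).
    - apply continuous_pos_plus; [apply mellin_kernel_continuous|exact C3].
    - exact Hpt.
    - apply int_conv_plus; [apply mellin_kernel_continuous|exact C3|apply mellin_int_conv|].
      apply int_conv_plus; [exact C1|exact C2| |].
      + apply int_conv_Cmult; [apply mellin_kernel_continuous|apply mellin_int_conv].
      + now apply int_conv_Cmult. }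
  replace (mellin (s + h) - mellin s - D * h)%C with (mellin (s + h) + (RtoC (-1) * mellin s + - h * D))%C
    by (rewrite RtoC_m1; ring).
  eapply Rle_trans; [exact HB|].
  assert (Hqh : (2 * Q + 1) * Cmod h <= eps).
  { apply Rle_trans with ((2 * Q + 1) * (eps / (2 * Q + 1))).
    - apply Rmult_le_compat_l; unfold Q in *; lra.
    - right; field; unfold Q; lra. }
  simpl. nra.
Qed.
End MellinEntire.

(** * The expansion of the completed L-function *)

(** The substitution [x = exp (- 2 * PI * y)], with the common factor [x ^ theta] divided out. *)
Lemma exp_series_power (b : nat -> R) (theta : R) (v : R -> R) :
  (forall y, 0 < y -> is_series (fun n => b n * exp (- (2 * PI * (INR n + theta) * y))) (v y)) ->
  disk_series b /\
  forall x, 0 < x < 1 -> 0 < - ln x / (2 * PI) /\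
    PSeries b x = exp (- (theta * ln x)) * v (- ln x / (2 * PI)).
Proof.
  intros H. pose proof PI_RGT_0 as HPI.
  assert (Hs : forall x, 0 < x < 1 -> 0 < - ln x / (2 * PI) /\
    is_series (fun n => b n * x ^ n) (exp (- (theta * ln x)) * v (- ln x / (2 * PI)))).
  { intros x Hx.
    assert (Hln : ln x < 0) by (rewrite <- ln_1; apply ln_increasing; lra).
    assert (Hy : 0 < - ln x / (2 * PI)) by (apply Rdiv_lt_0_compat; lra).
    split; [exact Hy|]. specialize (H _ Hy).
    apply (is_series_scal (exp (- (theta * ln x)))) in H.
    refine (is_series_ext _ _ _ _ H). intros n.
    change (exp (- (theta * ln x)) * (b n * exp (- (2 * PI * (INR n + theta) * (- ln x / (2 * PI))))) = b n * x ^ n).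
    replace (- (2 * PI * (INR n + theta) * (- ln x / (2 * PI)))) with (INR n * ln x + theta * ln x) by (field; lra).
    rewrite exp_plus, exp_INR_mult, exp_ln by lra.
    replace (exp (- (theta * ln x)) * (b n * (x ^ n * exp (theta * ln x))))
      with (b n * x ^ n * (exp (- (theta * ln x)) * exp (theta * ln x))) by ring.
    rewrite <- exp_plus, Rplus_opp_l, exp_0. ring. }
  split.
  - apply disk_series_of_ex. intros x Hx. eexists. apply (Hs x Hx).
  - intros x Hx. destruct (Hs x Hx) as [H1 H2]. split; [exact H1|].
    apply is_series_unique. exact H2.
Qed.

Lemma exp_series_zero (b : nat -> R) (theta : R) :
  (forall y, 0 < y -> is_series (fun n => b n * exp (- (2 * PI * (INR n + theta) * y))) 0) ->
  forall n, b n = 0.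
Proof.
  intros H. destruct (exp_series_power b theta (fun _ => 0) H) as [H1 H2].
  apply disk_series_zero; [exact H1|]. intros x Hx. destruct (H2 x Hx) as [_ ->]. ring.
Qed.

(** The imaginary parts form a series of the same kind with sum zero, so they vanish by the identity
    theorem. This reduces all coefficient work to real series. *)
Lemma real_exp_series (b : nat -> C) (theta : R) (v : R -> R) :
  (forall y, 0 < y -> C_series (fun n => b n * RtoC (exp (- (2 * PI * (INR n + theta) * y))))%C (RtoC (v y))) ->
  (forall n, b n = RtoC (Re (b n))) /\
  (forall y, 0 < y -> is_series (fun n => Re (b n) * exp (- (2 * PI * (INR n + theta) * y))) (v y)).
Proof.
  intros H. split.
  - intros n. assert (Hi : Im (b n) = 0).
    { revert n. apply (exp_series_zero _ theta). intros y Hy.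
      refine (is_series_ext _ _ _ _ (C_series_Im _ _ (H y Hy))).
      intros n. apply im_scal_r. }
    destruct (b n) as [u w]. simpl in *. now rewrite Hi.
  - intros y Hy. refine (is_series_ext _ _ _ _ (C_series_Re _ _ (H y Hy))).
    intros n. apply re_scal_r.
Qed.

Lemma Rpower_continuous (u : R -> R) (r y : R) : 0 < u y -> continuous u y ->
  continuous (fun y => Rpower (u y) r) y.
Proof.
  intros Hp Hu. apply (continuous_comp u (fun t => Rpower t r)); [exact Hu|].
  apply (ex_derive_continuous (fun t => Rpower t r)). unfold Rpower. auto_derive. exact Hp.
Qed.

Section Main.
Variables (k q : nat) (f : C -> C) (a : nat -> C) (L : C -> C).
Hypotheses (hk4 : Nat.divide 4 k) (hq : (0 < q)%nat)
  (hf : forall z, upper z -> C_differentiable f z)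
  (ha : fourier_expansion f a) (ha1 : a 1%nat = RtoC 1)
  (hW : forall z : C, upper z -> fricke k q f z = f z)
  (hpos : positive_on_axis f) (hL : completed_L k q a L).

Let Q : R := sqrt (INR q).
Let c : R := 2 * PI / Q.
Let g (y : R) : R := on_axis f (y / Q).
(** The index is shifted so that these are the coefficients of [f / X], with constant term 1. *)
Let A (n : nat) : R := Re (a (S n)).

Lemma q_pos : 0 < INR q.
Proof. apply lt_0_INR. exact hq. Qed.

Lemma Q_pos : 0 < Q.
Proof. apply sqrt_lt_R0, q_pos. Qed.

Lemma c_pos : 0 < c.
Proof. apply Rdiv_lt_0_compat; [pose proof PI_RGT_0; lra|apply Q_pos]. Qed.

Lemma f_on_axis (y : R) : 0 < y -> f (0, y) = RtoC (on_axis f y).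
Proof.
  intros Hy. destruct (hpos y Hy) as [H _]. unfold on_axis.
  destruct (f (0, y)) as [u v]. simpl in *. now rewrite H.
Qed.

Lemma axis_series (y : R) : 0 < y ->
  C_series (fun n => a (S n) * RtoC (exp (- (2 * PI * (INR n + 1) * y))))%C (RtoC (on_axis f y)).
Proof.
  intros Hy. rewrite <- f_on_axis by exact Hy.
  refine (C_series_ext _ _ _ _ (ha (0, y) Hy)). intros n. f_equal.
  rewrite <- Cexp_RtoC. f_equal. rewrite S_INR.
  apply injective_projections; simpl; ring.
Qed.

Lemma A_real (n : nat) : a (S n) = RtoC (A n).
Proof. apply (real_exp_series (fun n => a (S n)) 1 (on_axis f) axis_series). Qed.

Lemma A_series (y : R) : 0 < y ->
  is_series (fun n => A n * exp (- (2 * PI * (INR n + 1) * y))) (on_axis f y).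
Proof. apply (real_exp_series (fun n => a (S n)) 1 (on_axis f) axis_series). Qed.

Lemma A_disk : disk_series A.
Proof. apply (exp_series_power A 1 (on_axis f) A_series). Qed.

Lemma A_PSeries (x : R) : 0 < x < 1 -> 0 < - ln x / (2 * PI) /\
  PSeries A x = exp (- (1 * ln x)) * on_axis f (- ln x / (2 * PI)).
Proof. apply (exp_series_power A 1 (on_axis f) A_series). Qed.

Lemma A_PSeries_pos (x : R) : 0 < x < 1 -> 0 < PSeries A x.
Proof.
  intros Hx. destruct (A_PSeries x Hx) as [Hy ->].
  apply Rmult_lt_0_compat; [apply exp_pos|]. now apply hpos.
Qed.

Lemma A_0 : A 0%nat = 1.
Proof. unfold A. rewrite ha1. reflexivity. Qed.

(* The Dirichlet series of [f] converges at [(k + 3) / 2], hence its terms are bounded. *)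
Lemma A_bound : exists K, 0 <= K /\ forall n, Rabs (A n) <= K * (INR n + 1) ^ (k + 2).
Proof.
  set (r := (INR k + 1) / 2 + 1). pose proof (pos_INR k) as Hk.
  destruct hL as [_ hD]. destruct (hD (RtoC r)) as [D [HD _]]; [simpl; unfold r; lra|].
  apply C_series_Re in HD.
  assert (Hs : ex_series (fun n => A n * Rpower (INR n + 1) (- r))).
  { exists (Re D). refine (is_series_ext _ _ _ _ HD). intros n.
    rewrite <- RtoC_opp, Rcpow_RtoC, S_INR. apply re_scal_r. }
  pose proof (ex_series_lim_0 _ Hs) as Hlim. apply is_lim_seq_Reals in Hlim.
  destruct (maj_by_pos (fun n => A n * Rpower (INR n + 1) (- r))) as [M [HM HB]].
  { exists 0. exact Hlim. }
  exists M. split; [lra|]. intros n. specialize (HB n). pose proof (pos_INR n) as Hn.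
  rewrite Rabs_mult, (Rabs_pos_eq (Rpower _ _)) in HB by (left; apply exp_pos).
  assert (E : Rpower (INR n + 1) (- r) * Rpower (INR n + 1) r = 1).
  { rewrite <- Rpower_plus, Rplus_opp_l. apply Rpower_O. lra. }
  assert (Hp : 0 < Rpower (INR n + 1) r) by apply exp_pos.
  apply Rle_trans with (M * Rpower (INR n + 1) r).
  - replace (Rabs (A n)) with (Rabs (A n) * Rpower (INR n + 1) (- r) * Rpower (INR n + 1) r)
      by (rewrite Rmult_assoc, E; ring).
    apply Rmult_le_compat_r; lra.
  - apply Rmult_le_compat_l; [lra|]. apply Rpower_le_exp; [lra|].
    unfold r. rewrite plus_INR. simpl (INR 2). lra.
Qed.

(** In the variable [X] the powers [X ^ alpha] and [X] split off, and the hypothesis says that the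
    series of [c] is the [alpha]-th power of the series of [A] for [0 < X < 1]; [power_coeff_bound]
    then applies. *)
Lemma c_coeff_expansion (alpha : R) : 0 < alpha <= 1 -> power_expansion f a alpha ->
  (forall m, c_coeff a alpha m = RtoC (Re (c_coeff a alpha m))) /\
  (forall y, 0 < y -> is_series (fun m => Re (c_coeff a alpha m) * exp (- (2 * PI * (INR m + alpha) * y)))
     (Rpower (on_axis f y) alpha)) /\
  exists K N, 0 <= K /\ forall m, Rabs (Re (c_coeff a alpha m)) <= K * (INR m + 1) ^ N.
Proof.
  intros Hal Hexp.
  destruct (real_exp_series _ alpha _ Hexp) as [H1 H2]. split; [exact H1|]. split; [exact H2|].
  destruct (exp_series_power _ alpha _ H2) as [H3 H4].
  destruct A_bound as [K [HK HA]].
  destruct (power_coeff_bound A (fun m => Re (c_coeff a alpha m)) alpha K (k + 2) Hal A_disk H3 A_0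
    A_PSeries_pos) as [K' [HK' HB]].
  - intros x Hx. destruct (H4 x Hx) as [Hy ->]. destruct (A_PSeries x Hx) as [_ ->].
    destruct (hpos _ Hy) as [_ Hp]. unfold Rpower.
    rewrite ln_mult by (try apply exp_pos; exact Hp). rewrite ln_exp, <- exp_plus. f_equal. ring.
  - exact HA.
  - exists K', (k + 2 + 2)%nat. auto.
Qed.

Lemma g_pos (y : R) : 0 < y -> 0 < g y.
Proof. intros Hy. apply hpos. apply Rdiv_lt_0_compat; [exact Hy|apply Q_pos]. Qed.

Lemma g_continuous (y : R) : 0 < y -> continuous g y.
Proof.
  intros Hy. pose proof Q_pos as HQ.
  assert (Hu : upper (0, y / Q)) by (apply Rdiv_lt_0_compat; assumption).
  pose proof (cdiff_continuous f _ (C_differentiable_cdiff f _ (hf _ Hu))) as Hc.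
  apply filterlim_locally. intros eps. destruct (Hc eps (cond_pos eps)) as [d [Hd H]].
  assert (HdQ : 0 < d * Q) by now apply Rmult_lt_0_compat.
  exists (mkposreal _ HdQ). intros z Hz. change (Rabs (z - y) < d * Q) in Hz.
  change (Rabs (g z - g y) < eps).
  specialize (H (Ci * RtoC ((z - y) / Q))%C).
  assert (E : ((0, (y / Q)%R) + Ci * RtoC ((z - y) / Q))%C = (0, z / Q)).
  { apply injective_projections; simpl; field; lra. }
  rewrite E in H.
  eapply Rle_lt_trans; [|apply H].
  - unfold g, on_axis. apply (re_le_Cmod (f (0, (z / Q)%R) - f (0, (y / Q)%R))).
  - rewrite Cmod_mult, Cmod_Ci, Rmult_1_l, Cmod_R. unfold Rdiv.
    rewrite Rabs_mult, (Rabs_pos_eq (/ Q)) by (left; now apply Rinv_0_lt_compat).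
    apply Rmult_lt_reg_r with Q; [exact HQ|]. field_simplify; lra.
Qed.

Lemma Ci_pow4 : (Ci ^ 4)%C = RtoC 1.
Proof. apply injective_projections; simpl; ring. Qed.

(** Here [k] divisible by 4 enters: the automorphy factor on the axis is real and positive. *)
Lemma pow_Ci_mul (y : R) : ((0, y) ^ k)%C = RtoC (y ^ k).
Proof.
  replace (0, y) with (Ci * RtoC y)%C by (apply injective_projections; simpl; ring).
  rewrite Cpow_mult_l, RtoC_pow. destruct hk4 as [j ->].
  rewrite (Nat.mul_comm j 4), (Cpow_mult_r Ci 4 j), Ci_pow4, Cpow_1_l. ring.
Qed.

(** At [z = i y / Q] the point [- 1 / (q z)] is [i / (y Q)], and [q ^ (- k / 2)] cancels the [Q ^ k]
    from [z ^ (- k)]. *)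
Lemma g_fricke (y : R) : 0 < y -> g (/ y) = y ^ k * g y.
Proof.
  intros Hy. pose proof Q_pos as HQ. pose proof q_pos as Hq0.
  assert (HQ2 : Q * Q = INR q) by (apply sqrt_sqrt; lra).
  assert (Hyq : 0 < y / Q) by now apply Rdiv_lt_0_compat.
  pose proof (hW (0, y / Q) Hyq) as H. unfold fricke in H.
  rewrite pow_Ci_mul, f_on_axis in H by exact Hyq.
  assert (E : (- (RtoC 1 / (RtoC (INR q) * (0, (y / Q)%R))))%C = (0, / y / Q)).
  { rewrite <- HQ2. apply injective_projections; simpl; field; repeat split; nra. }
  rewrite E in H. rewrite f_on_axis in H by (apply Rdiv_lt_0_compat; [now apply Rinv_0_lt_compat|exact HQ]).
  assert (Hpk : 0 < (y / Q) ^ k) by now apply pow_lt.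
  rewrite <- RtoC_inv in H by lra. rewrite <- !RtoC_mult in H. apply RtoC_inj in H.
  fold (g (/ y)) in H. fold (g y) in H. rewrite <- H.
  assert (Ep : Rpower (INR q) (- (INR k / 2)) = / Q ^ k).
  { rewrite Rpower_Ropp. f_equal. rewrite <- Rpower_pow by exact HQ. unfold Rpower. f_equal.
    rewrite <- HQ2, ln_mult by exact HQ. field. }
  rewrite Ep. unfold Rdiv. rewrite Rpow_mult_distr, pow_inv.
  assert (0 < y ^ k) by now apply pow_lt. assert (0 < Q ^ k) by now apply pow_lt.
  field; repeat split; apply Rgt_not_eq; assumption.
Qed.

(** Writing [g = g ^ alpha * g ^ beta] and moving the second factor to [/ y] produces
    [y ^ (k * beta)], the origin of the shift [s - k * beta] in the Bessel index. *)
Lemma g_split (alpha beta : R) (s : C) (y : R) : alpha + beta = 1 -> 0 < y ->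
  (RtoC (Rpower (g y) alpha * Rpower (g (/ y)) beta) * Rcpow y (s - RtoC (INR k * beta) - RtoC 1))%C
  = mellin_kernel g s y.
Proof.
  intros Hab Hy. unfold mellin_kernel.
  pose proof (g_pos y Hy) as Hg.
  assert (Hyk : 0 < y ^ k) by now apply pow_lt.
  assert (E : Rpower (g y) alpha * Rpower (g (/ y)) beta = Rpower y (INR k * beta) * g y).
  { rewrite g_fricke by exact Hy. rewrite <- Rpower_mult_distr by assumption.
    rewrite <- Rpower_pow by exact Hy. rewrite Rpower_mult.
    transitivity (Rpower y (INR k * beta) * (Rpower (g y) alpha * Rpower (g y) beta)); [ring|].
    rewrite <- Rpower_plus, Hab, Rpower_1 by exact Hg. reflexivity. }
  rewrite E, RtoC_mult, <- Rcpow_RtoC.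
  transitivity (RtoC (g y) * (Rcpow y (RtoC (INR k * beta)) * Rcpow y (s - RtoC (INR k * beta) - RtoC 1)))%C; [ring|].
  rewrite <- Rcpow_plus. do 2 f_equal. ring.
Qed.
Lemma g_continuous_pos : continuous_pos (fun y => RtoC (g y)).
Proof. apply continuous_pos_RtoC_continuous, g_continuous. Qed.

Lemma g_Rpower_series (b : nat -> R) (theta r : R) :
  (forall y, 0 < y -> is_series (fun n => b n * exp (- (2 * PI * (INR n + theta) * y))) (Rpower (on_axis f y) r)) ->
  forall y, 0 < y -> is_series (fun n => b n * exp (- (c * (INR n + theta) * y))) (Rpower (g y) r).
Proof.
  intros H y Hy. pose proof Q_pos as HQ.
  refine (is_series_ext _ _ _ _ (H (y / Q) _)); [|now apply Rdiv_lt_0_compat].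
  intros n. do 2 f_equal. unfold c. field. lra.
Qed.

Lemma mellin_kernel_series (s : C) (y : R) : 0 < y ->
  C_series (fun n => RtoC (A n) * (RtoC (exp (- (c * (INR n + 1) * y))) * Rcpow y (s - RtoC 1)))%C
    (mellin_kernel g s y).
Proof.
  intros Hy. pose proof (g_pos y Hy) as Hg.
  assert (HS : is_series (fun n => A n * exp (- (c * (INR n + 1) * y))) (g y)).
  { rewrite <- (Rpower_1 (g y)) by exact Hg. apply g_Rpower_series; [|exact Hy].
    intros z Hz. rewrite Rpower_1 by now apply hpos. now apply A_series. }
  apply is_series_RtoC, (C_series_Cmult (Rcpow y (s - RtoC 1))) in HS.
  unfold mellin_kernel. rewrite (Cmult_comm (RtoC (g y))).
  refine (C_series_ext _ _ _ _ HS). intros n. rewrite RtoC_mult. ring.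
Qed.

(** Termwise integration of the Fourier series, each term giving a Gamma integral. The domination
    premise for all [s] is supplied later by the double series. *)
Lemma L_eq_mellin_right (s : C) : (forall s, exists M, dominated M (mellin_kernel g s)) ->
  INR (k + 5) < Re s -> L s = mellin g s.
Proof.
  intros Hdom Hs. rewrite plus_INR in Hs. simpl (INR 5) in Hs. pose proof (pos_INR k) as Hk.
  pose proof c_pos as Hc. pose proof Q_pos as HQ. pose proof q_pos as Hq0.
  destruct A_bound as [K [HK HA]].
  destruct (poly_exp_decay (k + 2) c Hc) as [K1 [HK1 H1]].
  (* The exponent left after [poly_exp_decay] has spent [y ^ (- (k + 4))]; the bound [k + 5] on
     [Re s] is what makes it non-negative. *)
  set (p := Re s - 1 - INR (k + 2 + 2)).
  assert (Hp : 0 <= p).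
  { unfold p. rewrite !plus_INR. simpl (INR 2). lra. }
  destruct (power_exp_bounded p (c / 2) Hp ltac:(lra)) as [K2 [HK2 H2]].
  set (u := fun n y => (RtoC (A n) * (RtoC (exp (- (c * (INR n + 1) * y))) * Rcpow y (s - RtoC 1)))%C).
  set (l := fun n => (RtoC (A n) * (Gamma s * Rcpow (c * (INR n + 1)) (- s)))%C).
  assert (Hcn : forall n, 0 < c * (INR n + 1)).
  { intros n. apply Rmult_lt_0_compat; [exact Hc|]. pose proof (pos_INR n); lra. }
  assert (Hcont : forall n, continuous_pos (fun y => RtoC (exp (- (c * (INR n + 1) * y))) * Rcpow y (s - RtoC 1))%C).
  { intros n. apply continuous_pos_Cmult; [|apply continuous_pos_Rcpow].
    apply (continuous_pos_RtoC (fun y => exp (- (c * (INR n + 1) * y)))). intros; auto_derive; easy. }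
  destruct (series_int_exchange u (mellin_kernel g s) l (fun n => K * K1 * K2 * / (INR n + 1) ^ 2)) as [_ [L' [HL' Hser]]].
  - intros n. apply continuous_pos_Cmult; [apply continuous_pos_const|apply Hcont].
  - apply mellin_kernel_continuous, g_continuous_pos.
  - intros n y Hy. unfold u. rewrite !Cmod_mult, !Cmod_R, Cmod_Rcpow.
    rewrite (Rabs_pos_eq (exp _)) by (left; apply exp_pos).
    replace (Re (s - RtoC 1)) with (Re s - 1) by (destruct s; simpl; ring).
    specialize (H1 n y Hy). specialize (H2 y Hy). specialize (HA n).
    pose proof (pos_INR n) as Hn.
    assert (Hn2 : 0 < / (INR n + 1) ^ 2) by (apply Rinv_0_lt_compat, pow_lt; lra).
    set (X := exp (- (c * (INR n + 1) * y))) in *. assert (HX : 0 < X) by apply exp_pos.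
    set (Y := Rpower y (Re s - 1)). assert (HY : 0 < Y) by apply exp_pos.
    assert (HYp : (/ y) ^ (k + 2 + 2) * Y = Rpower y p).
    { unfold Y, p. rewrite pow_inv, <- (Rpower_pow _ y), <- Rpower_Ropp, <- Rpower_plus by exact Hy. f_equal. ring. }
    apply Rle_trans with (K * ((INR n + 1) ^ (k + 2) * X) * Y).
    + rewrite <- Rmult_assoc. apply Rmult_le_compat_r; [lra|].
      rewrite <- Rmult_assoc. apply Rmult_le_compat_r; lra.
    + apply Rle_trans with (K * (K1 * / (INR n + 1) ^ 2 * ((/ y) ^ (k + 2 + 2) * exp (- (c / 2 * y)))) * Y).
      * apply Rmult_le_compat_r; [lra|]. now apply Rmult_le_compat_l.
      * replace (K * (K1 * / (INR n + 1) ^ 2 * ((/ y) ^ (k + 2 + 2) * exp (- (c / 2 * y)))) * Y)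
          with (K * K1 * / (INR n + 1) ^ 2 * (((/ y) ^ (k + 2 + 2) * Y) * exp (- (c / 2 * y)))) by ring.
        rewrite HYp. replace (K * K1 * K2 * / (INR n + 1) ^ 2 / (1 + y ^ 2))
          with (K * K1 * / (INR n + 1) ^ 2 * (K2 / (1 + y ^ 2))) by (unfold Rdiv; ring).
        apply Rmult_le_compat_l; [|exact H2]. apply Rmult_le_pos; [now apply Rmult_le_pos|lra].
  - apply (ex_series_scal (V := R_NormedModule) (K * K1 * K2)). exact ex_series_inv_sq.
  - intros y Hy. now apply mellin_kernel_series.
  - intros n. apply int_conv_Cmult; [apply Hcont|]. apply int_conv_Gamma_scale; [lra|apply Hcn].
  - assert (HLm : mellin g s = L').
    { apply (int_conv_unique (mellin_kernel g s)).
      - apply mellin_kernel_continuous, g_continuous_pos.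
      - apply mellin_int_conv; [exact g_continuous_pos|exact Hdom].
      - exact HL'. }
    rewrite HLm. destruct hL as [_ hD]. destruct (hD s ltac:(lra)) as [D [HD HLs]]. rewrite HLs.
    apply (C_series_unique l); [|exact Hser].
    apply (C_series_Cmult (Rcpow (INR q) (s / RtoC 2) * Rcpow (2 * PI) (- s) * Gamma s)%C) in HD.
    refine (C_series_ext _ _ _ _ HD). intros n. unfold l. rewrite A_real, S_INR.
    pose proof PI_RGT_0. pose proof (pos_INR n).
    (* As [c = 2 * PI / Q], the power [c ^ (- s)] is the product of [(2 * PI) ^ (- s)] and
       [q ^ (s / 2)]. *)
    rewrite (Rcpow_mult c) by lra. unfold c, Rdiv.
    rewrite (Rcpow_mult (2 * PI) (/ Q)) by (try apply Rinv_0_lt_compat; lra).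
    rewrite (Rcpow_inv Q) by exact HQ. replace (- - s)%C with s by ring.
    replace (Rcpow (INR q) (s / RtoC 2)) with (Rcpow Q s); [ring|].
    unfold Rcpow. f_equal. replace (ln (INR q)) with (2 * ln Q).
    + rewrite RtoC_mult. field.
    + unfold Q. rewrite <- (sqrt_sqrt (INR q)) at 2 by lra. rewrite ln_mult by exact HQ. ring.
Qed.

Lemma L_eq_mellin (s : C) : (forall s, exists M, dominated M (mellin_kernel g s)) -> L s = mellin g s.
Proof.
  intros Hdom. assert (E : (L s - mellin g s)%C = RtoC 0).
  { apply (unique_continuation (fun s => L s - mellin g s)%C (INR (k + 5))).
    - intros z. apply cdiff_sub.
      + apply C_differentiable_cdiff. apply hL.
      + apply mellin_hol; [exact g_continuous_pos|exact Hdom].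
    - intros z Hz. rewrite (L_eq_mellin_right z Hdom Hz). ring. }
  replace (L s) with ((L s - mellin g s) + mellin g s)%C by ring. rewrite E. ring.
Qed.

(** * The Bessel double series *)

Section Expansion.
Variables (alpha beta : R).
Hypotheses (Halpha : 0 < alpha) (Hbeta : 0 < beta) (Hab : alpha + beta = 1)
  (Ealpha : power_expansion f a alpha) (Ebeta : power_expansion f a beta).

Let u (m : nat) : R := Re (c_coeff a alpha m).
Let v (n : nat) : R := Re (c_coeff a beta n).

Definition double_term (s : C) (m n : nat) (y : R) : C :=
  (RtoC (u m * v n) * (RtoC (exp (- (c * (INR m + alpha) * y)) * exp (- (c * (INR n + beta) / y)))
     * Rcpow y (s - RtoC (INR k * beta) - RtoC 1)))%C.

(** [poly_exp_decay] at [y] for the index [m] and at [/ y] for the index [n] yields both summable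
    weights. What remains is a power of [y] times decaying exponentials in [y] and in [/ y], bounded
    for every [s]. *)
Lemma double_term_dominated (s : C) : exists K, 0 <= K /\ forall m n,
  dominated (K * / (INR m + 1) ^ 2 * / (INR n + 1) ^ 2) (double_term s m n).
Proof.
  pose proof c_pos as Hc.
  destruct (c_coeff_expansion alpha ltac:(lra) Ealpha) as [_ [_ [K1 [N1 [HK1 Hu]]]]].
  destruct (c_coeff_expansion beta ltac:(lra) Ebeta) as [_ [_ [K2 [N2 [HK2 Hv]]]]].
  assert (Hca : 0 < c * alpha) by now apply Rmult_lt_0_compat.
  assert (Hcb : 0 < c * beta) by now apply Rmult_lt_0_compat.
  destruct (poly_exp_decay N1 (c * alpha) Hca) as [K3 [HK3 H3]].
  destruct (poly_exp_decay N2 (c * beta) Hcb) as [K4 [HK4 H4]].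
  set (sg := Re (s - RtoC (INR k * beta) - RtoC 1)).
  destruct (power_exp_exp_bounded (- INR (N1 + 2) + INR (N2 + 2) + sg) (c * alpha / 2) (c * beta / 2)
    ltac:(lra) ltac:(lra)) as [K5 [HK5 H5]].
  exists (K1 * K2 * K3 * K4 * K5). split; [repeat apply Rmult_le_pos; assumption|].
  intros m n y Hy. unfold double_term.
  rewrite !Cmod_mult, !Cmod_R, Cmod_Rcpow, !Rabs_mult, !(Rabs_pos_eq (exp _)) by (left; apply exp_pos).
  fold sg. specialize (Hu m). specialize (Hv n). fold (u m) in Hu. fold (v n) in Hv.
  pose proof (pos_INR m) as Hm. pose proof (pos_INR n) as Hn.
  assert (Hiy : 0 < / y) by now apply Rinv_0_lt_compat.
  specialize (H3 m y Hy). specialize (H4 n (/ y) Hiy). specialize (H5 y Hy).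
  rewrite Rinv_inv in H4.
  (* [m + alpha >= alpha * (m + 1)] because [alpha <= 1]. *)
  assert (E1 : exp (- (c * (INR m + alpha) * y)) <= exp (- (c * alpha * (INR m + 1) * y))).
  { apply exp_le, Ropp_le_contravar. apply Rmult_le_compat_r; [lra|]. rewrite Rmult_assoc.
    apply Rmult_le_compat_l; [lra|]. nra. }
  assert (E2 : exp (- (c * (INR n + beta) / y)) <= exp (- (c * beta * (INR n + 1) * / y))).
  { apply exp_le, Ropp_le_contravar. unfold Rdiv. apply Rmult_le_compat_r; [lra|]. rewrite Rmult_assoc.
    apply Rmult_le_compat_l; [lra|]. nra. }
  set (X1 := exp (- (c * (INR m + alpha) * y))) in *. set (X2 := exp (- (c * (INR n + beta) / y))) in *.
  assert (HX1 : 0 < X1) by apply exp_pos. assert (HX2 : 0 < X2) by apply exp_pos.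
  set (Y := Rpower y sg). assert (HY : 0 < Y) by apply exp_pos.
  set (im := / (INR m + 1) ^ 2) in *. set (iN := / (INR n + 1) ^ 2) in *.
  assert (Him : 0 < im) by (apply Rinv_0_lt_compat, pow_lt; lra).
  assert (HiN : 0 < iN) by (apply Rinv_0_lt_compat, pow_lt; lra).
  assert (B1 : Rabs (u m) * X1 <= K1 * (K3 * im * ((/ y) ^ (N1 + 2) * exp (- (c * alpha / 2 * y))))).
  { apply Rle_trans with (K1 * ((INR m + 1) ^ N1 * exp (- (c * alpha * (INR m + 1) * y)))).
    - rewrite <- Rmult_assoc. apply Rmult_le_compat; [apply Rabs_pos|lra|exact Hu|exact E1].
    - now apply Rmult_le_compat_l. }
  assert (B2 : Rabs (v n) * X2 <= K2 * (K4 * iN * (y ^ (N2 + 2) * exp (- (c * beta / 2 * / y))))).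
  { apply Rle_trans with (K2 * ((INR n + 1) ^ N2 * exp (- (c * beta * (INR n + 1) * / y)))).
    - rewrite <- Rmult_assoc. apply Rmult_le_compat; [apply Rabs_pos|lra|exact Hv|exact E2].
    - now apply Rmult_le_compat_l. }
  replace (Rabs (u m) * Rabs (v n) * (X1 * X2 * Y)) with ((Rabs (u m) * X1) * (Rabs (v n) * X2) * Y) by ring.
  assert (HP : (/ y) ^ (N1 + 2) * y ^ (N2 + 2) * Y = Rpower y (- INR (N1 + 2) + INR (N2 + 2) + sg)).
  { unfold Y. rewrite pow_inv, <- !(Rpower_pow _ y), <- Rpower_Ropp, <- !Rpower_plus by exact Hy. reflexivity. }
  apply Rle_trans with ((K1 * (K3 * im * ((/ y) ^ (N1 + 2) * exp (- (c * alpha / 2 * y)))))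
    * (K2 * (K4 * iN * (y ^ (N2 + 2) * exp (- (c * beta / 2 * / y))))) * Y).
  - apply Rmult_le_compat_r; [lra|]. apply Rmult_le_compat; [| |exact B1|exact B2].
    + apply Rmult_le_pos; [apply Rabs_pos|lra].
    + apply Rmult_le_pos; [apply Rabs_pos|lra].
  - replace ((K1 * (K3 * im * ((/ y) ^ (N1 + 2) * exp (- (c * alpha / 2 * y)))))
      * (K2 * (K4 * iN * (y ^ (N2 + 2) * exp (- (c * beta / 2 * / y))))) * Y)
      with (K1 * K2 * K3 * K4 * im * iN * (((/ y) ^ (N1 + 2) * y ^ (N2 + 2) * Y)
        * exp (- (c * alpha / 2 * y)) * exp (- (c * beta / 2 / y)))) by (unfold Rdiv; ring).
    rewrite HP.
    replace (K1 * K2 * K3 * K4 * K5 * im * iN / (1 + y ^ 2))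
      with (K1 * K2 * K3 * K4 * im * iN * (K5 / (1 + y ^ 2))) by (unfold Rdiv; ring).
    apply Rmult_le_compat_l; [|exact H5]. repeat apply Rmult_le_pos; try assumption; lra.
Qed.

(** The integral of [double_term s m n], in the form delivered by [int_conv_Bessel]. *)
Definition double_limit (s : C) (m n : nat) : C :=
  (RtoC (u m * v n) * (RtoC 2 * (Rcpow ((c * (INR n + beta)) / (c * (INR m + alpha))) ((s - RtoC (INR k * beta)) / RtoC 2)
     * BesselK (s - RtoC (INR k * beta)) (2 * sqrt ((c * (INR m + alpha)) * (c * (INR n + beta)))))))%C.

Lemma shift_pos (n : nat) (theta : R) : 0 < theta -> 0 < c * (INR n + theta).
Proof.
  intros Ht. apply Rmult_lt_0_compat; [apply c_pos|]. pose proof (pos_INR n). lra.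
Qed.

Lemma double_kernel_continuous (s : C) (m n : nat) : continuous_pos
  (fun y => RtoC (exp (- (c * (INR m + alpha) * y)) * exp (- (c * (INR n + beta) / y)))
     * Rcpow y (s - RtoC (INR k * beta) - RtoC 1))%C.
Proof.
  apply continuous_pos_Cmult; [|apply continuous_pos_Rcpow].
  apply (continuous_pos_RtoC (fun y => exp (- (c * (INR m + alpha) * y)) * exp (- (c * (INR n + beta) / y)))).
  intros y Hy. auto_derive. lra.
Qed.

(** The exchange is made twice, over [n] for fixed [m] and then over [m]; the majorant of the outer
    step is the sum of the inner ones. Domination of the Mellin kernel at every [s] comes out on the
    way. *)
Lemma double_series_mellin (s : C) :
  (exists M, dominated M (mellin_kernel g s)) /\
  exists L0, int_conv (mellin_kernel g s) L0 /\ C_double_series (double_limit s) L0.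
Proof.
  destruct (double_term_dominated s) as [K [HK Hd]].
  destruct (c_coeff_expansion alpha ltac:(lra) Ealpha) as [_ [Su _]].
  destruct (c_coeff_expansion beta ltac:(lra) Ebeta) as [_ [Sv _]].
  set (w := (s - RtoC (INR k * beta) - RtoC 1)%C).
  (* The inner sum over [n] in closed form: the expansion of [g (/ y) ^ beta] is resummed. *)
  set (U := fun m y => (RtoC (u m * exp (- (c * (INR m + alpha) * y)) * Rpower (g (/ y)) beta) * Rcpow y w)%C).
  assert (HgI : forall y, 0 < y -> continuous (fun y => Rpower (g (/ y)) beta) y).
  { intros y Hy. assert (Hiy : 0 < / y) by now apply Rinv_0_lt_compat.
    apply (Rpower_continuous (fun y => g (/ y))); [now apply g_pos|].
    apply (continuous_comp (fun y => / y) g); [|now apply g_continuous].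
    apply (ex_derive_continuous (fun y => / y)). auto_derive. lra. }
  assert (HU : forall m, continuous_pos (U m)).
  { intros m. apply continuous_pos_Cmult; [|apply continuous_pos_Rcpow].
    apply (continuous_pos_RtoC_continuous (fun y => u m * exp (- (c * (INR m + alpha) * y)) * Rpower (g (/ y)) beta)).
    intros y Hy. apply (continuous_mult (fun y => u m * exp (- (c * (INR m + alpha) * y)))); [|now apply HgI].
    apply (ex_derive_continuous (fun y => u m * exp (- (c * (INR m + alpha) * y)))). auto_derive. easy. }
  assert (Hin : forall m, dominated (Series (fun n => K * / (INR m + 1) ^ 2 * / (INR n + 1) ^ 2)) (U m) /\
    exists Lm, int_conv (U m) Lm /\ C_series (double_limit s m) Lm).
  { intros m. apply (series_int_exchange (double_term s m)).
    - intros n. apply continuous_pos_Cmult; [apply continuous_pos_const|apply double_kernel_continuous].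
    - apply HU.
    - intros n. apply Hd.
    - apply (ex_series_scal (V := R_NormedModule) (K * / (INR m + 1) ^ 2)). exact ex_series_inv_sq.
    - intros y Hy. assert (Hiy : 0 < / y) by now apply Rinv_0_lt_compat.
      pose proof (g_Rpower_series v beta beta Sv (/ y) Hiy) as H.
      apply is_series_RtoC, (C_series_Cmult (RtoC (u m * exp (- (c * (INR m + alpha) * y))) * Rcpow y w)%C) in H.
      unfold U. rewrite RtoC_mult.
      replace (RtoC (u m * exp (- (c * (INR m + alpha) * y))) * RtoC (Rpower (g (/ y)) beta) * Rcpow y w)%C
        with (RtoC (u m * exp (- (c * (INR m + alpha) * y))) * Rcpow y w * RtoC (Rpower (g (/ y)) beta))%C by ring.
      refine (C_series_ext _ _ _ _ H). intros n. unfold double_term. fold w. unfold Rdiv.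
      rewrite !RtoC_mult. ring.
    - intros n. unfold double_limit. apply int_conv_Cmult; [apply double_kernel_continuous|].
      apply int_conv_Bessel; now apply shift_pos. }
  (* [C_double_series] wants the inner sums as a sequence, whereas for each [m] only existence is
     known. *)
  destruct (choice (fun m Lm => int_conv (U m) Lm /\ C_series (double_limit s m) Lm) (fun m => proj2 (Hin m))) as [r Hr].
  set (Z := Series (fun n => / (INR n + 1) ^ 2)).
  destruct (series_int_exchange U (mellin_kernel g s) r (fun m => K * Z * / (INR m + 1) ^ 2)) as [HD [L0 [HL0 Hser]]].
  - exact HU.
  - apply mellin_kernel_continuous, g_continuous_pos.
  - intros m. replace (K * Z * / (INR m + 1) ^ 2) with (Series (fun n => K * / (INR m + 1) ^ 2 * / (INR n + 1) ^ 2)).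
    + apply Hin.
    + rewrite Series_scal_l. unfold Z. ring.
  - apply (ex_series_scal (V := R_NormedModule) (K * Z)). exact ex_series_inv_sq.
  - intros y Hy. pose proof (g_Rpower_series u alpha alpha Su y Hy) as H.
    apply is_series_RtoC, (C_series_Cmult (RtoC (Rpower (g (/ y)) beta) * Rcpow y w)%C) in H.
    rewrite <- (g_split alpha beta s y Hab Hy). fold w. rewrite RtoC_mult.
    replace (RtoC (Rpower (g y) alpha) * RtoC (Rpower (g (/ y)) beta) * Rcpow y w)%C
      with (RtoC (Rpower (g (/ y)) beta) * Rcpow y w * RtoC (Rpower (g y) alpha))%C by ring.
    refine (C_series_ext _ _ _ _ H). intros m. unfold U. rewrite !RtoC_mult. ring.
  - intros m. apply Hr.
  - split; [eexists; exact HD|]. exists L0. split; [exact HL0|].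
    exists r. split; [intros m; apply Hr|exact Hser].
Qed.

(** The factor 2 inside [double_limit] is moved out of the sum, and the Bessel argument is [2 * c]
    times the square root, with [2 * c = 4 * PI / sqrt q]. *)
Lemma bessel_double_series (s : C) : exists S : C,
  C_double_series (fun m n =>
    c_coeff a alpha m * c_coeff a beta n
    * Rcpow ((INR n + beta) / (INR m + alpha)) ((s - RtoC (INR k * beta)) / RtoC 2)
    * BesselK (s - RtoC (INR k * beta)) (4 * PI / sqrt (INR q) * sqrt ((INR m + alpha) * (INR n + beta))))%C S
  /\ L s = (RtoC 2 * S)%C.
Proof.
  assert (Hdom : forall s, exists M, dominated M (mellin_kernel g s))
    by (intros z; apply (double_series_mellin z)).
  destruct (double_series_mellin s) as [_ [L0 [HL0 [r [Hr HS]]]]].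
  assert (HL1 : L s = L0).
  { rewrite (L_eq_mellin s Hdom).
    apply (int_conv_unique (mellin_kernel g s)).
    - apply mellin_kernel_continuous, g_continuous_pos.
    - apply mellin_int_conv; [exact g_continuous_pos|exact Hdom].
    - exact HL0. }
  exists (RtoC (/ 2) * L0)%C. split.
  2: { rewrite HL1, Cmult_assoc, <- RtoC_mult. replace (2 * / 2) with 1 by field. ring. }
  exists (fun m => RtoC (/ 2) * r m)%C. split; [|now apply C_series_Cmult].
  intros m. pose proof (C_series_Cmult (RtoC (/ 2)) _ _ (Hr m)) as H.
  refine (C_series_ext _ _ _ _ H). intros n. unfold double_limit.
  destruct (c_coeff_expansion alpha ltac:(lra) Ealpha) as [Ru _].
  destruct (c_coeff_expansion beta ltac:(lra) Ebeta) as [Rv _].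
  rewrite (Ru m), (Rv n). fold (u m). fold (v n). rewrite RtoC_mult.
  pose proof c_pos as Hc. pose proof (pos_INR m) as Hm. pose proof (pos_INR n) as Hn. pose proof Q_pos as HQ.
  replace (c * (INR n + beta) / (c * (INR m + alpha))) with ((INR n + beta) / (INR m + alpha)) by (field; lra).
  replace (2 * sqrt (c * (INR m + alpha) * (c * (INR n + beta))))
    with (4 * PI / sqrt (INR q) * sqrt ((INR m + alpha) * (INR n + beta))).
  - replace (RtoC (/ 2)) with (/ RtoC 2)%C by (rewrite RtoC_inv; [reflexivity|lra]). field.
  - replace (c * (INR m + alpha) * (c * (INR n + beta))) with (c * c * ((INR m + alpha) * (INR n + beta))) by ring.
    rewrite (sqrt_mult (c * c)) by nra. rewrite sqrt_square by lra. unfold c. fold Q. field. lra.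
Qed.
End Expansion.
End Main.

Theorem theorem3
  (k q : nat) (hk : (0 < k)%nat) (hk4 : Nat.divide 4 k) (hq : (0 < q)%nat)
  (f : C -> C) (a : nat -> C)
  (hf : cusp_form k q f)
  (ha : fourier_expansion f a)
  (ha1 : a 1%nat = RtoC 1)
  (hW : forall z : C, upper z -> fricke k q f z = f z)
  (hpos : positive_on_axis f)
  (L : C -> C) (hL : completed_L k q a L) :
  (forall alpha beta : R, 0 < alpha -> 0 < beta -> alpha + beta = 1 ->
     power_expansion f a alpha -> power_expansion f a beta ->
     forall s : C, exists S : C,
       C_double_series (fun m n =>
         c_coeff a alpha m * c_coeff a beta n
         * Rcpow ((INR n + beta) / (INR m + alpha))
                 ((s - RtoC (INR k * beta)) / RtoC 2)
         * BesselK (s - RtoC (INR k * beta))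
                   (4 * PI / sqrt (INR q)
                    * sqrt ((INR m + alpha) * (INR n + beta))))%C S
       /\ L s = (RtoC 2 * S)%C)
  /\
  (power_expansion f a (1 / 2) ->
     forall s : C, exists S : C,
       C_double_series (fun m n =>
         c_coeff a (1 / 2) m * c_coeff a (1 / 2) n
         * Rcpow ((2 * INR n + 1) / (2 * INR m + 1))
                 (s / RtoC 2 - RtoC (INR k / 4))
         * BesselK (s - RtoC (INR k / 2))
                   (2 * PI / sqrt (INR q)
                    * sqrt ((2 * INR m + 1) * (2 * INR n + 1))))%C S
       /\ L s = (RtoC 2 * S)%C).
Proof.
  destruct hf as [hhol _]. split.
  { intros alpha beta H1 H2 H3 H4 H5 s. now apply (bessel_double_series k q f a L). }
  intros H s.
  destruct (bessel_double_series k q f a L hk4 hq hhol ha ha1 hW hpos hL (1 / 2) (1 / 2)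
    ltac:(lra) ltac:(lra) ltac:(lra) H H s) as [S [[r [Hr HS]] HL]].
  exists S. split; [|exact HL]. exists r. split; [|exact HS].
  intros m. refine (C_series_ext _ _ _ _ (Hr m)). intros n.
  pose proof (pos_INR m). pose proof (pos_INR n).
  assert (Hq : 0 < sqrt (INR q)) by (apply sqrt_lt_R0, lt_0_INR, hq).
  replace ((INR n + 1 / 2) / (INR m + 1 / 2)) with ((2 * INR n + 1) / (2 * INR m + 1)) by (field; lra).
  replace (INR k * (1 / 2)) with (INR k / 2) by field.
  replace ((s - RtoC (INR k / 2)) / RtoC 2)%C with (s / RtoC 2 - RtoC (INR k / 4))%C.
  2: { replace (INR k / 2) with (2 * (INR k / 4)) by field. rewrite RtoC_mult. field. }
  replace (4 * PI / sqrt (INR q) * sqrt ((INR m + 1 / 2) * (INR n + 1 / 2)))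
    with (2 * PI / sqrt (INR q) * sqrt ((2 * INR m + 1) * (2 * INR n + 1))); [reflexivity|].
  (* Doubling both half-integers brings a 2 out of the square root, which turns [4 * PI] into
     [2 * PI]. *)
  replace ((2 * INR m + 1) * (2 * INR n + 1)) with (2 * 2 * ((INR m + 1 / 2) * (INR n + 1 / 2))) by field.
  rewrite (sqrt_mult (2 * 2)) by nra. rewrite sqrt_square by lra. field. lra.
Qed.
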